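(* Consider two independent sequences of i.i.d. letters, of lengths $m\ge1$ and $n\ge 1$, drawn from the alphabet $\{0,1\}$ with $\mathbb{P}(0 \mbox{ appears})=p$, $\mathbb{P}(1 \mbox{ appears})=q$, where $p\in(0,1)$ and $p+q=1$. Let $X$ and $Y$ be the numbers of occurrences of $0$ in the first and second sequence, respectively (so $X\sim\mathrm{Bin}(m,p)$ and $Y\sim\mathrm{Bin}(n,p)$ are independent), and let $$D_2^*=\bigg(\frac{X-mp}{\sqrt{mpq}}\bigg)\bigg(\frac{Y-np}{\sqrt{npq}}\bigg).$$ Let $V\sim\mathrm{VG}(1,0,1,0)$. Then, for $h\in C_b^4(\mathbb{R})$, $$|\mathbb{E}h(D_2^* )-\mathbb{E}h(V)|\leq \bigg(179+4411\bigg|\sqrt{\frac{q}{p}}-\sqrt{\frac{p}{q}}\bigg|\bigg)\bigg(\frac{q^4}{p^3}+\frac{p^4}{q^3}\bigg)\bigg(\frac{1}{m}+\frac{1}{n}\bigg)\big(\|h^{(4)}\|+6\|h^{(3)}\|+7\|h''\|+\|h'\|\big).$$ Suppose now that $p=q=\frac{1}{2}$. Then, for $h\in C_b^3(\mathbb{R})$, $$|\mathbb{E}h(D_2^* )-\mathbb{E}h(V)|\leq 193\bigg(\frac{1}{m}+\frac{1}{n}\bigg)\big(\|h^{(3)}\|+3\|h''\|+\|h'\|\big),$$ and, since $D2z=D_2^*$ in this case, the same bound holds for $|\mathbb{E}h(D2z)-\mathbb{E}h(V)|$.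
   Context: $\mathrm{VG}(1,0,1,0)$ is the variance-gamma distribution with density $\frac{1}{\pi}K_0(|x|)$, $x\in\mathbb{R}$, where $K_0$ is the modified Bessel function of the second kind; equivalently it is the law of the product $Z_1Z_2$ of two independent standard normal random variables. $D_2=XY+(m-X)(n-Y)$ and $D2z=(D_2-\mathbb{E}D_2)/\sqrt{\mathrm{Var}(D_2)}$. $\|u\|$ denotes the (essential) supremum of $|u|$ over $\mathbb R$. $h\in C_b^k(\mathbb{R})$ means that $h^{(k-1)}$ exists and is absolutely continuous (locally), and $h',\ldots,h^{(k)}$ are bounded ($h$ itself need not be bounded). *)

(* Defs.v *)
From mathcomp Require Export all_boot all_order all_algebra.
From mathcomp Require Export all_classical all_reals all_analysis.
From mathcomp Require Export ess_sup_inf.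
Export Order.TTheory GRing.Theory Num.Theory.
Export numFieldNormedType.Exports.

Set Implicit Arguments.
Unset Strict Implicit.
Unset Printing Implicit Defensive.

#[export] Set Implicit Arguments.
#[export] Unset Strict Implicit.
#[export] Unset Printing Implicit Defensive.

Local Open Scope classical_set_scope.
Local Open Scope ring_scope.

Definition mutually_independent (R : realType) (d d' : measure_display)
    (Omega : measurableType d) (T : measurableType d')
    (P : probability Omega R) (I : finType) (X : I -> {RV P >-> T}) : Prop :=
  forall (J : {set I}) (E : I -> set T), (forall i, measurable (E i)) ->
    P (\bigcap_(i in [set` J]) (X i @^-1` E i)) =
    (\prod_(i in J) P (X i @^-1` E i))%E.

(* The alphabet {0, 1} is [bool]: [false] is the letter 0, [true] is the
   letter 1. *)
Definition iid_letters (R : realType) (d : measure_display)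
    (Omega : measurableType d) (P : probability Omega R) (p q : R)
    (I : finType) (L : I -> {RV P >-> bool}) : Prop :=
  mutually_independent L /\
  forall i, P [set w | L i w = false] = p%:E /\
            P [set w | L i w = true] = q%:E.

(* Two independent sequences of i.i.d. letters with the same letter law amount
   to one i.i.d. family, indexed by the disjoint union of the positions. *)
Definition independent_letter_sequences (R : realType) (d : measure_display)
    (Omega : measurableType d) (P : probability Omega R) (p q : R) (m n : nat)
    (A : 'I_m -> {RV P >-> bool}) (B : 'I_n -> {RV P >-> bool}) : Prop :=
  iid_letters p q
    (fun k : 'I_m + 'I_n => match k with inl i => A i | inr j => B j end).

Definition zeros (R : realType) (Omega : Type) (m : nat)
    (A : 'I_m -> Omega -> bool) (w : Omega) : R :=
  #|[pred i | A i w == false]|%:R.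

Definition D2 (R : realType) (Omega : Type) (m n : nat)
    (X Y : Omega -> R) (w : Omega) : R :=
  X w * Y w + (m%:R - X w) * (n%:R - Y w).

Definition D2star (R : realType) (Omega : Type) (p q : R) (m n : nat)
    (X Y : Omega -> R) (w : Omega) : R :=
  ((X w - m%:R * p) / Num.sqrt (m%:R * p * q)) *
  ((Y w - n%:R * p) / Num.sqrt (n%:R * p * q)).

Definition standardized (R : realType) (d : measure_display)
    (Omega : measurableType d) (P : probability Omega R)
    (W : Omega -> R) (w : Omega) : R :=
  (W w - fine 'E_P[W]) / Num.sqrt (fine 'V_P[W]).

Definition cosh (R : realType) (x : R) : R := (expR x + expR (- x)) / 2.

(* Modified Bessel function of the second kind, for x > 0. It is extended-real
   valued so that the integral makes sense at x = 0 too, where K_0 is +oo. *)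
Definition besselK (R : realType) (nu x : R) : \bar R :=
  (\int[@lebesgue_measure R]_(t in `[0%R, +oo[)
     (expR (- (x * cosh t)) * cosh (nu * t))%:E)%E.

Definition VG1010_density (R : realType) (x : R) : \bar R :=
  ((pi^-1)%:E * besselK 0 `|x|)%E.

Definition has_VG1010_law (R : realType) (d : measure_display)
    (Omega : measurableType d) (P : probability Omega R)
    (V : {RV P >-> R}) : Prop :=
  forall S : set R, measurable S ->
    distribution P V S =
    (\int[@lebesgue_measure R]_(x in S) VG1010_density x)%E.

Definition supnorm (R : realType) (u : R -> R) : \bar R :=
  ess_sup (@lebesgue_measure R) (fun x => `|u x|%:E).

Definition absolutely_continuous_on (R : realType) (a b : R) (f : R -> R) :
    Prop :=
  forall e : R, 0 < e -> exists2 delta : R, 0 < delta &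
    forall (k : nat) (x y : 'I_k -> R),
      (forall i, a <= x i /\ x i <= y i /\ y i <= b) ->
      (forall i j, i != j -> y i <= x j \/ y j <= x i) ->
      \sum_(i < k) (y i - x i) < delta ->
      \sum_(i < k) `|f (y i) - f (x i)| < e.

Definition locally_absolutely_continuous (R : realType) (f : R -> R) : Prop :=
  forall a b : R, a <= b -> absolutely_continuous_on a b f.

(* For k >= 1. The derivative of order k exists only almost everywhere; the
   library's total [derive1n] takes an arbitrary value on the remaining null set,
   which [supnorm] ignores. *)
Definition Cb (R : realType) (k : nat) (h : R -> R) : Prop :=
  [/\ forall (j : nat) (x : R), (j.+1 < k)%N -> derivable (derive1n j h) x 1,
      locally_absolutely_continuous (derive1n k.-1 h) &
      forall j : nat, (1 <= j <= k)%N -> (supnorm (derive1n j h) < +oo)%E].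

(* Main.v *)
(* Let [xi] be the standardized letter and put [T_d u(x) = E u(x + d xi)], [G_s u(x) =
   E u(x + sqrt s Z)] with [Z] standard normal. With [dm = 1/sqrt m] and [dn = 1/sqrt n],
   [E h(D2star)] is [h(xy)] after [m] steps of [T_dm] in [x] and [n] steps of [T_dn] in [y],
   evaluated at 0, and [E h(V)] is the same with [G_1] in both variables; one sum is made
   Gaussian after the other. For one sum of [m] steps of size [d], put [D = T_d - G_(d^2)]:
   then [T_d^m - G_1] is [m D G_((m-1) d^2)] plus the sum over [0 < k < m] of
   [k T_d^(m-1-k) D D G_((k-1) d^2)]. Since [G] is smoothing, everything is [O(1/m)] with only
   [h''] and [h'''], except the part of the first term that carries the third moment of [xi],
   which is of order [1/sqrt m] times the third derivative at 0 of a smoothed function [u].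
   It vanishes in the symmetric case. When the other factor is already Gaussian, [u] is even
   and its third derivative at 0 is 0; when the other factor is still a sum of [n] letters, [u]
   is [O(x^2/sqrt n)] away from that even function, so the term is [O(1/sqrt(m n))].
   Finally [h''] and, for [h] in [Cb 4], [h'''] are continuous, so that their essential
   suprema bound them everywhere; higher derivatives are never used. *)

From HB Require Import structures.
Require Import Defs.
From mathcomp Require Import ring lra measurable_realfun.

Local Open Scope classical_set_scope.
Local Open Scope ring_scope.

(** * Gaussian expectations *)

Section gauss_expectation.
Context {R : realType}.
Implicit Types (u v : R -> R) (f g : R -> R -> R) (F G : R -> R -> R -> R) (x z s t a : R).

(** Rates are found by counting derivatives. A derivative not taken from the test function is paid
    for by smoothing, at the price of an inverse standard deviation. A double difference after [k]
    Gaussian steps of variance [d^2] therefore costs [d^8 / (k d^2)^3] when [D] has order four, and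
    the weight [k] still leaves a convergent series: [h''] is enough. With a third moment [D] has
    only order three; [h''] alone would give [d^6 / (k d^2)^2] and, after weighting, a logarithm.
    Three derivatives taken from the function give [d^3 k^(-3/2)] instead, whose weighted sum, of
    order [d^3 sqrt n], is again of order [d^2]. Since [h] is unbounded, everything takes place
    among continuous functions of polynomial growth, where Gaussian expectations converge, can be
    differentiated under the integral and integrated by parts. The semigroup law follows from these
    operations by a rotation, with no convolution of densities. The variance-gamma density enters
    only when the law of [V] is identified with that of a product of two Gaussians. *)

Lemma is_derive1M (u v : R -> R) (a b x : R) : is_derive x 1 u a -> is_derive x 1 v b ->
  is_derive x 1 (fun x => u x * v x) (a * v x + u x * b).
Proof.
move=> ua vb; apply: (is_derive_eq (is_deriveM ua vb)).
by rewrite addrC /GRing.scale/= (mulrC a).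
Qed.

Lemma is_derive1D (u v : R -> R) (a b x : R) : is_derive x 1 u a -> is_derive x 1 v b ->
  is_derive x 1 (fun x => u x + v x) (a + b).
Proof. by move=> ua vb; apply: (is_derive_eq (is_deriveD ua vb)). Qed.

Lemma is_derive1Mcst (u : R -> R) (a b x : R) : is_derive x 1 u a ->
  is_derive x 1 (fun x => u x * b) (a * b).
Proof.
move=> ua; apply: (is_derive_eq (is_derive1M ua (is_derive_cst b x 1))).
by rewrite mulr0 addr0.
Qed.

Lemma is_derive1Z (u : R -> R) (a b x : R) : is_derive x 1 u a ->
  is_derive x 1 (fun x => b * u x) (b * a).
Proof.
move=> ua; apply: (is_derive_eq (is_derive1M (is_derive_cst b x 1) ua)).
by rewrite mul0r add0r.
Qed.

Lemma is_derive1_affine (c s x : R) : is_derive x 1 (fun x => c + s * x) s.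
Proof.
have := is_derive1D (is_derive_cst c x 1) (is_derive1Z s (is_derive_id x 1)).
by rewrite add0r mulr1.
Qed.

Lemma is_derive1_fcomp (u v : R -> R) (a b x : R) :
  is_derive (v x) 1 u a -> is_derive x 1 v b ->
  is_derive x 1 (fun x => u (v x)) (a * b).
Proof. exact: is_derive1_comp. Qed.

Lemma is_derive1_cont (u u' : R -> R) : (forall x : R, is_derive x 1 u (u' x)) -> continuous u.
Proof.
move=> du x; apply/differentiable_continuous/derivable1_diffP.
exact: (@ex_derive _ _ _ _ _ _ _ (du x)).
Qed.

Definition phi : R -> R := normal_pdf 0 1.

Definition gE u : R := \int[lebesgue_measure]_x (u x * phi x).

(** Test functions may grow linearly and the derivatives of their mixtures carry powers of the
    averaged variable, so bounded functions would not do; this class is stable under products,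
    composition and Gaussian averaging. *)
Definition pg u := continuous u /\
  exists a k, forall x, `|u x| <= a * (1 + `|x|) ^+ k.

Lemma phiE x : phi x = normal_peak 1 * expR (- x ^+ 2 / 2).
Proof.
by rewrite /phi normal_pdfE ?oner_neq0// /normal_fun subr0 expr1n.
Qed.

Lemma phi_ge0 x : 0 <= phi x.
Proof. exact: normal_pdf_ge0. Qed.

Lemma phi_cont : continuous phi.
Proof. by apply: continuous_normal_pdf; rewrite oner_neq0. Qed.

Lemma one_norm_ge0 x : 0 <= 1 + `|x|.
Proof. by rewrite addr_ge0. Qed.

Lemma one_norm_ge1 x : 1 <= 1 + `|x|.
Proof. by rewrite lerDl. Qed.

Hint Resolve one_norm_ge0 one_norm_ge1 : core.

(** Completing the square. Polynomial growth is dominated by [expR (k |x|)], which turns [phi] into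
    multiples of shifted normal densities; these are integrable and bounded, whence [pg_integrable]
    and [pg_phi_bounded]. *)
Lemma expR_shift_phi (b x : R) :
  expR (b * x) * phi x = expR (b ^+ 2 / 2) * normal_pdf b 1 x.
Proof.
rewrite phiE normal_pdfE ?oner_neq0// /normal_fun expr1n.
rewrite mulrCA [RHS]mulrCA -!expRD; congr (_ * expR _).
by field.
Qed.

Lemma expR_norm_le (b x : R) : expR (b * `|x|) <= expR (b * x) + expR (- b * x).
Proof.
have [x0|x0] := lerP 0 x; first by rewrite ger0_norm// lerDl expR_ge0.
by rewrite ltr0_norm// mulrN -mulNr lerDr expR_ge0.
Qed.

Lemma integrable_expR_phi (b : R) : lebesgue_measure.-integrable setT
  (fun x => (expR (b * x) * phi x)%:E).
Proof.
under eq_fun do rewrite expR_shift_phi EFinM.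
by apply: integrableZl => //; exact: integrable_normal_pdf.
Qed.

Lemma pg_integrable u : pg u -> lebesgue_measure.-integrable setT
  (EFin \o (fun x => u x * phi x)).
Proof.
move=> [cu [a [k ua]]].
pose g x := `|a| * (expR (k%:R * x) * phi x + expR (- k%:R * x) * phi x).
apply: (@le_integrable _ _ R lebesgue_measure setT measurableT _ (EFin \o g)) => //.
- apply/measurable_EFinP/measurable_funM; apply: continuous_measurable_fun => //.
  exact: phi_cont.
- move=> x _ /=; rewrite lee_fin normrM (ger0_norm (phi_ge0 x)).
  apply: le_trans (ler_norm _); rewrite /g -mulrDl mulrA; apply: ler_wpM2r; first exact: phi_ge0.
  apply: (le_trans (ua x)); apply: (@le_trans _ _ (`|a| * (1 + `|x|) ^+ k)).
    by apply: ler_wpM2r; [rewrite exprn_ge0|rewrite ler_norm].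
  apply: ler_wpM2l => //; apply: le_trans (expR_norm_le _ _).
  rewrite expRM_natl; apply: lerXn2r; rewrite ?nnegrE ?expR_ge0//.
  exact: expR_ge1Dx.
- rewrite (_ : EFin \o g = (fun x => `|a|%:E * ((expR (k%:R * x) * phi x)%:E +
      (expR (- k%:R * x) * phi x)%:E))%E); last by apply/funext.
  apply: integrableZl => //; apply: integrableD => //; exact: integrable_expR_phi.
Qed.

Lemma pg_cst c : pg (fun=> c).
Proof.
split; first by move=> x; exact: cvg_cst.
by exists `|c|, 0%N => x; rewrite expr0 mulr1.
Qed.

Lemma pg_id : pg id.
Proof.
split; first by move=> x; exact: cvg_id.
by exists 1, 1%N => x; rewrite expr1 mul1r lerDr.
Qed.

Lemma pg_ge0 u : (exists a k, forall x, `|u x| <= a * (1 + `|x|) ^+ k) ->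
  exists a k, 0 <= a /\ forall x, `|u x| <= a * (1 + `|x|) ^+ k.
Proof.
move=> [a [k ua]]; exists a, k; split => //.
by have := ua 0; rewrite normr0 addr0 expr1n mulr1; apply: le_trans.
Qed.

Lemma pgD u v : pg u -> pg v -> pg (fun x => u x + v x).
Proof.
move=> [cu /pg_ge0 [a [k [a0 ua]]]] [cv /pg_ge0 [b [l [b0 vb]]]]; split.
  by move=> x; apply: cvgD; [exact: cu|exact: cv].
exists (a + b), (k + l)%N => x; apply: (le_trans (ler_normD _ _)).
rewrite mulrDl; apply: lerD.
- apply: (le_trans (ua x)); apply: ler_wpM2l => //.
  by rewrite ler_weXn2l// leq_addr.
- apply: (le_trans (vb x)); apply: ler_wpM2l => //.
  by rewrite ler_weXn2l// leq_addl.
Qed.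

Lemma pgM u v : pg u -> pg v -> pg (fun x => u x * v x).
Proof.
move=> [cu /pg_ge0 [a [k [a0 ua]]]] [cv /pg_ge0 [b [l [b0 vb]]]]; split.
  by move=> x; apply: cvgM; [exact: cu|exact: cv].
exists (a * b), (k + l)%N => x; rewrite normrM exprD mulrACA.
by apply: ler_pM.
Qed.

Lemma pgZ c u : pg u -> pg (fun x => c * u x).
Proof. by move=> ?; apply: pgM => //; exact: pg_cst. Qed.

Lemma pgN u : pg u -> pg (fun x => - u x).
Proof. by move=> /(pgZ (-1)); under eq_fun do rewrite mulN1r. Qed.

Lemma pgB u v : pg u -> pg v -> pg (fun x => u x - v x).
Proof. by move=> pu /pgN; exact: pgD. Qed.

Lemma pgX u n : pg u -> pg (fun x => u x ^+ n).
Proof.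
move=> pu; elim: n => [|n IH]; first by under eq_fun do rewrite expr0; exact: pg_cst.
by under eq_fun do rewrite exprS; exact: pgM.
Qed.

Lemma pg_norm u : pg u -> pg (fun x => `|u x|).
Proof.
move=> [cu [a [k ua]]]; split.
  by move=> x; apply: cvg_norm; exact: cu.
by exists a, k => x; rewrite normr_id.
Qed.

Lemma pg_comp u v : pg u -> pg v -> pg (fun x => u (v x)).
Proof.
move=> [cu /pg_ge0 [a [k [a0 ua]]]] [cv /pg_ge0 [b [l [b0 vb]]]]; split.
  by move=> x; apply: continuous_comp; [exact: cv|exact: cu].
exists (a * (1 + b) ^+ k), (l * k)%N => x; apply: (le_trans (ua _)).
rewrite -mulrA; apply: ler_wpM2l => //; rewrite exprM -exprMn.
apply: lerXn2r; rewrite ?nnegrE//; first by rewrite mulr_ge0 ?exprn_ge0 ?addr_ge0.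
rewrite mulrDl mul1r; apply: lerD; last exact: vb.
by rewrite exprn_ege1.
Qed.

Lemma pg_affine u c s : pg u -> pg (fun x => u (c + s * x)).
Proof.
move=> pu; apply: (pg_comp pu); apply: pgD; first exact: pg_cst.
by apply: pgZ; exact: pg_id.
Qed.

Lemma gED u v : pg u -> pg v -> gE (fun x => u x + v x) = gE u + gE v.
Proof.
move=> pu pv; rewrite /gE -RintegralD//; try exact: pg_integrable.
by apply: eq_Rintegral => x _; rewrite mulrDl.
Qed.

Lemma gEZ c u : pg u -> gE (fun x => c * u x) = c * gE u.
Proof.
move=> pu; rewrite /gE -RintegralZl//; last exact: pg_integrable.
by apply: eq_Rintegral => x _; rewrite mulrA.
Qed.

Lemma gEB u v : pg u -> pg v -> gE (fun x => u x - v x) = gE u - gE v.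
Proof.
move=> pu pv; rewrite gED//; last exact: pgN.
congr (_ + _); rewrite -mulN1r -gEZ//; congr gE.
by apply/funext => x; rewrite mulN1r.
Qed.

Lemma gE_cst c : gE (fun=> c) = c.
Proof.
rewrite -[in RHS](mulr1 c) -[in LHS](mulr1 c) gEZ; last exact: pg_cst.
congr (_ * _); rewrite /gE /Rintegral.
under eq_integral do rewrite mul1r.
by rewrite integral_normal_pdf.
Qed.

Lemma gE_le u v : pg u -> pg v -> (forall x, u x <= v x) -> gE u <= gE v.
Proof.
move=> pu pv uv; apply: le_Rintegral => //; try exact: pg_integrable.
by move=> x _; apply: ler_wpM2r; rewrite ?phi_ge0.
Qed.

Lemma gE_norm u : pg u -> `|gE u| <= gE (fun x => `|u x|).
Proof.
move=> pu; rewrite /gE; apply: (le_trans (le_normr_Rintegral _ _)) => //.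
  exact: pg_integrable.
rewrite le_eqVlt; apply/orP; left; apply/eqP; apply: eq_Rintegral => x _.
by rewrite normrM (ger0_norm (phi_ge0 x)).
Qed.

Lemma gE_norm_le u v : pg u -> pg v -> (forall x, `|u x| <= v x) -> `|gE u| <= gE v.
Proof.
move=> pu pv uv; apply: (le_trans (gE_norm pu)); apply: gE_le => //.
exact: pg_norm.
Qed.

(** The bound is joint in both variables: freezing [x] or integrating out [z] leaves polynomial
    growth, and for [x] in a bounded interval it gives a single integrable function of [z], the
    domination asked for by continuity and differentiation under the integral. *)
Definition pg2 f := [/\ (forall z, continuous (f^~ z)), (forall x, continuous (f x)) &
  exists a k, 0 <= a /\ forall x z, `|f x z| <= a * ((1 + `|x|) * (1 + `|z|)) ^+ k].

Lemma pg2_section f x : pg2 f -> pg (f x).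
Proof.
move=> [_ cf [a [k [a0 fa]]]]; split; first exact: cf.
exists (a * (1 + `|x|) ^+ k), k => z.
by rewrite -mulrA -exprMn.
Qed.

Lemma gE_pg f : pg2 f -> pg (fun x => gE (f x)).
Proof.
move=> pf; have [cf1 cf2 [a [k [a0 fa]]]] := pf.
have pk : pg (fun z => (1 + `|z|) ^+ k).
  by apply: pgX; apply: pgD; [exact: pg_cst|apply: pg_norm; exact: pg_id].
split; last first.
  exists (a * gE (fun z => (1 + `|z|) ^+ k)), k => x.
  rewrite mulrAC -gEZ//; apply: gE_norm_le; [exact: pg2_section|exact: pgZ|].
  by move=> z; rewrite -mulrA -exprMn.
move=> x.
have xI : x \in `](x - 1), (x + 1)[ by rewrite in_itv/=; apply/andP; split; lra.
(* Domination on the interval of radius 1 around [x], where [1 + |y| <= 2 + |x|]. *)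
pose g z := a * (2 + `|x|) ^+ k * (1 + `|z|) ^+ k.
have := @continuity_under_integral R _ _ lebesgue_measure
  (fun x z => f x z * phi z) setT measurableT (x - 1) (x + 1) _ _ (fun z => g z * phi z) _ _.
move=> /(_ _ _ _ _ x); apply.
- by move=> y _; apply: pg_integrable; exact: pg2_section.
- apply: aeW => y _ w _; apply: cvgM; first exact: cf1.
  exact: cvg_cst.
- by apply: pg_integrable; exact: pgZ.
- move=> y /=; rewrite in_itv/= => /andP[y1 y2]; apply: aeW => z _.
  rewrite normrM (ger0_norm (phi_ge0 z)); apply: ler_wpM2r; first exact: phi_ge0.
  apply: (le_trans (fa _ _)); rewrite /g -mulrA; apply: ler_wpM2l => //.
  rewrite exprMn; apply: ler_wpM2r; first by rewrite exprn_ge0.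
  apply: lerXn2r; rewrite ?nnegrE ?addr_ge0//.
  have : `|y - x| <= 1 by rewrite ler_norml; apply/andP; split; lra.
  have := ler_normD (y - x) x; rewrite subrK; lra.
- by rewrite inE.
Qed.

Lemma gE_derive f g x : pg2 f -> pg2 g ->
  (forall x z, is_derive x 1 (f^~ z) (g x z)) ->
  is_derive x 1 (fun x => gE (f x)) (gE (g x)).
Proof.
move=> pf pgg fg; have [cg1 cg2 [a [k [a0 ga]]]] := pgg.
have pk : pg (fun z => (1 + `|z|) ^+ k).
  by apply: pgX; apply: pgD; [exact: pg_cst|apply: pg_norm; exact: pg_id].
pose G z := a * (2 + `|x|) ^+ k * (1 + `|z|) ^+ k.
have fphi (y z : R) : is_derive y 1 ((fun x z => f x z * phi z)^~ z) (g y z * phi z).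
  exact: is_derive1Mcst.
have Ix : `](x - 1), (x + 1)[%classic x by rewrite /= in_itv/=; apply/andP; split; lra.
have intf y : `](x - 1), (x + 1)[%classic y ->
    lebesgue_measure.-integrable setT (EFin \o (fun z => f y z * phi z)).
  by move=> _; apply: pg_integrable; exact: pg2_section.
have df y z : `](x - 1), (x + 1)[%classic y -> setT z ->
    derivable ((fun x z => f x z * phi z)^~ z) y 1.
  by move=> _ _; exact: (@ex_derive _ _ _ _ _ _ _ (fphi y z)).
have G0 z : 0 <= G z * phi z.
  by rewrite mulr_ge0 ?phi_ge0// /G mulr_ge0 ?exprn_ge0// mulr_ge0 ?exprn_ge0 ?addr_ge0.
have d1E y z : partial1of2 (fun x z => f x z * phi z) y z = g y z * phi z.
  by rewrite partial1of2E; exact: (@derive_val _ _ _ _ _ _ _ (fphi y z)).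
have Gub y z : `](x - 1), (x + 1)[%classic y -> setT z ->
    `|partial1of2 (fun x z => f x z * phi z) y z| <= G z * phi z.
  rewrite /= in_itv/= => /andP[y1 y2] _; rewrite d1E.
  rewrite normrM (ger0_norm (phi_ge0 z)); apply: ler_wpM2r; first exact: phi_ge0.
  apply: (le_trans (ga _ _)); rewrite /G -mulrA; apply: ler_wpM2l => //.
  rewrite exprMn; apply: ler_wpM2r; first by rewrite exprn_ge0.
  apply: lerXn2r; rewrite ?nnegrE ?addr_ge0//.
  have : `|y - x| <= 1 by rewrite ler_norml; apply/andP; split; lra.
  have := ler_normD (y - x) x; rewrite subrK; lra.
have intG : lebesgue_measure.-integrable setT (EFin \o (fun z => G z * phi z)).
  by apply: pg_integrable; exact: pgZ.
have D := @derivable_under_integral R _ _ lebesgue_measure _ setT measurableT x _ _ Ix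
   intf df _ G0 intG Gub.
have V := @differentiation_under_integral R _ _ lebesgue_measure _ setT measurableT x _ _ Ix
   intf df _ G0 intG Gub.
apply: DeriveDef; first exact: D.
rewrite -derive1E V; apply: eq_Rintegral => z _; exact: d1E.
Qed.

Lemma pg_phi_bounded u : pg u -> exists C, forall x, `|u x * phi x| <= C.
Proof.
move=> [_ /pg_ge0 [a [k [a0 ua]]]].
exists (a * (expR (k%:R ^+ 2 / 2) * normal_peak 1 + expR ((- k%:R) ^+ 2 / 2) * normal_peak 1)) => x.
rewrite normrM (ger0_norm (phi_ge0 x)).
apply: (@le_trans _ _ (a * (expR (k%:R * `|x|) * phi x))).
  rewrite mulrA; apply: ler_wpM2r; first exact: phi_ge0.
  apply: (le_trans (ua x)); apply: ler_wpM2l => //.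
  rewrite expRM_natl; apply: lerXn2r; rewrite ?nnegrE ?expR_ge0//.
  exact: expR_ge1Dx.
apply: ler_wpM2l => //.
apply: (@le_trans _ _ ((expR (k%:R * x) + expR (- k%:R * x)) * phi x)).
  by apply: ler_wpM2r; [exact: phi_ge0|exact: expR_norm_le].
rewrite mulrDl !expR_shift_phi; apply: lerD; apply: ler_wpM2l; rewrite ?expR_ge0//;
  by apply: normal_pdf_ub; rewrite oner_neq0.
Qed.

Lemma is_derive_phi x : is_derive x 1 phi (- x * phi x).
Proof.
have -> : phi = (fun x => normal_peak 1 * expR (- (1 / 2) * (x * x))).
  by apply/funext => y; rewrite phiE; congr (_ * expR _); rewrite expr2; field.
have := is_derive1Z (normal_peak 1) (@is_derive1_fcomp expR
  (fun x => - (1 / 2) * (x * x)) _ _ _ (is_derive_expR (- (1 / 2) * (x * x))) (is_derive1Z (- (1 / 2)) (is_derive1M (is_derive_id x 1) (is_derive_id x 1)))).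
by move=> /is_derive_eq; apply; field.
Qed.

(** Stein's identity: [(u' x - x * u x) * phi x] is the derivative of [u * phi], so its integral
    over a symmetric interval is a boundary term. As [x * u x * phi x] is bounded, that term is at
    most a constant over the half-length of the interval. *)
Lemma gE_ibp u u' : pg u -> pg u' -> (forall x, is_derive x 1 u (u' x)) ->
  gE u' = gE (fun x => x * u x).
Proof.
move=> pu pu' du.
have pxu : pg (fun x => x * u x) by apply: pgM => //; exact: pg_id.
apply/eqP; rewrite -subr_eq0 -gEB//; apply/eqP.
pose f x := (u' x - x * u x) * phi x.
pose F x := u x * phi x.
have pf : pg (fun x => u' x - x * u x) by exact: pgB.
have If := pg_integrable pf.
have dF x : is_derive x 1 F (f x).
  apply: (is_derive_eq (is_derive1M (du x) (is_derive_phi x))).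
  by rewrite /f; ring.
have cf : continuous f.
  by move=> x; apply: cvgM; [exact: pf.1|exact: phi_cont].
have cF : continuous F by exact: is_derive1_cont dF.
have [C FC] := pg_phi_bounded pxu.
have FTC n : (\int[lebesgue_measure]_(x in `[(- n.+1%:R)%R, n.+1%:R]) (f x)%:E =
    (F n.+1%:R)%:E - (F (- n.+1%:R)%R)%:E)%E.
  apply: continuous_FTC2.
  - by rewrite gtrN.
  - exact: continuous_subspaceT.
  - split.
    + by move=> x _; exact: (@ex_derive _ _ _ _ _ _ _ (dF x)).
    + by apply: cvg_at_right_filter; exact: cF.
    + by apply: cvg_at_left_filter; exact: cF.
  - by move=> x _; rewrite derive1E; exact: (@derive_val _ _ _ _ _ _ _ (dF x)).
have L1 : (\int[lebesgue_measure]_x ((f \_ `[(- n.+1%:R)%R, n.+1%:R]) x)%:E @[n --> \oo] -->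
    \int[lebesgue_measure]_x (f x)%:E)%E.
  apply: (@dominated_cvg _ _ _ lebesgue_measure setT measurableT
     (fun n x => ((f \_ `[(- n.+1%:R)%R, n.+1%:R]) x)%:E) _ (fun x => `|(f x)%:E|%E)) => //.
  - move=> n; apply/measurable_EFinP/(measurable_restrictT _ _).1 => //.
    by apply: measurable_funTS; exact: continuous_measurable_fun.
  - move=> x _; apply: cvg_near_cst; near=> n.
    rewrite patchE mem_set//= in_itv/=.
    have : `|x| <= n.+1%:R.
      apply: (@le_trans _ _ n%:R); last by rewrite ler_nat.
      by near: n; exact: nbhs_infty_ger.
    by rewrite ler_norml.
  - exact: integrable_abse.
  - move=> n x _; rewrite patchE; case: ifPn => // _.
    by rewrite /= normr0 lee_fin.
have L2 : (\int[lebesgue_measure]_x ((f \_ `[(- n.+1%:R)%R, n.+1%:R]) x)%:E @[n --> \oo] -->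
    0)%E.
  rewrite [X in X @ _ --> _](_ : _ = (fun n => (F n.+1%:R - F (- n.+1%:R))%:E)); last first.
    apply/funext => n; rewrite EFinB -FTC [RHS]integral_mkcond.
    by apply: eq_integral => x _; rewrite restrict_EFin.
  apply: cvg_EFin; first exact: nearW.
  apply/cvgr0Pnorm_le => e e0; near=> n => /=.
  have n0 : 0 < n.+1%:R :> R by rewrite ltr0n.
  have B y : `|y| = n.+1%:R -> `|F y| <= C / n.+1%:R.
    move=> yn; rewrite ler_pdivlMr// mulrC -yn -normrM.
    by rewrite /F mulrA; exact: FC.
  apply: (le_trans (ler_normB _ _)).
  apply: (@le_trans _ _ (C / n.+1%:R + C / n.+1%:R)).
    by apply: lerD; apply: B; rewrite ?normrN ger0_norm// ltW.
  rewrite -mulrDl ler_pdivrMr// mulrC -ler_pdivrMr//.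
  apply: (@le_trans _ _ n%:R); last by rewrite ler_nat.
  by near: n; exact: nbhs_infty_ger.
have := cvg_unique _ L1 L2 => /(_ _)/= I0.
by rewrite /gE /Rintegral I0.
Unshelve. all: by end_near. Qed.

Lemma pg2M f g : pg2 f -> pg2 g -> pg2 (fun x z => f x z * g x z).
Proof.
move=> [f1 f2 [a [k [a0 fa]]]] [g1 g2 [b [l [b0 gb]]]]; split.
- by move=> z x; apply: cvgM; [exact: f1|exact: g1].
- by move=> x z; apply: cvgM; [exact: f2|exact: g2].
exists (a * b), (k + l)%N; split; first exact: mulr_ge0.
by move=> x z; rewrite normrM exprD mulrACA; apply: ler_pM.
Qed.

Lemma pg2_comp u f : pg u -> pg2 f -> pg2 (fun x z => u (f x z)).
Proof.
move=> [cu /pg_ge0 [b [l [b0 ub]]]] [f1 f2 [a [k [a0 fa]]]]; split.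
- by move=> z x; apply: continuous_comp; [exact: f1|exact: cu].
- by move=> x z; apply: continuous_comp; [exact: f2|exact: cu].
exists (b * (1 + a) ^+ l), (k * l)%N; split; first by rewrite mulr_ge0 ?exprn_ge0 ?addr_ge0.
move=> x z; apply: (le_trans (ub _)); rewrite -mulrA; apply: ler_wpM2l => //.
rewrite exprM -exprMn; apply: lerXn2r; rewrite ?nnegrE//.
  by rewrite mulr_ge0 ?exprn_ge0 ?mulr_ge0 ?addr_ge0.
rewrite mulrDl mul1r; apply: lerD; last exact: fa.
by rewrite exprn_ege1// mulr_ege1.
Qed.

Lemma pg2_fst u : pg u -> pg2 (fun x _ => u x).
Proof.
move=> [cu /pg_ge0 [a [k [a0 ua]]]]; split => //.
- by move=> x z; exact: cvg_cst.
exists a, k; split => // x z; apply: (le_trans (ua x)); apply: ler_wpM2l => //.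
by apply: lerXn2r; rewrite ?nnegrE ?mulr_ge0// ler_peMr.
Qed.

Lemma pg2_snd u : pg u -> pg2 (fun _ z => u z).
Proof.
move=> [cu /pg_ge0 [a [k [a0 ua]]]]; split => //.
- by move=> x z; exact: cvg_cst.
exists a, k; split => // x z; apply: (le_trans (ua z)); apply: ler_wpM2l => //.
by apply: lerXn2r; rewrite ?nnegrE ?mulr_ge0// ler_peMl.
Qed.

(** Three parameters serve the rotation argument: the angle and the two Gaussian variables. *)
Definition pg3 (f : R -> R -> R -> R) := [/\ (forall y z, continuous (fun t => f t y z)),
  (forall t z, continuous (fun y => f t y z)), (forall t y, continuous (f t y)) &
  exists a k, 0 <= a /\
    forall t y z, `|f t y z| <= a * ((1 + `|t|) * (1 + `|y|) * (1 + `|z|)) ^+ k].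

Lemma pg3_section1 F t : pg3 F -> pg2 (F t).
Proof.
move=> [_ f2 f1 [a [k [a0 fa]]]]; split => //.
exists (a * (1 + `|t|) ^+ k), k; split; first by rewrite mulr_ge0// exprn_ge0.
by move=> y z; rewrite -mulrA -exprMn mulrA.
Qed.

Lemma pg3_section2 F y : pg3 F -> pg2 (fun t => F t y).
Proof.
move=> [f2 _ f1 [a [k [a0 fa]]]]; split => //.
exists (a * (1 + `|y|) ^+ k), k; split; first by rewrite mulr_ge0// exprn_ge0.
by move=> t z; rewrite -mulrA -exprMn mulrCA mulrA.
Qed.

Lemma gE_pg3 F : pg3 F -> pg2 (fun t y => gE (F t y)).
Proof.
move=> pf; have [_ _ _ [a [k [a0 fa]]]] := pf; split.
- by move=> y; apply: (gE_pg _).1; exact: pg3_section2.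
- by move=> t; apply: (gE_pg _).1; exact: pg3_section1.
have pk : pg (fun z => (1 + `|z|) ^+ k).
  by apply: pgX; apply: pgD; [exact: pg_cst|apply: pg_norm; exact: pg_id].
exists (`|a * gE (fun z => (1 + `|z|) ^+ k)|), k; split => // t y.
apply: (@le_trans _ _ ((a * gE (fun z => (1 + `|z|) ^+ k)) * ((1 + `|t|) * (1 + `|y|)) ^+ k)).
  rewrite mulrAC -gEZ//; apply: gE_norm_le; last by move=> z; rewrite -mulrA -exprMn.
    by apply: pg2_section; exact: pg3_section1.
  exact: pgZ.
by apply: ler_wpM2r; [rewrite exprn_ge0// mulr_ge0|exact: ler_norm].
Qed.

Lemma pg3M F G : pg3 F -> pg3 G -> pg3 (fun t y z => F t y z * G t y z).
Proof.
move=> [f1 f2 f4 [a [k [a0 fa]]]] [g1 g2 g4 [b [l [b0 gb]]]]; split.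
- by move=> y z x; apply: cvgM; [exact: f1|exact: g1].
- by move=> t z x; apply: cvgM; [exact: f2|exact: g2].
- by move=> t y x; apply: cvgM; [exact: f4|exact: g4].
exists (a * b), (k + l)%N; split; first exact: mulr_ge0.
by move=> t y z; rewrite normrM exprD mulrACA; apply: ler_pM.
Qed.

Lemma pg3D F G : pg3 F -> pg3 G -> pg3 (fun t y z => F t y z + G t y z).
Proof.
move=> [f1 f2 f4 [a [k [a0 fa]]]] [g1 g2 g4 [b [l [b0 gb]]]]; split.
- by move=> y z x; apply: cvgD; [exact: f1|exact: g1].
- by move=> t z x; apply: cvgD; [exact: f2|exact: g2].
- by move=> t y x; apply: cvgD; [exact: f4|exact: g4].
exists (a + b), (k + l)%N; split; first exact: addr_ge0.
move=> t y z; apply: (le_trans (ler_normD _ _)).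
rewrite mulrDl; apply: lerD.
- apply: (le_trans (fa _ _ _)); apply: ler_wpM2l => //.
  by rewrite ler_weXn2l ?leq_addr// !mulr_ege1.
- apply: (le_trans (gb _ _ _)); apply: ler_wpM2l => //.
  by rewrite ler_weXn2l ?leq_addl// !mulr_ege1.
Qed.

Lemma pg3_comp u F : pg u -> pg3 F -> pg3 (fun t y z => u (F t y z)).
Proof.
move=> [cu /pg_ge0 [b [l [b0 ub]]]] [f1 f2 f4 [a [k [a0 fa]]]]; split.
- by move=> y z x; apply: continuous_comp; [exact: f1|exact: cu].
- by move=> t z x; apply: continuous_comp; [exact: f2|exact: cu].
- by move=> t y x; apply: continuous_comp; [exact: f4|exact: cu].
exists (b * (1 + a) ^+ l), (k * l)%N; split; first by rewrite mulr_ge0 ?exprn_ge0 ?addr_ge0.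
move=> t y z; apply: (le_trans (ub _)); rewrite -mulrA; apply: ler_wpM2l => //.
rewrite exprM -exprMn; apply: lerXn2r; rewrite ?nnegrE//.
  by rewrite mulr_ge0 ?exprn_ge0 ?mulr_ge0 ?addr_ge0.
rewrite mulrDl mul1r; apply: lerD; last exact: fa.
by rewrite exprn_ege1// !mulr_ege1.
Qed.

Lemma pg3_1 u : pg u -> pg3 (fun t _ _ => u t).
Proof.
move=> [cu /pg_ge0 [a [k [a0 ua]]]]; split => //; try by move=> ? ? ?; exact: cvg_cst.
exists a, k; split => // t y z; apply: (le_trans (ua t)); apply: ler_wpM2l => //.
by apply: lerXn2r; rewrite ?nnegrE ?mulr_ge0// -mulrA ler_peMr// mulr_ege1.
Qed.

Lemma pg3_2 u : pg u -> pg3 (fun _ y _ => u y).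
Proof.
move=> [cu /pg_ge0 [a [k [a0 ua]]]]; split => //; try by move=> ? ? ?; exact: cvg_cst.
exists a, k; split => // t y z; apply: (le_trans (ua y)); apply: ler_wpM2l => //.
by apply: lerXn2r; rewrite ?nnegrE ?mulr_ge0// mulrAC ler_peMl// mulr_ege1.
Qed.

Lemma pg3_3 u : pg u -> pg3 (fun _ _ z => u z).
Proof.
move=> [cu /pg_ge0 [a [k [a0 ua]]]]; split => //; try by move=> ? ? ?; exact: cvg_cst.
exists a, k; split => // t y z; apply: (le_trans (ua z)); apply: ler_wpM2l => //.
by apply: lerXn2r; rewrite ?nnegrE ?mulr_ge0// ler_peMl// mulr_ege1.
Qed.

Lemma pg_bounded u C : continuous u -> (forall x, `|u x| <= C) -> pg u.
Proof. by move=> cu uC; split => //; exists C, 0%N => x; rewrite expr0 mulr1. Qed.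

Lemma pg_cos : pg cos.
Proof.
apply: (@pg_bounded _ 1); first exact: continuous_cos.
by move=> x; rewrite ler_norml cos_geN1 cos_le1.
Qed.

Lemma pg_sin : pg sin.
Proof.
apply: (@pg_bounded _ 1); first exact: continuous_sin.
by move=> x; rewrite ler_norml sin_geN1 sin_le1.
Qed.

End gauss_expectation.

(** * The heat semigroup *)

Section gauss_semigroup.
Local Open Scope classical_set_scope.
Context {R : realType}.
Implicit Types (u v : R -> R) (x z s t a b B : R) (k i j : nat).

(** All derivatives up to order [k] exist everywhere and lie in [pg]. Peeling off the first one
    makes each commutation with an averaging operator a one-step induction. *)
Fixpoint Ck k u : Prop := pg u /\
  (if k is l.+1 then (forall x : R, derivable u x 1) /\ Ck l u^`() else True).

Lemma Ck_pg k u : Ck k u -> pg u.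
Proof. by case: k => [|k] []. Qed.

Lemma CkS k u : Ck k.+1 u -> Ck k u^`().
Proof. by move=> [_ []]. Qed.

Lemma CkW k u : Ck k.+1 u -> Ck k u.
Proof.
elim: k u => [|k IH] u [pu [du Cu]]; first by split.
by split => //; split => //; exact: IH.
Qed.

Lemma Ck_is_derive k u : Ck k.+1 u -> forall x : R, is_derive x 1 u (u^`() x).
Proof. by move=> [_ [du _]] x; apply: DeriveDef => //; rewrite derive1E. Qed.

Lemma CkP k u u' : pg u -> (forall x : R, is_derive x 1 u (u' x)) -> Ck k u' -> Ck k.+1 u.
Proof.
move=> pu du Cu'; split => //; split.
  by move=> x; exact: (@ex_derive _ _ _ _ _ _ _ (du x)).
rewrite (_ : u^`() = u')//; apply/funext => x.
by rewrite derive1E; exact: (@derive_val _ _ _ _ _ _ _ (du x)).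
Qed.

Lemma is_derive_derive1 u u' : (forall x : R, is_derive x 1 u (u' x)) -> u^`() = u'.
Proof.
move=> du; apply/funext => x.
by rewrite derive1E; exact: (@derive_val _ _ _ _ _ _ _ (du x)).
Qed.

Lemma Ck_derive1n j k u : Ck (j + k) u -> Ck k u^`(j).
Proof.
elim: j u => // j IH u Cu.
by rewrite derive1Sn; apply: IH; exact: CkS.
Qed.

Lemma Ck_le j k u : (j <= k)%N -> Ck k u -> Ck j u.
Proof.
move=> /subnK <-; elim: (k - j)%N => // n IH; rewrite addSn => /CkW; exact: IH.
Qed.

Lemma gE_lin a b u v : pg u -> pg v ->
  gE (fun z => a * u z + b * v z) = a * gE u + b * gE v.
Proof. by move=> pu pv; rewrite gED ?gEZ//; exact: pgZ. Qed.

(* Differentiating in the angle [t] gives zero, by one integration by parts in each variable. *)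
Lemma gE_rotation u x a t : Ck 2 u ->
  gE (fun y => gE (fun z => u (x + a * cos t * y + a * sin t * z))) =
  gE (fun y => u (x + a * y)).
Proof.
move=> Cu; have [pu [_ [pu' [_ pu'']]]] := Cu.
have du := Ck_is_derive Cu; have du' := Ck_is_derive (CkS Cu).
set u1 := u^`() in pu' pu'' du du' *; set u2 := u1^`() in pu'' du'.
have {}pu'' : pg u2 by exact: pu''.1.
pose c (t y z : R) := x + a * cos t * y + a * sin t * z.
pose c' (t y z : R) := a * - sin t * y + a * cos t * z.
have pc : pg3 c.
  apply: pg3D; first apply: pg3D.
  - by apply: (pg3_1 (u := fun=> x)); exact: pg_cst.
  - apply: pg3M; last by apply: pg3_2; exact: pg_id.
    by apply: (pg3_1 (u := fun t => a * cos t)); apply: pgZ; exact: pg_cos.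
  - apply: pg3M; last by apply: pg3_3; exact: pg_id.
    by apply: (pg3_1 (u := fun t => a * sin t)); apply: pgZ; exact: pg_sin.
have pc' : pg3 c'.
  apply: pg3D; apply: pg3M.
  - by apply: (pg3_1 (u := fun t => a * - sin t)); apply: pgZ; apply: pgN; exact: pg_sin.
  - by apply: pg3_2; exact: pg_id.
  - by apply: (pg3_1 (u := fun t => a * cos t)); apply: pgZ; exact: pg_cos.
  - by apply: pg3_3; exact: pg_id.
have dc (t0 y z : R) : is_derive t0 1 (fun t => c t y z) (c' t0 y z).
  apply: is_derive1D; last first.
    by apply: is_derive1Mcst; apply: is_derive1Z; exact: is_derive_sin.
  have := is_derive1D (is_derive_cst x t0 1)
    (is_derive1Mcst y (is_derive1Z a (is_derive_cos t0))).
  by rewrite add0r.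
have puc : pg3 (fun t y z => u (c t y z)) by exact: pg3_comp.
have pu1c : pg3 (fun t y z => u1 (c t y z)) by exact: pg3_comp.
have pg' : pg3 (fun t y z => u1 (c t y z) * c' t y z) by exact: pg3M.
pose w (t y : R) := gE (fun z => u1 (c t y z)).
have pw (t0 : R) : pg (w t0) by exact: (gE_pg (pg3_section1 t0 pu1c)).
have pu2c (t0 : R) : pg2 (fun y z => u2 (c t0 y z)).
  exact: (pg3_section1 t0 (pg3_comp pu'' pc)).
have pw' (t0 : R) : pg (fun y => gE (fun z => u2 (c t0 y z))) by exact: gE_pg.
have inner (t0 y : R) : gE (fun z => u1 (c t0 y z) * c' t0 y z) =
    a * - sin t0 * (y * w t0 y) + a * cos t0 * (a * sin t0) * gE (fun z => u2 (c t0 y z)).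
  have p1 : pg (fun z => u1 (c t0 y z)) by exact: (pg2_section y (pg3_section1 t0 pu1c)).
  have p2 : pg (fun z => u2 (c t0 y z)) by exact: (pg2_section _ (pu2c t0)).
  rewrite (_ : (fun z => _) = (fun z => (a * - sin t0 * y) * u1 (c t0 y z) +
       a * cos t0 * (z * u1 (c t0 y z)))); last by apply/funext => z; rewrite /c'; ring.
  rewrite gED; [|exact: pgZ|by apply: pgZ; apply: pgM => //; exact: pg_id].
  rewrite gEZ// gEZ; last by apply: pgM => //; exact: pg_id.
  have d1 (z : R) : is_derive z 1 (fun z => u1 (c t0 y z)) (a * sin t0 * u2 (c t0 y z)).
    rewrite mulrC; apply: (@is_derive1_fcomp _ u1 (c t0 y) _ _ _ (du' _)).
    exact: is_derive1_affine.
  by rewrite -(gE_ibp p1 (pgZ _ p2) d1) gEZ// -/(w t0 y); ring.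
have outer (t0 : R) : gE (fun y => y * w t0 y) = a * cos t0 * gE (fun y => gE (fun z => u2 (c t0 y z))).
  rewrite -[RHS](gEZ _ (pw' t0)); symmetry.
  apply: gE_ibp; [exact: pw|exact: pgZ|].
  move=> y; rewrite -(gEZ _ (pg2_section y (pu2c t0))).
  apply: (gE_derive (g := fun y z => a * cos t0 * u2 (c t0 y z))).
  - exact: (pg3_section1 t0 pu1c).
  - apply: (pg2M (f := fun _ _ => a * cos t0)) => //.
    by apply: (pg2_fst (u := fun=> a * cos t0)); exact: pg_cst.
  move=> y0 z; rewrite mulrC; apply: (@is_derive1_fcomp _ u1 (fun y => c t0 y z) _ _ _ (du' _)).
  have := is_derive1D (is_derive1_affine x (a * cos t0) y0) (is_derive_cst (a * sin t0 * z) y0 1).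
  by rewrite addr0.
have dF (t0 : R) : is_derive t0 1 (fun t => gE (fun y => gE (fun z => u (c t y z)))) 0.
  have := gE_derive (f := fun t y => gE (fun z => u (c t y z)))
     (g := fun t y => gE (fun z => u1 (c t y z) * c' t y z)) t0 (gE_pg3 puc) (gE_pg3 pg').
  move=> /(_ _)/is_derive_eq; apply.
    move=> t1 y; apply: (gE_derive (g := fun t z => u1 (c t y z) * c' t y z)).
    - exact: (pg3_section2 y puc).
    - exact: (pg3_section2 y pg').
  have pyw : pg (fun y => y * w t0 y) by apply: pgM => //; exact: pg_id.
  under eq_fun do rewrite inner.
  apply: (eq_trans (gE_lin _ _ pyw (pw' t0))).
  by rewrite outer; ring.
rewrite [LHS](is_derive_0_is_cst t 0 dF); congr gE; apply/funext => y.
under eq_fun do rewrite /c cos0 sin0 mulr0 mul0r mulr1 addr0.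
exact: gE_cst.
Qed.

(** Symmetry of the normal law, obtained as the rotation by [pi], where the sine vanishes and the
    cosine is -1. *)
Lemma gE_sym u x a : Ck 2 u -> gE (fun y => u (x - a * y)) = gE (fun y => u (x + a * y)).
Proof.
move=> Cu; rewrite -(gE_rotation x a pi Cu); congr gE; apply/funext => y.
rewrite (_ : (fun z => _) = fun=> u (x - a * y)) ?gE_cst//.
by apply/funext => z; rewrite cospi sinpi mulr0 mul0r addr0 mulrN1 mulNr.
Qed.

(* The heat semigroup, parametrized by the variance [s]. *)
Definition G s u x := gE (fun z => u (x + Num.sqrt s * z)).

Lemma G0 u : G 0 u = u.
Proof.
apply/funext => x; rewrite /G; under eq_fun do rewrite sqrtr0 mul0r addr0.
exact: gE_cst.
Qed.

Lemma G_semigroup u s t : 0 <= s -> 0 <= t -> Ck 2 u -> G s (G t u) = G (s + t) u.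
Proof.
rewrite le_eqVlt => /predU1P[<-|s0] t0 Cu; first by rewrite G0 add0r.
apply/funext => x; rewrite /G; set a := Num.sqrt (s + t).
have a0 : 0 < a by rewrite sqrtr_gt0 ltr_wpDr.
have sa : Num.sqrt s <= a by rewrite ler_wsqrtr// lerDl.
have I01 : -1 <= Num.sqrt s / a <= 1.
  apply/andP; split; last by rewrite ler_pdivrMr// mul1r.
  by apply: (@le_trans _ _ 0); rewrite ?lerN10// divr_ge0 ?sqrtr_ge0// ltW.
(* The angle is chosen with [a] times its cosine equal to [Num.sqrt s]; then [a] times its sine is
   [Num.sqrt t], because [a ^+ 2 = s + t]. *)
rewrite -(gE_rotation x a (acos (Num.sqrt s / a)) Cu); congr gE; apply/funext => y.
rewrite acosK ?in_itv//= sin_acos// mulrCA divff ?gt_eqF// mulr1.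
congr gE; apply/funext => z; congr (u (_ + _ * _)).
rewrite -[a in a * _]ger0_norm ?ltW// -sqrtr_sqr -sqrtrM ?sqr_ge0//; congr Num.sqrt.
have aE : a ^+ 2 = s + t by rewrite sqr_sqrtr// addr_ge0// ltW.
rewrite mulrBr mulr1 expr_div_n mulrCA divff ?mulr1 ?expf_neq0 ?gt_eqF//.
by rewrite aE sqr_sqrtr ?ltW// addrC addKr.
Qed.

Lemma pg2_shift u s : pg u -> pg2 (fun x z => u (x + s * z)).
Proof.
move=> pu; apply: (pg2_comp pu); split.
- by move=> z x; apply: cvgD; [exact: cvg_id|exact: cvg_cst].
- by move=> x z; apply: cvgD; [exact: cvg_cst|apply: cvgM; [exact: cvg_cst|exact: cvg_id]].
exists (1 + `|s|), 1%N; split; first by rewrite addr_ge0.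
move=> x z; rewrite expr1; apply: (le_trans (ler_normD _ _)); rewrite normrM.
have x0 := normr_ge0 x; have z0 := normr_ge0 z; have s0 := normr_ge0 s.
have xz := mulr_ge0 x0 z0; have sx := mulr_ge0 s0 x0; have sz := mulr_ge0 s0 z0.
have sxz := mulr_ge0 s0 xz; lra.
Qed.

Lemma pg_G s u : pg u -> pg (G s u).
Proof. by move=> pu; apply: gE_pg; exact: pg2_shift. Qed.

Lemma G_is_derive s u x : Ck 1 u -> is_derive x 1 (G s u) (G s u^`() x).
Proof.
move=> Cu; have [pu [_ [pu' _]]] := Cu.
apply: (gE_derive (f := fun x z => u (x + Num.sqrt s * z))
  (g := fun x z => derive1 u (x + Num.sqrt s * z))); [exact: pg2_shift|exact: pg2_shift|].
move=> y z; rewrite -[X in is_derive _ _ _ X]mulr1.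
apply: is_derive1_fcomp; first exact: (Ck_is_derive Cu).
have := is_derive1D (is_derive_id y 1) (is_derive_cst (Num.sqrt s * z) y 1).
by rewrite addr0.
Qed.

Lemma Ck_G k s u : Ck k u -> Ck k (G s u).
Proof.
elim: k u => [|k IH] u Cu; first by split => //; apply: pg_G; exact: Ck_pg Cu.
apply: CkP; first by apply: pg_G; exact: Ck_pg Cu.
  by move=> x; apply: G_is_derive; apply: (Ck_le _ Cu).
by apply: IH; exact: CkS.
Qed.

Lemma derive1n_G k s u : Ck k u -> (G s u)^`(k) = G s u^`(k).
Proof.
elim: k u => // k IH u Cu; rewrite !derive1Sn -IH; last exact: CkS.
congr (_^`(k)); apply: is_derive_derive1 => x.
by apply: G_is_derive; apply: (Ck_le _ Cu).
Qed.

(* The derivative of [G s u], written without differentiating [u]: integrate by parts. *)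
Definition M s u x := (Num.sqrt s)^-1 * gE (fun z => z * u (x + Num.sqrt s * z)).

Lemma pg2_zshift u s : pg u -> pg2 (fun x z => z * u (x + s * z)).
Proof.
move=> pu; apply: (pg2M (f := fun _ z => z)); last exact: pg2_shift.
by apply: pg2_snd; exact: pg_id.
Qed.

Lemma pg_M s u : pg u -> pg (M s u).
Proof. by move=> pu; apply: pgZ; apply: gE_pg; exact: pg2_zshift. Qed.

Lemma G_M s u : 0 < s -> Ck 1 u -> G s u^`() = M s u.
Proof.
move=> s0 Cu; have [pu [_ [pu' _]]] := Cu; apply/funext => x; rewrite /M.
have r0 : Num.sqrt s != 0 by rewrite gt_eqF// sqrtr_gt0.
have du (z : R) : is_derive z 1 (fun z => u (x + Num.sqrt s * z))
    (Num.sqrt s * derive1 u (x + Num.sqrt s * z)).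
  rewrite mulrC; apply: is_derive1_fcomp; first exact: (Ck_is_derive Cu).
  exact: is_derive1_affine.
rewrite -(gE_ibp (pg_affine x (Num.sqrt s) pu) (pgZ _ (pg_affine x (Num.sqrt s) pu')) du).
by rewrite gEZ ?mulKf//; exact: pg_affine.
Qed.

Lemma M_is_derive s u x : Ck 1 u -> is_derive x 1 (M s u) (M s u^`() x).
Proof.
move=> Cu; have [pu [_ [pu' _]]] := Cu; apply: is_derive1Z.
apply: (gE_derive (f := fun x z => z * u (x + Num.sqrt s * z))
  (g := fun x z => z * derive1 u (x + Num.sqrt s * z))); [exact: pg2_zshift|exact: pg2_zshift|].
move=> y z; apply: is_derive1Z; rewrite -[X in is_derive _ _ _ X]mulr1.
apply: is_derive1_fcomp; first exact: (Ck_is_derive Cu).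
have := is_derive1D (is_derive_id y 1) (is_derive_cst (Num.sqrt s * z) y 1).
by rewrite addr0.
Qed.

(** One derivative is gained: [k.+1] of them fall on [u], and one more is moved to the Gaussian
    weight, which turns [G] into [M]. *)
Lemma Ck_G_smooth k s u : 0 < s -> Ck k.+1 u ->
  Ck k.+2 (G s u) /\ (G s u)^`(k.+2) = M s u^`(k.+1).
Proof.
move=> s0; elim: k u => [|k IH] u Cu; last first.
  have [C E] := IH _ (CkS Cu); have C1 : Ck 1 u by apply: (Ck_le _ Cu).
  have G1 : (G s u)^`() = G s u^`() := is_derive_derive1 (fun x => G_is_derive s x C1).
  split.
    2: { apply: (eq_trans (derive1Sn (G s u) k.+2)); rewrite G1.
         apply: (eq_trans E); congr (M s _); exact/esym/derive1Sn. }
  apply: CkP C; first by apply: pg_G; exact: Ck_pg Cu.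
  by move=> x; exact: G_is_derive.
have [pu [_ [pu' _]]] := Cu.
have G' x : is_derive x 1 (G s u) (M s u x) by rewrite -G_M//; exact: G_is_derive.
split; last first.
  change ((G s u)^`()^`() = M s u^`()).
  by rewrite (is_derive_derive1 G') (is_derive_derive1 (fun x => M_is_derive s x Cu)).
apply: CkP G' _; first exact: pg_G.
apply: CkP (fun x => M_is_derive s x Cu) _; first exact: pg_M.
by split => //; exact: pg_M.
Qed.

Lemma gE_id : gE (fun z : R => z) = 0.
Proof.
rewrite -[RHS](gE_cst 0) (@gE_ibp _ (fun=> 1) (fun=> 0)); try exact: pg_cst.
by congr gE; apply/funext => z; rewrite mulr1.
Qed.

Lemma pg_pow k : pg (fun z : R => z ^+ k).
Proof. by apply: pgX; exact: pg_id. Qed.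

Lemma is_derive_pow k x : is_derive x 1 (fun z : R => z ^+ k.+1) (k.+1%:R * x ^+ k).
Proof.
elim: k => [|k IH].
  rewrite expr0 mulr1 (_ : (fun z => _) = id); first exact: is_derive_id.
  by apply/funext => z; rewrite expr1.
rewrite (_ : (fun z => _) = fun z => z * z ^+ k.+1); last by apply/funext => z; rewrite exprS.
apply: (is_derive_eq (is_derive1M (is_derive_id x 1) IH)).
by rewrite mul1r mulrCA -exprS -[in RHS]natr1 mulrDl mul1r addrC.
Qed.

Lemma gE_powS k : gE (fun z : R => z ^+ k.+2) = k.+1%:R * gE (fun z => z ^+ k).
Proof.
rewrite -gEZ; last exact: pg_pow.
rewrite (gE_ibp (pg_pow k.+1) (pgZ k.+1%:R (pg_pow k)) (is_derive_pow k)).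
by congr gE; apply/funext => z; rewrite -exprS.
Qed.

Lemma gE_pow2 : gE (fun z : R => z ^+ 2) = 1.
Proof. by rewrite gE_powS mul1r gE_cst. Qed.

Lemma gE_pow3 : gE (fun z : R => z ^+ 3) = 0.
Proof. by rewrite gE_powS gE_id mulr0. Qed.

Lemma gE_pow4 : gE (fun z : R => z ^+ 4) = 3.
Proof. by rewrite gE_powS gE_pow2 mulr1. Qed.

Lemma pg_normpow k : pg (fun z : R => `|z| ^+ k).
Proof. by apply: pgX; apply: pg_norm; exact: pg_id. Qed.

Lemma gE_norm1 : gE (fun z : R => `|z|) <= 1.
Proof.
have p1 : pg (fun z : R => 1 / 2 + 1 / 2 * z ^+ 2).
  by apply: pgD; [exact: pg_cst|apply: pgZ; exact: pg_pow].
have -> : 1 = gE (fun z : R => 1 / 2 + 1 / 2 * z ^+ 2).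
  rewrite gED; [|exact: pg_cst|by apply: pgZ; exact: pg_pow].
  by rewrite gE_cst gEZ ?gE_pow2; [field|exact: pg_pow].
apply: gE_le => //; first by apply: pg_norm; exact: pg_id.
by move=> z; rewrite -(real_normK (num_real z)); have := sqr_ge0 (`|z| - 1); lra.
Qed.

(** From [|z|^3 <= (z^2 + z^4) / 2], that is [z^2 (|z| - 1)^2 >= 0], and the moments 1 and 3. The
    same interpolation gives [iter_twopt_norm3] and [absmom3_le]. *)
Lemma gE_norm3 : gE (fun z : R => `|z| ^+ 3) <= 2.
Proof.
have p1 : pg (fun z : R => 1 / 2 * z ^+ 2 + 1 / 2 * z ^+ 4).
  by apply: pgD; apply: pgZ; exact: pg_pow.
have -> : 2 = gE (fun z : R => 1 / 2 * z ^+ 2 + 1 / 2 * z ^+ 4).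
  rewrite gED; try (by apply: pgZ; exact: pg_pow).
  by rewrite !gEZ ?gE_pow2 ?gE_pow4; try exact: pg_pow; field.
apply: gE_le => //; first exact: pg_normpow.
move=> z; rewrite (_ : z ^+ 4 = `|z| ^+ 4); last by rewrite -normrX ger0_norm// exprn_even_ge0.
by rewrite -(real_normK (num_real z)); have := sqr_ge0 (`|z| * (`|z| - 1)); lra.
Qed.

Lemma M_bound s u B : 0 < s -> pg u -> (forall x, `|u x| <= B) ->
  forall x, `|M s u x| <= B / Num.sqrt s.
Proof.
move=> s0 pu uB x; rewrite /M normrM mulrC [X in _ * X]ger0_norm ?invr_ge0 ?sqrtr_ge0//.
apply: ler_wpM2r; first by rewrite invr_ge0 sqrtr_ge0.
have B0 : 0 <= B by exact: le_trans (uB 0).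
apply: (@le_trans _ _ (gE (fun z => B * `|z|))).
  apply: gE_norm_le.
  - exact: (pg2_section x (pg2_zshift (Num.sqrt s) pu)).
  - by apply: pgZ; apply: pg_norm; exact: pg_id.
  - by move=> z; rewrite normrM mulrC; apply: ler_wpM2r.
rewrite gEZ; last by apply: pg_norm; exact: pg_id.
by rewrite ler_piMr// gE_norm1.
Qed.

Lemma G_bound s u B : pg u -> (forall x, `|u x| <= B) -> forall x, `|G s u x| <= B.
Proof.
move=> pu uB x; rewrite -[leRHS](gE_cst B); apply: gE_norm_le => //.
  exact: pg_affine.
exact: pg_cst.
Qed.

(** The variance [i * s] is cut into [i] slices of variance [s]; each slice absorbs one derivative
    at the price [1 / sqrt s] of [M_bound]. *)
Lemma G_iter k i s u B : 0 < s -> Ck k.+2 u -> (forall x, `|u^`(k.+2) x| <= B) ->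
  Ck (i + k.+2) (G (i%:R * s) u) /\
  forall x, `|(G (i%:R * s) u)^`(i + k.+2) x| <= B / Num.sqrt s ^+ i.
Proof.
move=> s0 Cu uB; elim: i => [|i [IHC IHB]].
  by rewrite mul0r G0 expr0 divr1.
have E : G (i.+1%:R * s) u = G s (G (i%:R * s) u).
  have is0 : 0 <= i%:R * s by rewrite mulr_ge0// ltW.
  rewrite (G_semigroup (ltW s0) is0 (@Ck_le 2 k.+2 u isT Cu)).
  by rewrite (_ : i.+1%:R * s = s + i%:R * s)//; rewrite -natr1; ring.
rewrite E addSn.
move: IHC IHB; rewrite addnS => IHC IHB.
have [C ->] := Ck_G_smooth s0 IHC; split => // x.
rewrite exprSr invfM mulrA; have C0 : Ck ((i + k.+1).+1 + 0) (G (i%:R * s) u) by rewrite addn0.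
exact: M_bound s0 (Ck_pg (Ck_derive1n C0)) IHB x.
Qed.

End gauss_semigroup.

(** * Sums of two-point variables *)

Section taylor.
Context {R : realType}.
Local Open Scope classical_set_scope.
Implicit Types (u v g : R -> R) (x y z s t a b B C : R) (k i j : nat).

Lemma power_bound_right g g' C k : (forall x : R, is_derive x 1 g (g' x)) ->
  g 0 = 0 -> (forall y, 0 <= y -> g' y <= C * y ^+ k) ->
  forall y, 0 <= y -> g y <= C * y ^+ k.+1 / k.+1%:R.
Proof.
move=> dg g0 gC y y0.
pose F t := C * t ^+ k.+1 / k.+1%:R - g t.
have dF (t : R) : is_derive t 1 F (C * t ^+ k - g' t).
  have dN : is_derive t 1 (fun t => - g t) (- g' t).
    by have := is_derive1Z (-1) (dg t); under eq_fun do rewrite mulN1r; rewrite mulN1r.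
  have := is_derive1D (is_derive1Mcst (k.+1%:R^-1) (is_derive1Z C (is_derive_pow k t))) dN.
  move=> /is_derive_eq; apply; congr (_ - _); field.
  by rewrite addrC natr1 pnatr_eq0.
have h1 (x : R) : x \in `]0, +oo[%R -> derivable F x 1.
  by move=> _; exact: (@ex_derive _ _ _ _ _ _ _ (dF x)).
have h2 (x : R) : x \in `]0, +oo[%R -> 0 <= F^`()%classic x.
  rewrite in_itv/= andbT => x0.
  rewrite derive1E (@derive_val _ _ _ _ _ _ _ (dF x)) subr_ge0.
  by apply: gC; exact: ltW.
have h3 : {within `[0, +oo[, continuous F}.
  by apply: continuous_subspaceT; exact: is_derive1_cont dF.
have := ger0_derive1_ndecry h1 h2 h3 (lexx 0) y0.
by rewrite /F g0 expr0n/= mulr0 mul0r subrr subr_ge0.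
Qed.

Lemma power_bound g g' C k : (forall x : R, is_derive x 1 g (g' x)) ->
  g 0 = 0 -> (forall y, `|g' y| <= C * `|y| ^+ k) ->
  forall y, `|g y| <= C * `|y| ^+ k.+1 / k.+1%:R.
Proof.
move=> dg g0 gC.
(* The signs [c] and [e] choose the side of the inequality and the half-line, so that
   [power_bound_right] covers all four cases. *)
have scaled (c e : R) : `|c| = 1 -> `|e| = 1 ->
    forall y, 0 <= y -> c * g (e * y) <= C * y ^+ k.+1 / k.+1%:R.
  move=> c1 e1; apply: (@power_bound_right _ (fun y => c * (g' (e * y) * e))).
  - move=> x; apply: is_derive1Z; apply: (@is_derive1_fcomp _ g (fun y => e * y)).
    by have := is_derive1_affine 0 e x; under eq_fun do rewrite add0r.
  - by rewrite mulr0 g0 mulr0.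
  - move=> y y0; apply: (le_trans (ler_norm _)); rewrite !normrM c1 e1 mulr1 mul1r.
    by apply: (le_trans (gC _)); rewrite normrM e1 mul1r ger0_norm.
have n1 : `|-1 : R| = 1 by rewrite normrN normr1.
have p1 : `|1 : R| = 1 by rewrite normr1.
move=> y; rewrite ler_norml; have [y0|y0] := lerP 0 y.
- rewrite ger0_norm//; apply/andP; split.
  + by have := scaled (-1) 1 n1 p1 y y0; rewrite mul1r mulN1r lerNl.
  + by have := scaled 1 1 p1 p1 y y0; rewrite !mul1r.
- have y0' : 0 <= - y by rewrite oppr_ge0 ltW.
  rewrite ltr0_norm//; apply/andP; split.
  + by have := scaled (-1) (-1) n1 n1 _ y0'; rewrite !mulN1r opprK lerNl.
  + by have := scaled 1 (-1) p1 n1 _ y0'; rewrite mul1r mulN1r opprK.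
Qed.

(** As a function of [y] the remainder vanishes at 0, and its derivative is the remainder of one
    order less for the derivative of [u]; [power_bound] integrates the induction hypothesis. *)
Lemma taylor_bound k u B x y : Ck k u -> (forall x, `|u^`(k) x| <= B) ->
  `|u (x + y) - \sum_(j < k) derive1n j u x * (y ^+ j / j`!%:R)| <= B * `|y| ^+ k / k`!%:R.
Proof.
elim: k u y => [|k IH] u y Cu uB.
  by rewrite big_ord0 subr0 expr0 mulr1 fact0 divr1; exact: uB.
pose g y := u (x + y) - \sum_(j < k.+1) derive1n j u x * (y ^+ j / j`!%:R).
pose g' y := derive1 u (x + y) - \sum_(j < k) derive1n j (derive1 u) x * (y ^+ j / j`!%:R).
have dg (t : R) : is_derive t 1 g (g' t).
  have d1 : is_derive t 1 (fun y => u (x + y)) (u^`() (x + t)).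
    rewrite -[X in is_derive _ _ _ X]mulr1.
    apply: (is_derive1_fcomp (Ck_is_derive Cu (x + t))).
    by have := is_derive1_affine x 1 t; under eq_fun do rewrite mul1r.
  have d2 : is_derive t 1 (fun y => - \sum_(j < k.+1) derive1n j u x * (y ^+ j / j`!%:R))
      (- \sum_(j < k) derive1n j (derive1 u) x * (t ^+ j / j`!%:R)).
    have dj (j : 'I_k.+1) : is_derive t 1 (fun y => derive1n j u x * (y ^+ j / j`!%:R))
        (if j : nat is i.+1 then derive1n i.+1 u x * (t ^+ i / i`!%:R) else 0).
      case: j => -[|i] ij /=.
        have -> : (fun y : R => u x * (y ^+ 0 / 0`!%:R)) = cst (u x).
          by apply/funext => z; rewrite expr0 fact0 divr1 mulr1.
        exact: is_derive_cst.
      apply: is_derive1Z.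
      apply: (is_derive_eq (is_derive1Mcst (i.+1`!%:R^-1) (is_derive_pow i t))).
      by rewrite factS natrM invfM mulrACA divff ?pnatr_eq0// mul1r.
    have := is_derive_sum dj; rewrite [X in is_derive _ _ _ X]big_ord_recl/= add0r => dS.
    have dN := is_deriveN dS.
    rewrite (_ : (fun y => _) = - (\sum_(i < k.+1) (fun y => derive1n i u x * (y ^+ i / i`!%:R)))).
      apply: (is_derive_eq dN); congr (- _); apply: eq_bigr => i _.
      by rewrite -derive1Sn.
    by apply/funext => z; rewrite fctE/= fct_sumE.
  exact: is_derive1D d1 d2.
have g0 : g 0 = 0.
  rewrite /g addr0 big_ord_recl/= expr0 fact0 divr1 mulr1.
  rewrite big1 ?addr0 ?subrr// => i _.
  by rewrite exprS mul0r mul0r mulr0.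
have gB z : `|g' z| <= B / k`!%:R * `|z| ^+ k.
  rewrite mulrAC; apply: IH; first exact: CkS.
  by move=> w; rewrite -derive1Sn.
have := power_bound dg g0 gB y; rewrite /g => /le_trans; apply.
rewrite factS natrM invfM le_eqVlt; apply/orP; left; apply/eqP; ring.
Qed.

End taylor.

(** * Normal approximation of a walk with two-point steps *)

Section two_point.
Context {R : realType} (p q al be d : R).
Hypotheses (p0 : 0 <= p) (q0 : 0 <= q) (pq1 : p + q = 1) (d0 : 0 < d).
Hypotheses (mean0 : p * al + q * be = 0) (var1 : p * al ^+ 2 + q * be ^+ 2 = 1).
Local Open Scope classical_set_scope.
Implicit Types (u v f g : R -> R) (x y z s t a b c B C : R) (k i j l n : nat).

(** [T_d] of the overview, for a letter worth [al] with probability [p] and [be] with probability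
    [q]; [stepdiff] below is [D]. The [n]-fold iterate at [x] is the expectation of [u] at [x] plus
    [d] times a sum of [n] letters. *)
Definition twopt u x := p * u (x + d * al) + q * u (x + d * be).

Definition mom j := p * al ^+ j + q * be ^+ j.
Definition absmom j := p * `|al| ^+ j + q * `|be| ^+ j.

Definition stepdiff u x := twopt u x - G (d ^+ 2) u x.

Lemma G_dE u x : G (d ^+ 2) u x = gE (fun z => u (x + d * z)).
Proof. by rewrite /G sqrtr_sqr ger0_norm// ltW. Qed.

Lemma pg_translate u c : pg u -> pg (fun x => u (x + c)).
Proof. by move=> pu; apply: (pg_comp pu); apply: pgD; [exact: pg_id|exact: pg_cst]. Qed.

Lemma pg_twopt u : pg u -> pg (twopt u).
Proof. by move=> pu; apply: pgD; apply: pgZ; exact: pg_translate. Qed.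

Lemma pg_stepdiff u : pg u -> pg (stepdiff u).
Proof. by move=> pu; apply: pgB; [exact: pg_twopt|exact: pg_G]. Qed.

Lemma twopt_is_derive u x : Ck 1 u -> is_derive x 1 (twopt u) (twopt u^`() x).
Proof.
move=> Cu.
have T c : is_derive x 1 (fun x => u (x + c)) (u^`() (x + c)).
  have d1 : is_derive x 1 (fun x => x + c) 1.
    by have := is_derive1D (is_derive_id x 1) (is_derive_cst c x 1); rewrite addr0.
  by have := @is_derive1_fcomp R u (fun x => x + c) _ 1 x (Ck_is_derive Cu (x + c)) d1; rewrite mulr1.
by apply: is_derive1D; apply: is_derive1Z.
Qed.

Lemma stepdiff_is_derive u x : Ck 1 u -> is_derive x 1 (stepdiff u) (stepdiff u^`() x).
Proof.
move=> Cu; have := is_derive1D (twopt_is_derive x Cu) (is_derive1Z (-1) (G_is_derive (d ^+ 2) x Cu)).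
by under eq_fun do rewrite mulN1r; rewrite mulN1r.
Qed.

Lemma Ck_stepdiff k u : Ck k u -> Ck k (stepdiff u).
Proof.
elim: k u => [|k IH] u Cu; first by split => //; apply: pg_stepdiff; exact: Ck_pg Cu.
apply: CkP; first by apply: pg_stepdiff; exact: Ck_pg Cu.
  by move=> x; apply: stepdiff_is_derive; exact: (@Ck_le _ 1 k.+1 u isT Cu).
by apply: IH; exact: CkS.
Qed.

Lemma derive1n_stepdiff k u : Ck k u -> (stepdiff u)^`(k) = stepdiff u^`(k).
Proof.
elim: k u => // k IH u Cu; rewrite !derive1Sn -IH; last exact: CkS.
congr (_^`(k)); apply: is_derive_derive1 => x.
by apply: stepdiff_is_derive; exact: (@Ck_le _ 1 k.+1 u isT Cu).
Qed.

Lemma derive1n_add k l u : u^`(k + l) = u^`(l)^`(k).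
Proof. exact: iterD. Qed.

(** The order of [D] as an approximation error. Orders 2 and 3 hold for every standardized letter,
    order 4 is reached when the third moment vanishes, and nested differences are treated alike in
    all cases. *)
Definition stepdiff_order l c := forall v B, Ck l v -> (forall x, `|v^`(l) x| <= B) ->
  forall x, `|stepdiff v x| <= c * B.

(** [D] commutes with derivatives: [l] of the [l + l] derivatives pay for the outer difference, the
    other [l] for the inner one. *)
Lemma stepdiff2_bound l c v B : stepdiff_order l c -> Ck (l + l) v ->
  (forall x, `|v^`(l + l) x| <= B) ->
  forall x, `|stepdiff (stepdiff v) x| <= c * (c * B).
Proof.
move=> Hl Cv vB; have Clv : Ck l v by exact: (@Ck_le _ l (l + l) v (leq_addr _ _) Cv).
apply: (Hl); first exact: Ck_stepdiff.
rewrite derive1n_stepdiff//; apply: (Hl); first exact: Ck_derive1n.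
by move=> x; rewrite -derive1n_add.
Qed.

Lemma twopt_bound f B : (forall x, `|f x| <= B) -> forall x, `|twopt f x| <= B.
Proof.
move=> fB x; apply: (le_trans (ler_normD _ _)); rewrite !normrM (ger0_norm p0) (ger0_norm q0).
rewrite -[leRHS]mul1r -pq1 mulrDl; by apply: lerD; apply: ler_wpM2l.
Qed.

Lemma stepdiff_bound f B : pg f -> (forall x, `|f x| <= B) -> forall x, `|stepdiff f x| <= 2 * B.
Proof.
move=> pf fB x; apply: (le_trans (ler_normB _ _)); rewrite mulr_natl mulr2n; apply: lerD.
  exact: twopt_bound.
exact: G_bound.
Qed.

Lemma twopt_taylor k v B x : Ck k v -> (forall x, `|v^`(k) x| <= B) ->
  `|twopt v x - \sum_(j < k) derive1n j v x * (d ^+ j * mom j / j`!%:R)| <=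
  B * d ^+ k * absmom k / k`!%:R.
Proof.
move=> Cv vB.
have Ta := taylor_bound x (d * al) Cv vB; have Tb := taylor_bound x (d * be) Cv vB.
rewrite (_ : _ - _ = p * (v (x + d * al) - \sum_(j < k) derive1n j v x * ((d * al) ^+ j / j`!%:R)) +
    q * (v (x + d * be) - \sum_(j < k) derive1n j v x * ((d * be) ^+ j / j`!%:R))); last first.
  rewrite !mulrBr addrACA -opprD; congr (_ - _).
  rewrite !mulr_sumr -big_split; apply: eq_bigr => j _ /=.
  by rewrite /mom !exprMn; ring.
apply: (le_trans (ler_normD _ _)); rewrite !normrM (ger0_norm p0) (ger0_norm q0).
rewrite (_ : B * d ^+ k * absmom k / k`!%:R = p * (B * `|d * al| ^+ k / k`!%:R) +
   q * (B * `|d * be| ^+ k / k`!%:R)); last first.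
  by rewrite /absmom !normrM !exprMn ger0_norm ?ltW//; ring.
by apply: lerD; apply: ler_wpM2l.
Qed.

Lemma pg_sum k (f : 'I_k -> R -> R) : (forall i0 : 'I_k, pg (f i0)) -> pg (fun x => \sum_(j < k) f j x).
Proof.
elim: k f => [|k IH] f pf; first by under eq_fun do rewrite big_ord0; exact: pg_cst.
by under eq_fun do rewrite big_ord_recl; apply: pgD => //; exact: IH.
Qed.

Lemma gE_sum k (f : 'I_k -> R -> R) : (forall i0 : 'I_k, pg (f i0)) ->
  gE (fun x => \sum_(j < k) f j x) = \sum_(j < k) gE (f j).
Proof.
elim: k f => [|k IH] f pf.
  by under eq_fun do rewrite big_ord0; rewrite big_ord0 gE_cst.
under eq_fun do rewrite big_ord_recl.
by rewrite big_ord_recl gED ?IH//; exact: pg_sum.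
Qed.

Lemma G_taylor k v B x : Ck k v -> (forall x, `|v^`(k) x| <= B) ->
  `|G (d ^+ 2) v x - \sum_(j < k) derive1n j v x * (d ^+ j * gE (fun z => z ^+ j) / j`!%:R)| <=
  B * d ^+ k * gE (fun z => `|z| ^+ k) / k`!%:R.
Proof.
move=> Cv vB; rewrite G_dE.
pose f (j : 'I_k) z := derive1n j v x * (d ^+ j / j`!%:R) * z ^+ j.
have pf (j : 'I_k) : pg (f j) by apply: pgZ; exact: pg_pow.
rewrite (_ : \sum_(j < k) _ = gE (fun z => \sum_(j < k) f j z)); last first.
  by rewrite gE_sum//; apply: eq_bigr => j _; rewrite gEZ; [ring|exact: pg_pow].
have pv : pg (fun z => v (x + d * z)) by apply: pg_affine; exact: Ck_pg Cv.
rewrite -gEB//; last exact: pg_sum.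
rewrite (_ : B * _ * _ / _ = gE (fun z => B * d ^+ k / k`!%:R * `|z| ^+ k)); last first.
  by rewrite gEZ; [ring|exact: pg_normpow].
apply: gE_norm_le.
- by apply: pgB => //; exact: pg_sum.
- by apply: pgZ; exact: pg_normpow.
- move=> z; have := taylor_bound x (d * z) Cv vB.
  rewrite (_ : \sum_(j < k) f j z = \sum_(j < k) derive1n j v x * ((d * z) ^+ j / j`!%:R)); last first.
    by apply: eq_bigr => j _; rewrite /f exprMn; ring.
  by rewrite normrM exprMn (ger0_norm (ltW d0)) => /le_trans; apply; rewrite le_eqVlt; apply/orP; left;
    apply/eqP; ring.
Qed.

(** Matching moments cancel: with mean 0 and variance 1, the first term that can survive in the sum
    is that of the third moment. *)
Lemma stepdiff_taylor k v B x : Ck k v -> (forall x, `|v^`(k) x| <= B) ->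
  `|stepdiff v x - \sum_(j < k) derive1n j v x * (d ^+ j * (mom j - gE (fun z => z ^+ j)) / j`!%:R)| <=
  B * d ^+ k * (absmom k + gE (fun z => `|z| ^+ k)) / k`!%:R.
Proof.
move=> Cv vB; have T1 := twopt_taylor x Cv vB; have T2 := G_taylor x Cv vB.
rewrite (_ : \sum_(j < k) _ = \sum_(j < k) derive1n j v x * (d ^+ j * mom j / j`!%:R) -
   \sum_(j < k) derive1n j v x * (d ^+ j * gE (fun z => z ^+ j) / j`!%:R)); last first.
  by rewrite -sumrB; apply: eq_bigr => j _; ring.
rewrite /stepdiff; set a := twopt v x in T1 *; set b := G _ v x in T2 *.
set S1 := \sum_(j < k) _ in T1 *; set S2 := \sum_(j < k) _ in T2 *.
rewrite (_ : a - b - (S1 - S2) = (a - S1) - (b - S2)); last by ring.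
apply: (le_trans (ler_normB _ _)); apply: (le_trans (lerD T1 T2)).
by rewrite le_eqVlt; apply/orP; left; apply/eqP; ring.
Qed.

(* [beta * d^3] bounds the one-step error on a function with third derivative at most 1:
   [beta = (E|xi|^3 + 2) / 6] and [E|Z|^3 <= 2] for [Z] standard normal. *)
Definition beta := (absmom 3 + 2) / 6.

Lemma mom0 : mom 0 = 1.
Proof. by rewrite /mom !expr0 !mulr1. Qed.

Lemma mom1 : mom 1 = 0.
Proof. by rewrite /mom !expr1. Qed.

Lemma absmom2 : absmom 2 = 1.
Proof. by rewrite /absmom !real_normK ?num_real. Qed.

Lemma absmom4 : absmom 4 = mom 4.
Proof. by rewrite /absmom /mom -!normrX !ger0_norm// exprn_even_ge0. Qed.

Lemma absmom_ge0 k : 0 <= absmom k.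
Proof. by rewrite addr_ge0// mulr_ge0// exprn_ge0. Qed.

Lemma beta_ge0 : 0 <= beta.
Proof. by rewrite divr_ge0// addr_ge0// absmom_ge0. Qed.

Lemma stepdiff_order2 : stepdiff_order 2 (d ^+ 2).
Proof.
move=> v B Cv vB x; have := stepdiff_taylor x Cv vB.
rewrite !big_ord_recr big_ord0/= mom0 mom1 gE_cst expr1 gE_id !subrr !(mulr0, mul0r, addr0) subr0.
rewrite absmom2 (_ : gE _ = 1); last first.
  by rewrite -gE_pow2; congr gE; apply/funext => z; rewrite real_normK ?num_real.
by rewrite (_ : 2`!%:R = 2)// => /le_trans; apply; rewrite le_eqVlt; apply/orP; left; apply/eqP; field.
Qed.

Lemma stepdiff_order3 : stepdiff_order 3 (beta * d ^+ 3).
Proof.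
move=> v B Cv vB x; have := stepdiff_taylor x Cv vB.
rewrite !big_ord_recr big_ord0/= mom0 mom1 gE_cst expr1 gE_id /mom var1 gE_pow2.
rewrite !subrr !(mulr0, mul0r, addr0) subr0 (_ : 3`!%:R = 6)//.
move/le_trans; apply.
have B0 : 0 <= B by exact: le_trans (vB 0).
have d3 : 0 <= d ^+ 3 by rewrite exprn_ge0// ltW.
rewrite /beta (_ : _ * B = B * d ^+ 3 * ((absmom 3 + 2) / 6)); last by ring.
rewrite -mulrA; apply: ler_wpM2l; first exact: mulr_ge0.
by apply: ler_wpM2r; [rewrite invr_ge0|rewrite lerD2l gE_norm3].
Qed.

Lemma stepdiff_main v B x : Ck 4 v -> (forall x, `|v^`(4) x| <= B) ->
  `|stepdiff v x - mom 3 * d ^+ 3 / 6 * derive1n 3 v x| <= (mom 4 + 3) / 24 * d ^+ 4 * B.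
Proof.
move=> Cv vB; have := stepdiff_taylor x Cv vB.
rewrite !big_ord_recr big_ord0/= mom0 mom1 gE_cst expr1 gE_id gE_pow2 gE_pow3.
rewrite (_ : mom 2 = 1)// absmom4 (_ : gE _ = 3); last first.
  by rewrite -gE_pow4; congr gE; apply/funext => z; rewrite -normrX ger0_norm// exprn_even_ge0.
rewrite !subrr !(mulr0, mul0r, addr0, add0r) subr0.
rewrite (_ : 3`!%:R = 6)// (_ : 4`!%:R = 24)//.
set a := stepdiff v x; set w := derive1n 3 v x.
rewrite (_ : w * _ = mom 3 * d ^+ 3 / 6 * w); last by ring.
by move/le_trans; apply; rewrite le_eqVlt; apply/orP; left; apply/eqP; ring.
Qed.

Lemma G_twopt s u : pg u -> G s (twopt u) = twopt (G s u).
Proof.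
move=> pu; apply/funext => x; rewrite /G /twopt.
have pc c : pg (fun z => u (x + Num.sqrt s * z + c)).
  by have := pg_translate c pu; move=> /(pg_affine x (Num.sqrt s)).
rewrite (gE_lin p q (pc (d * al)) (pc (d * be))).
by congr (_ * gE _ + _ * gE _); apply/funext => z; rewrite addrAC.
Qed.

Lemma G_stepdiff s u : 0 <= s -> Ck 2 u -> G s (stepdiff u) = stepdiff (G s u).
Proof.
move=> s0 Cu; have pu := Ck_pg Cu; have dd : 0 <= d ^+ 2 by rewrite exprn_ge0// ltW.
apply/funext => x; transitivity (G s (twopt u) x - G s (G (d ^+ 2) u) x).
  exact: (gEB (pg_affine x (Num.sqrt s) (pg_twopt pu)) (pg_affine x (Num.sqrt s) (pg_G (d ^+ 2) pu))).
by rewrite /stepdiff (G_twopt _ pu) (G_semigroup s0 dd Cu) (G_semigroup dd s0 Cu) (addrC s).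
Qed.

Definition Gk k := G (k%:R * d ^+ 2).

Lemma GkS k u : Ck 2 u -> G (d ^+ 2) (Gk k u) = Gk k.+1 u.
Proof.
move=> Cu; have dd : 0 <= d ^+ 2 by rewrite exprn_ge0// ltW.
rewrite /Gk G_semigroup//; last by rewrite mulr_ge0.
by rewrite (_ : d ^+ 2 + _ = k.+1%:R * d ^+ 2)//; rewrite -[k.+1%:R]natr1; ring.
Qed.

Lemma Ck_Gk k j u : Ck k u -> Ck k (Gk j u).
Proof. exact: Ck_G. Qed.

(* Telescoping gives [T^k - G^k] as the sum of the [T^i D G^(k-1-i)], where [T = twopt] and
   [D = T - G]; changing each [T^i] into [G^i] makes it [k D G^(k-1)], and [err] is the
   price of this change, in which [D] appears twice (lemma [errS]). *)
Definition err u k x := iter k twopt u x - Gk k u x - k%:R * stepdiff (Gk k.-1 u) x.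

Lemma twoptE w y : twopt w y = stepdiff w y + G (d ^+ 2) w y.
Proof. by rewrite /stepdiff subrK. Qed.

Lemma twopt_lin f g v c x :
  twopt (fun y => f y - g y - c * v y) x = twopt f x - twopt g x - c * twopt v x.
Proof. by rewrite /twopt; ring. Qed.

Lemma err1 u x : err u 1 x = 0.
Proof. by rewrite /err /Gk mul0r G0 mul1r /= mul1r /stepdiff subrr. Qed.

(** [T] sends [G^(j+1)] to [D G^(j+1) + G^(j+2)] and [D G^j] to [D D G^j + D G^(j+1)]. The terms
    [D G^(j+1)] add up to the [j + 2] copies subtracted in [err], which leaves [j + 1] double
    differences. *)
Lemma errS u j x : Ck 2 u ->
  err u j.+2 x = twopt (err u j.+1) x + j.+1%:R * stepdiff (stepdiff (Gk j u)) x.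
Proof.
move=> Cu; have dd : 0 <= d ^+ 2 by rewrite exprn_ge0// ltW.
have E1 y : twopt (Gk j.+1 u) y = stepdiff (Gk j.+1 u) y + Gk j.+2 u y.
  by rewrite twoptE (GkS j.+1 Cu).
have E2 y : twopt (stepdiff (Gk j u)) y =
    stepdiff (stepdiff (Gk j u)) y + stepdiff (Gk j.+1 u) y.
  by rewrite twoptE (G_stepdiff dd (Ck_Gk j Cu)) (GkS j Cu).
have L : twopt (err u j.+1) x = iter j.+2 twopt u x - twopt (Gk j.+1 u) x -
    j.+1%:R * twopt (stepdiff (Gk j u)) x.
  exact: (twopt_lin (iter j.+1 twopt u) (Gk j.+1 u) (stepdiff (Gk j u)) j.+1%:R x).
rewrite L E1 E2 /err -[j.+2%:R]natr1 /=; ring.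
Qed.

(** Averaging by [T] preserves a uniform bound, so the recursion [errS] only adds its new term at
    each step. *)
Lemma err_bound u (b : nat -> R) : Ck 2 u ->
  (forall j x, `|stepdiff (stepdiff (Gk j u)) x| <= b j) ->
  forall k x, `|err u k.+1 x| <= \sum_(r < k) r.+1%:R * b r.
Proof.
move=> Cu ub; elim=> [|k IH] x; first by rewrite err1 normr0 big_ord0.
rewrite errS// big_ord_recr/=; apply: (le_trans (ler_normD _ _)); apply: lerD.
  exact: twopt_bound.
by rewrite normrM ger0_norm//; apply: ler_wpM2l.
Qed.

(** Lindeberg's replacement of one letter at a time by a Gaussian of the same variance. *)
Lemma onelevel_bound u (b : nat -> R) : Ck 2 u ->
  (forall j x, `|stepdiff (Gk j u) x| <= b j) ->
  forall k x, `|iter k twopt u x - Gk k u x| <= \sum_(r < k) b r.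
Proof.
move=> Cu ub; elim=> [|k IH] x; first by rewrite big_ord0 /Gk mul0r G0 subrr normr0.
rewrite big_ord_recr/=.
rewrite (_ : _ - _ = twopt (fun y => iter k twopt u y - Gk k u y) x + stepdiff (Gk k u) x).
  by apply: (le_trans (ler_normD _ _)); apply: lerD => //; exact: twopt_bound.
rewrite -(GkS k Cu) /stepdiff /twopt; ring.
Qed.

(** The right-hand side is shaped for the induction: with [x = k + 1], the new term
    [6 (x + 1) / x^3] is at most [36 / x - 36 / (x + 1)] since [(x + 1)^2 <= 6 x^2], and both sides
    equal 2 at [k = 0]. *)
Lemma sum_cube_bound k : \sum_(r < k.+1) r.+1%:R * (if r : nat is 0%N then 2 else 6 / r%:R ^+ 3) <=
  38 - 36 / k.+1%:R :> R.
Proof.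
elim: k => [|k IH]; first by rewrite big_ord_recr big_ord0/=; lra.
rewrite big_ord_recr/=; apply: (le_trans (lerD IH (lexx _))).
rewrite -[k.+2%:R]natr1; set x : R := k.+1%:R.
have x1 : 1 <= x by rewrite ler1n.
rewrite -subr_ge0 (_ : _ - _ = 6 * (6 * x ^+ 2 - (x + 1) ^+ 2) / (x ^+ 3 * (x + 1))); last first.
  by field; apply/andP; split; rewrite gt_eqF//; lra.
apply: divr_ge0; first nra.
by apply: mulr_ge0; [apply: exprn_ge0|]; lra.
Qed.

Lemma sqrt_diff_bound k : (Num.sqrt k.+1%:R)^-1 <= 2 * (Num.sqrt k.+1%:R - Num.sqrt k%:R) :> R.
Proof.
set x : R := Num.sqrt k.+1%:R; set y : R := Num.sqrt k%:R.
have x0 : 0 < x by rewrite sqrtr_gt0.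
have y0 : 0 <= y by rewrite sqrtr_ge0.
have xy : x ^+ 2 = y ^+ 2 + 1 by rewrite !sqr_sqrtr// natr1.
by rewrite -div1r ler_pdivrMr//; nra.
Qed.

Lemma sum_invsqrt_bound a c k : 0 <= c ->
  \sum_(r < k.+1) (if r : nat is 0%N then a else c / Num.sqrt r%:R) <=
  a + 2 * c * Num.sqrt k%:R :> R.
Proof.
move=> c0; elim: k => [|k IH].
  by rewrite big_ord_recr big_ord0/= add0r sqrtr0 mulr0 addr0.
rewrite big_ord_recr/=; apply: (le_trans (lerD IH (lexx _))).
have := ler_wpM2l c0 (sqrt_diff_bound k); lra.
Qed.

(** As [r + 1 <= 2 r] for [r >= 1], each weighted term is at most [2 c / sqrt r]. *)
Lemma sum_weighted_invsqrt_bound a c k : 0 <= c ->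
  \sum_(r < k.+1) r.+1%:R * (if r : nat is 0%N then a else c / (r%:R * Num.sqrt r%:R)) <=
  a + 4 * c * Num.sqrt k%:R :> R.
Proof.
move=> c0.
have c20 : 0 <= 2 * c by rewrite mulr_ge0.
have := sum_invsqrt_bound a k c20; rewrite (_ : 2 * (2 * c) = 4 * c); last by ring.
apply: le_trans; apply: ler_sum => -[[|r] rk] _ /=; first by rewrite mul1r.
set x : R := r.+1%:R; have x1 : 1 <= x by rewrite ler1n.
rewrite -[r.+2%:R]natr1 -/x; set y := Num.sqrt x.
have y0 : 0 < y by rewrite sqrtr_gt0; lra.
rewrite -subr_ge0 (_ : _ - _ = c * (x - 1) / (x * y)); last first.
  by field; apply/andP; split; rewrite gt_eqF//; lra.
by apply: divr_ge0; apply: mulr_ge0 => //; lra.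
Qed.

Lemma iter_err u k x : iter k twopt u x = G (k%:R * d ^+ 2) u x +
  k%:R * stepdiff (Gk k.-1 u) x + err u k x.
Proof. by rewrite /err /Gk; ring. Qed.

Lemma d2_gt0 : 0 < d ^+ 2.
Proof. by rewrite exprn_gt0. Qed.

Lemma Gk_smooth i j k u B : (0 < i)%N -> (0 < j)%N -> Ck k.+2 u ->
  (forall x, `|derive1n k.+2 u x| <= B) ->
  Ck (i + k.+2) (Gk j u) /\
  forall x, `|derive1n (i + k.+2) (Gk j u) x| <= B / Num.sqrt (j%:R * d ^+ 2 / i%:R) ^+ i.
Proof.
move=> i0 j0 Cu uB.
have s0 : 0 < j%:R * d ^+ 2 / i%:R by rewrite divr_gt0 ?mulr_gt0 ?d2_gt0 ?ltr0n.
have := G_iter i s0 Cu uB.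
by rewrite (_ : i%:R * (j%:R * d ^+ 2 / i%:R) = j%:R * d ^+ 2) // mulrC divfK// pnatr_eq0 -lt0n.
Qed.

Lemma clt_symmetric n u B x : (0 < n)%N -> n%:R * d ^+ 2 = 1 -> mom 3 = 0 -> mom 4 = 1 ->
  Ck 2 u -> (forall x, `|derive1n 2 u x| <= B) ->
  `|iter n twopt u x - G 1 u x| <= 39 * B * d ^+ 2.
Proof.
move=> n0 nd m3 m4 Cu uB; have B0 : 0 <= B by exact: le_trans (uB 0).
have dd := d2_gt0; have d2 := stepdiff_order2.
have d4 : stepdiff_order 4 (d ^+ 4 / 6).
  move=> v C Cv vC y; have := stepdiff_main y Cv vC.
  rewrite m3 m4 !mul0r subr0 => /le_trans; apply; rewrite le_eqVlt; apply/orP; left; apply/eqP.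
  by field.
case: n n0 nd => // -[|k] _ nd.
  have -> : G 1 u = G (d ^+ 2) u by rewrite [d ^+ 2](_ : _ = 1)// -[RHS]nd mul1r.
  apply: (le_trans (d2 _ _ Cu uB x)).
  by have := mulr_ge0 B0 (ltW dd); lra.
have nd' := nd; rewrite iter_err nd.
(* Two differences of order 4 use two derivatives of [u] and six of smoothing, in slices of variance
   [r * d^2 / 6]: [(d^4 / 6)^2 * 6^3 / (r * d^2)^3 = 6 * d^2 / r^3]. At [r = 0] there is no
   smoothing: the inner difference is bounded by order 2, the outer one by the factor 2. *)
pose b (r : nat) := d ^+ 2 * B * (if r is 0%N then 2 else 6 / r%:R ^+ 3).
have bP j y : `|stepdiff (stepdiff (Gk j u)) y| <= b j.
  case: j => [|j].
    rewrite /b /Gk mul0r G0 mulrC; apply: stepdiff_bound; last exact: d2.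
    by apply: pg_stepdiff; exact: Ck_pg Cu.
  have [C1 B1] := @Gk_smooth 6 j.+1 0 u B isT isT Cu uB.
  apply: (le_trans (stepdiff2_bound d4 C1 B1 y)).
  set s := (X in Num.sqrt X); have s0 : 0 < s by rewrite divr_gt0 ?mulr_gt0.
  rewrite (_ : Num.sqrt s ^+ 6 = s ^+ 3); last by rewrite (exprM _ 2 3) sqr_sqrtr// ltW.
  rewrite /b /s; set z : R := j.+1%:R; have z0 : 0 < z by rewrite ltr0n.
  by rewrite le_eqVlt; apply/orP; left; apply/eqP; field; rewrite !gt_eqF.
have E := err_bound Cu bP k.+1 x.
have Es : \sum_(r < k.+1) r.+1%:R * b r <= d ^+ 2 * B * 38.
  rewrite (_ : \sum_(r < _) _ = d ^+ 2 * B * \sum_(r < k.+1) r.+1%:R * (if r : nat is 0%N then 2 else 6 / r%:R ^+ 3)).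
    apply: ler_wpM2l; first by rewrite mulr_ge0// ltW.
    by apply: (le_trans (sum_cube_bound k)); rewrite gerBl divr_ge0.
  by rewrite mulr_sumr; apply: eq_bigr => r _; rewrite /b mulrCA.
(* The main term [n D G^(n-1)]: two of its four derivatives come from smoothing, and it contributes
   the 1 in [39 = 38 + 1]. *)
have [C1 B1] := @Gk_smooth 2 k.+1 0 u B isT isT Cu uB.
have := d4 _ _ C1 B1 x; set s := (X in Num.sqrt X).
have s0 : 0 < s by rewrite divr_gt0 ?mulr_gt0.
rewrite (sqr_sqrtr (ltW s0)) => M.
rewrite (addrC (G 1 u x)) addrAC addrK /=.
set z : R := k.+1%:R; have z1 : 1 <= z by rewrite ler1n.
have M' : `|k.+2%:R * stepdiff (Gk k.+1 u) x| <= d ^+ 2 * B.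
  rewrite normrM ger0_norm// -natr1 -/z; apply: (@le_trans _ _ ((z + 1) * (d ^+ 4 / 6 * (B / s)))).
    by apply: ler_wpM2l => //; lra.
  rewrite /s -/z (_ : _ * _ = d ^+ 2 * B * ((z + 1) / (3 * z))); last first.
    by field; rewrite !gt_eqF//; lra.
  by apply: ler_piMr; [exact: mulr_ge0 (ltW dd) B0|rewrite ler_pdivrMr; lra].
apply: (le_trans (ler_normD _ _)); apply: (le_trans (lerD M' (le_trans E Es))).
by lra.
Qed.

(** The subtracted term is the third-moment part of [n D G^(n-1)], where [n * d^3 = d]. Being of
    order [d] in general, it is set aside so that parity at 0 can be used later. *)
Lemma clt_general k u B2 B3 x : k.+2%:R * d ^+ 2 = 1 -> Ck 3 u ->
  (forall x, `|derive1n 2 u x| <= B2) -> (forall x, `|derive1n 3 u x| <= B3) ->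
  `|iter k.+2 twopt u x - G 1 u x - mom 3 * d / 6 * derive1n 3 (Gk k.+1 u) x| <=
  d ^+ 2 * ((mom 4 + 3) / 6 * B2 + (2 * beta + 24 * beta ^+ 2) * B3).
Proof.
move=> nd Cu uB2 uB3; have B20 : 0 <= B2 by exact: le_trans (uB2 0).
have B30 : 0 <= B3 by exact: le_trans (uB3 0).
have be0 := beta_ge0; have dd := d2_gt0; have d3 := stepdiff_order3.
have Cu2 : Ck 2 u by exact: CkW.
rewrite iter_err nd.
(* Two differences of order 3 give [beta^2 * d^6], and three smoothed derivatives divide by
   [(r * d^2 / 3)^(3/2)]; the factor [3^(3/2)] is rounded up to 6 through [sqrt 3 <= 2]. The term
   [a] is the one without smoothing. *)
pose c := 6 * beta ^+ 2 * d ^+ 3 * B3; pose a := 2 * (beta * d ^+ 3 * B3).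
have c0 : 0 <= c.
  apply: mulr_ge0 => //; apply: mulr_ge0; last exact: exprn_ge0 (ltW d0).
  by apply: mulr_ge0 => //; exact: sqr_ge0.
pose b (r : nat) := if r is 0%N then a else c / (r%:R * Num.sqrt r%:R).
have bP j y : `|stepdiff (stepdiff (Gk j u)) y| <= b j.
  case: j => [|j].
    rewrite /b /Gk mul0r G0; apply: stepdiff_bound; last exact: d3.
    by apply: pg_stepdiff; exact: Ck_pg Cu.
  have [C1 B1] := @Gk_smooth 3 j.+1 1 u B3 isT isT Cu uB3.
  apply: (le_trans (stepdiff2_bound d3 C1 B1 y)).
  set s := (X in Num.sqrt X); have s0 : 0 < s by rewrite divr_gt0 ?mulr_gt0.
  rewrite /b /c; set z : R := j.+1%:R; have z0 : 0 < z by rewrite ltr0n.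
  have r0 : 0 < Num.sqrt z by rewrite sqrtr_gt0.
  have rs : d * Num.sqrt z / 2 <= Num.sqrt s.
    rewrite -[leLHS]ger0_norm; last by rewrite divr_ge0// mulr_ge0 ?ltW.
    rewrite -sqrtr_sqr ler_wsqrtr// !exprMn (sqr_sqrtr (ltW z0)) /s -/z.
    by have := mulr_ge0 (ltW z0) (ltW dd); lra.
  have t0 : 0 < Num.sqrt s by rewrite sqrtr_gt0.
  rewrite (_ : Num.sqrt s ^+ 3 = s * Num.sqrt s); last by rewrite exprSr sqr_sqrtr// ltW.
  have I : (Num.sqrt s)^-1 <= 2 / (d * Num.sqrt z).
    by rewrite -[leRHS]invrK invf_div lef_pV2 ?posrE ?divr_gt0 ?mulr_gt0.
  rewrite (_ : beta * d ^+ 3 * _ = beta ^+ 2 * d ^+ 6 * B3 / s * (Num.sqrt s)^-1); last first.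
    by field; rewrite !gt_eqF.
  apply: (le_trans (ler_wpM2l _ I)).
    apply: divr_ge0; last exact: ltW.
    by apply: mulr_ge0 => //; apply: mulr_ge0; [exact: sqr_ge0|exact: exprn_ge0 (ltW d0)].
  rewrite /s -/z le_eqVlt; apply/orP; left; apply/eqP; field.
  by rewrite !gt_eqF.
have E := err_bound Cu2 bP k.+1 x.
(* The sum grows like [sqrt k], and [d * sqrt k <= 1] compensates this: [4 * c * sqrt k] is at most
   [24 * beta^2 * d^2 * B3]. *)
have := sum_weighted_invsqrt_bound a k c0 => /(le_trans E) {}E.
have dn : d * Num.sqrt k.+2%:R = 1.
  by rewrite -{1}[d]ger0_norm ?ltW// -sqrtr_sqr -sqrtrM ?sqr_ge0// mulrC nd sqrtr1.
have dk : d * Num.sqrt k%:R <= 1.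
  by rewrite -[leRHS]dn ler_wpM2l ?(ltW d0)// ler_wsqrtr// ler_nat; exact: (leq_addl 2 k).
have d1 : d <= 1.
  by rewrite -[leRHS]dn ler_peMr ?(ltW d0)// -[leLHS]sqrtr1 ler_wsqrtr// ler1n.
have [C1 B1] := @Gk_smooth 2 k.+1 0 u B2 isT isT Cu2 uB2.
have := stepdiff_main x C1 B1; set s := (X in Num.sqrt X).
have s0 : 0 < s by rewrite divr_gt0 ?mulr_gt0.
rewrite (sqr_sqrtr (ltW s0)) => M; set S := stepdiff _ x in M *; set T := derive1n 3 _ x in M *.
set e := err _ _ _ in E *.
rewrite (_ : _ - _ = k.+2%:R * (S - mom 3 * d ^+ 3 / 6 * T) + e); last first.
  have -> : mom 3 * d / 6 * T = (k.+2%:R * d ^+ 2) * (mom 3 * d / 6 * T) by rewrite nd mul1r.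
  by rewrite -/S; ring.
apply: (le_trans (ler_normD _ _)).
set z : R := k.+1%:R; have z1 : 1 <= z by rewrite ler1n.
have m40 : 0 <= mom 4 by rewrite -absmom4 absmom_ge0.
have M' : `|k.+2%:R * (S - mom 3 * d ^+ 3 / 6 * T)| <= d ^+ 2 * ((mom 4 + 3) / 6 * B2).
  rewrite normrM ger0_norm// -natr1 -/z.
  apply: (@le_trans _ _ ((z + 1) * ((mom 4 + 3) / 24 * d ^+ 4 * (B2 / s)))).
    by apply: ler_wpM2l => //; lra.
  rewrite /s -/z (_ : _ * _ = d ^+ 2 * ((mom 4 + 3) / 6 * B2) * ((z + 1) / (2 * z))); last first.
    by field; rewrite !gt_eqF//; lra.
  apply: ler_piMr; last by rewrite ler_pdivrMr; lra.
  by apply: mulr_ge0 (ltW dd) _; apply: mulr_ge0 => //; apply: divr_ge0 => //; lra.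
apply: (le_trans (lerD M' E)); rewrite [leRHS]mulrDr lerD2l /a /c.
have dB : 0 <= d ^+ 2 * B3 := mulr_ge0 (ltW dd) B30.
have P1 : beta * (d ^+ 2 * B3) * d <= beta * (d ^+ 2 * B3).
  by apply: ler_piMr d1; exact: mulr_ge0.
have P2 : beta ^+ 2 * (d ^+ 2 * B3) * (d * Num.sqrt k%:R) <= beta ^+ 2 * (d ^+ 2 * B3).
  by apply: ler_piMr dk; apply: mulr_ge0 dB; exact: sqr_ge0.
lra.
Qed.

(** Only the rate [d], but with second derivatives alone: each replacement of order 3 uses two
    derivatives of [u] and one of smoothing, and the terms [d^2 / sqrt r] add up to order [d]. Used
    with [B] proportional to [x^2], it shows that [walk_mix] is close to [gauss_mix]. *)
Lemma clt_one_level n u B x : (0 < n)%N -> n%:R * d ^+ 2 = 1 ->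
  Ck 2 u -> (forall x, `|derive1n 2 u x| <= B) ->
  `|iter n twopt u x - G 1 u x| <= d * (1 + 2 * beta) * B.
Proof.
move=> n0 nd Cu uB; have B0 : 0 <= B by exact: le_trans (uB 0).
have be0 := beta_ge0; have dd := d2_gt0.
case: n n0 nd => // k _ nd.
pose b (r : nat) := if r is 0%N then d ^+ 2 * B else beta * d ^+ 2 * B / Num.sqrt r%:R.
have bP j y : `|stepdiff (Gk j u) y| <= b j.
  case: j => [|j]; first by rewrite /b /Gk mul0r G0; exact: stepdiff_order2.
  have [C1 B1] := @Gk_smooth 1 j.+1 0 u B isT isT Cu uB.
  apply: (le_trans (stepdiff_order3 C1 B1 y)).
  have r0 : 0 < Num.sqrt j.+1%:R :> R by rewrite sqrtr_gt0.
  rewrite /b divr1 expr1 sqrtrM// sqrtr_sqr (ger0_norm (ltW d0)) le_eqVlt; apply/orP; left; apply/eqP.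
  by field; rewrite !gt_eqF.
have dn : d * Num.sqrt k.+1%:R = 1.
  by rewrite -{1}[d]ger0_norm ?ltW// -sqrtr_sqr -sqrtrM ?sqr_ge0// mulrC nd sqrtr1.
have dk : d * Num.sqrt k%:R <= 1.
  by rewrite -[leRHS]dn ler_wpM2l ?(ltW d0)// ler_wsqrtr// ler_nat leqnSn.
have d1 : d <= 1.
  by rewrite -[leRHS]dn ler_peMr ?(ltW d0)// -[leLHS]sqrtr1 ler_wsqrtr// ler1n.
have := onelevel_bound Cu bP k.+1 x; rewrite /Gk nd => /le_trans; apply.
have c0 : 0 <= beta * d ^+ 2 * B.
  by apply: mulr_ge0 => //; apply: mulr_ge0 => //; exact: ltW.
apply: (le_trans (sum_invsqrt_bound (d ^+ 2 * B) k c0)).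
have dB : 0 <= d * B := mulr_ge0 (ltW d0) B0.
have P1 : (beta * (d * B)) * (d * Num.sqrt k%:R) <= beta * (d * B).
  by apply: ler_piMr dk; exact: mulr_ge0.
have P2 : (d * B) * d <= d * B by exact: ler_piMr.
lra.
Qed.

End two_point.

(** * The third-moment term *)

Section skew_term.
Context {R : realType}.
Local Open Scope classical_set_scope.
Implicit Types (u v K H : R -> R) (x y z s a b e : R).

(** Bounds of the form [a + b x^2] are stable under [M], by [(x + sqrt s z)^2 <= 2 x^2 + 2 s z^2]
    and the absolute moments [E|z| <= 1], [E|z|^3 <= 2]. *)
Lemma M_weighted_bound s u a b : 0 < s -> pg u -> 0 <= a -> 0 <= b ->
  (forall x, `|u x| <= a + b * x ^+ 2) ->
  forall x, `|M s u x| <= (a + 4 * b * s) / Num.sqrt s + 2 * b / Num.sqrt s * x ^+ 2.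
Proof.
move=> s0 pu a0 b0 uB x.
have r0 : 0 < Num.sqrt s by rewrite sqrtr_gt0.
rewrite (_ : _ + _ = (Num.sqrt s)^-1 * ((a + 2 * b * x ^+ 2) * 1 + 2 * b * s * 2)); last by ring.
rewrite /M normrM (ger0_norm _) ?invr_ge0 ?sqrtr_ge0//; apply: ler_wpM2l.
  by rewrite invr_ge0 ltW.
have pn : pg (fun z : R => `|z|) by apply: pg_norm; exact: pg_id.
have c1 : 0 <= a + 2 * b * x ^+ 2 by rewrite addr_ge0// mulr_ge0 ?sqr_ge0// mulr_ge0.
have c2 : 0 <= 2 * b * s by rewrite !mulr_ge0// ltW.
apply: (@le_trans _ _ (gE (fun z => (a + 2 * b * x ^+ 2) * `|z| + 2 * b * s * `|z| ^+ 3))).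
  apply: gE_norm_le.
  - exact: (pg2_section x (pg2_zshift (Num.sqrt s) pu)).
  - by apply: pgD; apply: pgZ => //; exact: pg_normpow.
  - move=> z; rewrite normrM.
    apply: (@le_trans _ _ (`|z| * (a + b * (x + Num.sqrt s * z) ^+ 2))).
      by apply: ler_wpM2l => //; exact: uB.
    rewrite (_ : (a + _) * _ + _ = `|z| * (a + b * (2 * x ^+ 2 + 2 * s * `|z| ^+ 2))); last by ring.
    apply: ler_wpM2l => //; rewrite lerD2l; apply: ler_wpM2l => //.
    have sE : Num.sqrt s ^+ 2 = s by rewrite sqr_sqrtr// ltW.
    rewrite real_normK ?num_real// -{2}sE.
    have := sqr_ge0 (x - Num.sqrt s * z); lra.
rewrite (gE_lin _ _ pn (pg_normpow 3)).
by apply: lerD; apply: ler_wpM2l => //; [exact: gE_norm1|exact: gE_norm3].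
Qed.

Lemma Ck1_M s u : Ck 1 u -> Ck 1 (M s u).
Proof.
move=> Cu; have [pu [_ [pu' _]]] := Cu.
apply: CkP (fun x => M_is_derive s x Cu) _; first exact: pg_M.
by split => //; exact: pg_M.
Qed.

Lemma derive1_G s u : Ck 1 u -> (G s u)^`() = G s (derive1 u).
Proof. by move=> Cu; apply: is_derive_derive1 => x; exact: G_is_derive. Qed.

(* The variance [3 s] is split into three equal parts, each absorbing one derivative. *)
Lemma derive3_G s u : 0 < s -> Ck 2 u -> (G (3 * s) u)^`(3) = M s (M s (M s u)).
Proof.
move=> s0 Cu; have C1 : Ck 1 u := CkW Cu.
have s2 : 0 <= s + s by rewrite addr_ge0 ?ltW.
have -> : 3 * s = s + (s + s) by ring.
rewrite -(G_semigroup (ltW s0) s2 Cu) -(G_semigroup (ltW s0) (ltW s0) Cu).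
have CG := Ck_G s C1; have CGG := Ck_G s CG; have CM := Ck1_M s C1; have CMM := Ck1_M s CM.
change ((G s (G s (G s u)))^`()^`()^`() = M s (M s (M s u))).
rewrite (derive1_G s CGG) (derive1_G s CG) (derive1_G s C1) (G_M s0 C1).
rewrite (derive1_G s (Ck_G s CM)) (derive1_G s CM) (G_M s0 CM).
by rewrite (derive1_G s CMM) (G_M s0 CMM).
Qed.

(* Three copies of [M], rather than a bound on derivatives of [K], so that the smallness of
   [K] itself survives. *)
Lemma derive3_G_bound s K e : 0 < s -> Ck 2 K -> 0 <= e ->
  (forall x, `|K x| <= e * x ^+ 2) ->
  `|derive1n 3 (G (3 * s) K) 0| <= 28 * e / Num.sqrt s.
Proof.
move=> s0 CK e0 Ke; have C1 := CkW CK.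
have r0 : 0 < Num.sqrt s by rewrite sqrtr_gt0.
have rr : s = Num.sqrt s ^+ 2 by rewrite sqr_sqrtr// ltW.
have K0 x : `|K x| <= 0 + e * x ^+ 2 by rewrite add0r.
have B1 := M_weighted_bound s0 (Ck_pg C1) (lexx 0) e0 K0.
have a1 : 0 <= (0 + 4 * e * s) / Num.sqrt s by rewrite divr_ge0 ?addr_ge0 ?mulr_ge0// ltW.
have b1 : 0 <= 2 * e / Num.sqrt s by rewrite divr_ge0 ?mulr_ge0// ltW.
have B2 := M_weighted_bound s0 (pg_M s (Ck_pg C1)) a1 b1 B1.
have a2 : 0 <= ((0 + 4 * e * s) / Num.sqrt s + 4 * (2 * e / Num.sqrt s) * s) / Num.sqrt s.
  by rewrite divr_ge0 ?(ltW r0)// addr_ge0// mulr_ge0 ?(ltW s0)// mulr_ge0.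
have b2 : 0 <= 2 * (2 * e / Num.sqrt s) / Num.sqrt s.
  by rewrite divr_ge0 ?(ltW r0)// mulr_ge0.
have B3 := M_weighted_bound s0 (pg_M s (pg_M s (Ck_pg C1))) a2 b2 B2.
(* From the pair [(0, e)] the successive bounds have coefficients [(4 e sqrt s, 2 e / sqrt s)], then
   [(12 e, 4 e / s)], then the constant term [28 e / sqrt s], which alone remains at 0. *)
rewrite derive3_G//; apply: (le_trans (B3 0)).
rewrite expr0n/= mulr0 addr0; set r := Num.sqrt s in r0 rr *.
rewrite (_ : _ / r = 28 * e * s / (r ^+ 2 * r)); last by field; rewrite gt_eqF.
rewrite -rr le_eqVlt; apply/orP; left; apply/eqP.
by field; rewrite !gt_eqF.
Qed.

Lemma derive1_opp_arg u x : Ck 1 u -> is_derive x 1 (fun x => u (- x)) (- (derive1 u) (- x)).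
Proof.
move=> Cu; have d1 : is_derive x 1 (fun x => - x) (-1).
  by have := is_derive1_affine 0 (-1) x; under eq_fun do rewrite add0r mulN1r.
have := @is_derive1_fcomp R u (fun x => - x) _ _ x (Ck_is_derive Cu (- x)) d1.
by rewrite mulrN1.
Qed.

Lemma derive1_even u : Ck 1 u -> (forall x, u (- x) = u x) ->
  forall x, derive1 u (- x) = - derive1 u x.
Proof.
move=> Cu ev x; have E : (fun x => u (- x)) = u by apply/funext.
have := is_derive_derive1 (fun x => derive1_opp_arg x Cu); rewrite E => D.
by have := congr1 (fun f => f x) D; rewrite /= => ->; rewrite opprK.
Qed.

Lemma derive1_odd u : Ck 1 u -> (forall x, u (- x) = - u x) ->
  forall x, derive1 u (- x) = derive1 u x.
Proof.
move=> Cu od x.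
have E : (fun x => u (- x)) = (fun x => -1 * u x) by apply/funext => y; rewrite mulN1r.
have D1 := is_derive_derive1 (fun x => derive1_opp_arg x Cu).
have D2 := is_derive_derive1 (fun x => is_derive1Z (-1) (Ck_is_derive Cu x)).
rewrite E D2 in D1; have := congr1 (fun f => f x) D1; rewrite /= mulN1r.
by move/oppr_inj.
Qed.

(** [G] preserves evenness because the normal law is symmetric, and the third derivative of an even
    function is odd. *)
Lemma derive3_G_even s H : Ck 3 H -> (forall x, H (- x) = H x) -> derive1n 3 (G s H) 0 = 0.
Proof.
move=> CH evenH; have CG := Ck_G s CH.
have evenG x : G s H (- x) = G s H x.
  rewrite /G -(gE_sym (- x) (Num.sqrt s) (CkW CH)); congr gE; apply/funext => z.
  by rewrite -opprD evenH.
have odd1 := derive1_even (CkW (CkW CG)) evenG.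
have even2 := derive1_odd (CkW (CkS CG)) odd1.
have odd3 := derive1_even (CkS (CkS CG)) even2 0.
change (derive1 (derive1 (derive1 (G s H))) 0 = 0).
move/eqP: odd3; rewrite oppr0 -addr_eq0 -mulr2n mulrn_eq0/=.
by move/eqP.
Qed.

End skew_term.

(** * Products of two sums *)

Section derivative_sequences.
Context {R : realType}.
Local Open Scope classical_set_scope.
Implicit Types (u h : R -> R) (x y z : R).

(** Candidates for all the derivatives are supplied at once. The scaled functions, both mixtures,
    their difference and [h] itself are put into [Ck] this way. *)
Lemma Ck_seq (g : nat -> R -> R) k : (forall j, (j <= k)%N -> pg (g j)) ->
  (forall j x, (j < k)%N -> is_derive x 1 (g j) (g j.+1 x)) ->
  Ck k (g 0%N) /\ forall j, (j <= k)%N -> derive1n j (g 0%N) = g j.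
Proof.
move=> pgg dg; split.
  elim: k g pgg dg => [|k IH] g pgg dg; first by split => //; exact: pgg.
  apply: (@CkP _ k _ (g 1%N)); [exact: pgg|by move=> x; exact: dg|].
  by apply: (IH (fun j => g j.+1)) => [j jk|j x jk]; [exact: (pgg j.+1)|exact: (dg j.+1)].
elim=> // j IH jk; rewrite derive1nS IH; last exact: ltnW.
by apply: is_derive_derive1 => x; exact: dg.
Qed.

Lemma Ck_nth_pg k h j : Ck k h -> (j <= k)%N -> pg (derive1n j h).
Proof.
move=> Ch jk; apply: (Ck_pg (k := k - j)); apply: (@Ck_derive1n _ j).
by rewrite subnKC.
Qed.

Lemma Ck_nth_is_derive k h j : Ck k h -> (j < k)%N ->
  forall x : R, is_derive x 1 (derive1n j h) (derive1n j.+1 h x).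
Proof.
move=> Ch jk; apply: (@Ck_is_derive _ (k - j.+1)); apply: (@Ck_derive1n _ j).
by rewrite -subSn// subSS subnKC// ltnW.
Qed.

Lemma pg_scale u y : pg u -> pg (fun x => u (x * y)).
Proof.
move=> pu; apply: (pg_comp pu); apply: pgM; [exact: pg_id|exact: pg_cst].
Qed.

Lemma pg_scaled_derive k h y j : Ck k h -> (j <= k)%N ->
  pg (fun x => y ^+ j * derive1n j h (x * y)).
Proof. by move=> Ch jk; apply: pgZ; apply: pg_scale; exact: Ck_nth_pg Ch jk. Qed.

Lemma is_derive_scaled k h y j x : Ck k h -> (j < k)%N ->
  is_derive x 1 (fun x => y ^+ j * derive1n j h (x * y)) (y ^+ j.+1 * derive1n j.+1 h (x * y)).
Proof.
move=> Ch jk; rewrite exprSr -mulrA (mulrC y); apply: is_derive1Z.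
have d1 : is_derive x 1 (fun x => x * y) y.
  by have := is_derive1Mcst y (is_derive_id x 1); rewrite mul1r.
exact: (@is_derive1_fcomp R (derive1n j h) (fun x => x * y) _ _ x (Ck_nth_is_derive Ch jk (x * y)) d1).
Qed.

Lemma pg2_mul u : pg u -> pg2 (fun x z => u (x * z)).
Proof.
move=> pu; apply: (pg2_comp pu); apply: (pg2M (f := fun x _ => x) (g := fun _ z => z)).
  exact: (pg2_fst (pg_id (R := R))).
exact: (pg2_snd (pg_id (R := R))).
Qed.

(** The [j]-th derivative in [x] of [E h(x Z)]; [walk_mix] below is its analogue with a sum of
    letters in place of [Z]. *)
Definition gauss_mix h j x := gE (fun z => z ^+ j * derive1n j h (x * z)).

Lemma pg2_scaled_derive k h j : Ck k h -> (j <= k)%N ->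
  pg2 (fun x z => z ^+ j * derive1n j h (x * z)).
Proof.
move=> Ch jk; apply: (pg2M (f := fun _ z => z ^+ j)); first exact: (pg2_snd (pg_pow j)).
by apply: pg2_mul; exact: Ck_nth_pg Ch jk.
Qed.

Lemma pg_gauss_mix k h j : Ck k h -> (j <= k)%N -> pg (gauss_mix h j).
Proof. by move=> Ch jk; apply: gE_pg; exact: pg2_scaled_derive Ch jk. Qed.

Lemma is_derive_gauss_mix k h j x : Ck k h -> (j < k)%N ->
  is_derive x 1 (gauss_mix h j) (gauss_mix h j.+1 x).
Proof.
move=> Ch jk; apply: (gE_derive (f := fun x z => z ^+ j * derive1n j h (x * z))
  (g := fun x z => z ^+ j.+1 * derive1n j.+1 h (x * z))).
- exact: pg2_scaled_derive Ch (ltnW jk).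
- exact: pg2_scaled_derive Ch jk.
- by move=> y z; exact: is_derive_scaled Ch jk.
Qed.

Lemma gauss_mix0 h x : gauss_mix h 0 x = gE (fun z => h (x * z)).
Proof. by congr gE; apply/funext => z; rewrite expr0 mul1r. Qed.

Lemma gauss_mix_bound k h j B C x : Ck k h -> (j <= k)%N ->
  (forall x, `|derive1n j h x| <= B) -> gE (fun z => `|z| ^+ j) <= C ->
  `|gauss_mix h j x| <= C * B.
Proof.
move=> Ch jk hB jC; have B0 : 0 <= B by exact: le_trans (hB 0).
apply: (@le_trans _ _ (gE (fun z => B * `|z| ^+ j))).
  apply: gE_norm_le.
  - exact: (pg2_section x (pg2_scaled_derive Ch jk)).
  - by apply: pgZ; exact: pg_normpow.
  - by move=> z; rewrite normrM normrX mulrC; apply: ler_wpM2r; rewrite ?exprn_ge0.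
rewrite gEZ; last exact: pg_normpow.
by rewrite mulrC; apply: ler_wpM2r.
Qed.

Lemma gauss_mix_even h x : Ck 2 h -> gauss_mix h 0 (- x) = gauss_mix h 0 x.
Proof.
move=> Ch; rewrite !gauss_mix0; have := gE_sym 0 x Ch.
under eq_fun do rewrite sub0r -mulNr.
by under [X in _ = gE X -> _]eq_fun do rewrite add0r.
Qed.

End derivative_sequences.

(** * From one sum to the product of two *)

Section product_clt.
Context {R : realType} (p q al be : R).
Hypotheses (p0 : 0 <= p) (q0 : 0 <= q) (pq1 : p + q = 1).
Hypotheses (mean0 : p * al + q * be = 0) (var1 : p * al ^+ 2 + q * be ^+ 2 = 1).
Local Open Scope classical_set_scope.
Implicit Types (u f g h : R -> R) (F : R -> R -> R) (x y z d B : R) (k j n m : nat).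

Let T d := twopt p q al be d.
Let m3 := mom p q al be 3.
Let m4 := mom p q al be 4.
Let b := beta p q al be.

Lemma iter_twopt_norm d n f g x : (forall y, `|f y| <= g y) ->
  `|iter n (T d) f x| <= iter n (T d) g x.
Proof.
move=> fg; elim: n x => [|n IH] x //=; apply: (le_trans (ler_normD _ _)).
by rewrite !normrM (ger0_norm p0) (ger0_norm q0); apply: lerD; apply: ler_wpM2l.
Qed.

Lemma iter_twopt_le d n f g x : (forall y, f y <= g y) ->
  iter n (T d) f x <= iter n (T d) g x.
Proof.
move=> fg; elim: n x => [|n IH] x //=.
by apply: lerD; apply: ler_wpM2l.
Qed.

Lemma iter_twopt_lin d n (s t : R) f g x :
  iter n (T d) (fun y => s * f y + t * g y) x = s * iter n (T d) f x + t * iter n (T d) g x.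
Proof.
elim: n x => [|n IH] x //=; rewrite [LHS]/T /twopt !IH /T /twopt; ring.
Qed.

Lemma iter_twopt_cst d n c x : iter n (T d) (fun=> c) x = c.
Proof. by elim: n x => [|n IH] x //=; rewrite /T /twopt !IH -mulrDl pq1 mul1r. Qed.

Lemma iter_twopt_id d n x : iter n (T d) id x = x.
Proof.
elim: n x => [|n IH] x //=; rewrite /T /twopt !IH.
rewrite (_ : _ + _ = (p + q) * x + d * (p * al + q * be)); last by ring.
by rewrite pq1 mean0 mul1r mulr0 addr0.
Qed.

Lemma iter_twopt_sqr d n x : iter n (T d) (fun y => y ^+ 2) x = x ^+ 2 + n%:R * d ^+ 2.
Proof.
elim: n x => [|n IH] x /=; first by rewrite mul0r addr0.
rewrite /T /twopt !IH.
rewrite (_ : _ + _ = (p + q) * (x ^+ 2 + n%:R * d ^+ 2) + 2 * x * d * (p * al + q * be) +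
  d ^+ 2 * (p * al ^+ 2 + q * be ^+ 2)); last by ring.
by rewrite pq1 mean0 var1 -[n.+1%:R]natr1; ring.
Qed.

(** The fourth moment of a walk started at [x]: the induction moves the starting point, so the lower
    powers of [x] belong to the formula. *)
Lemma iter_twopt_pow4 d n x : iter n (T d) (fun y => y ^+ 4) x =
  x ^+ 4 + 6 * n%:R * d ^+ 2 * x ^+ 2 + 4 * n%:R * d ^+ 3 * m3 * x +
  n%:R * d ^+ 4 * m4 + 3 * n%:R * (n%:R - 1) * d ^+ 4.
Proof.
elim: n x => [|n IH] x /=; first by ring.
rewrite /T /twopt !IH -[n.+1%:R]natr1; set N : R := n%:R.
(* Regrouped so that the mass, the mean and the variance of the letter appear as factors, ready for
   the hypotheses. *)
rewrite (_ : _ + _ = (p + q) * (x ^+ 4 + 6 * N * d ^+ 2 * x ^+ 2 + 4 * N * d ^+ 3 * m3 * x +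
    N * d ^+ 4 * m4 + 3 * N * (N - 1) * d ^+ 4) +
  (4 * x ^+ 3 * d + 12 * N * d ^+ 3 * x + 4 * N * d ^+ 4 * m3) * (p * al + q * be) +
  (6 * x ^+ 2 * d ^+ 2 + 6 * N * d ^+ 4) * (p * al ^+ 2 + q * be ^+ 2) +
  4 * x * d ^+ 3 * m3 + d ^+ 4 * m4); last by rewrite /m3 /m4 /mom; ring.
by rewrite pq1 mean0 var1; ring.
Qed.

Lemma m4_ge0 : 0 <= m4.
Proof. by rewrite /m4 -absmom4 absmom_ge0. Qed.

Lemma iter_twopt_norm3 d n : 0 < d -> (0 < n)%N -> n%:R * d ^+ 2 = 1 ->
  iter n (T d) (fun y => `|y| ^+ 3) 0 <= (4 + m4) / 2.
Proof.
move=> d0 n0 nd.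
apply: (@le_trans _ _ (iter n (T d) (fun y => 2^-1 * y ^+ 2 + 2^-1 * y ^+ 4) 0)).
  apply: iter_twopt_le => y.
  rewrite (_ : y ^+ 4 = `|y| ^+ 4); last by rewrite -normrX ger0_norm// exprn_even_ge0.
  by rewrite -(real_normK (num_real y)); have := sqr_ge0 (`|y| * (`|y| - 1)); lra.
rewrite iter_twopt_lin iter_twopt_sqr iter_twopt_pow4 !expr0n/= !mulr0 !add0r nd.
have E1 : n%:R * d ^+ 4 = d ^+ 2.
  by rewrite (_ : n%:R * d ^+ 4 = n%:R * d ^+ 2 * d ^+ 2); [rewrite nd mul1r|ring].
have E2 : 3 * n%:R * (n%:R - 1) * d ^+ 4 = 3 * (1 - d ^+ 2).
  rewrite (_ : _ * d ^+ 4 = 3 * (n%:R * d ^+ 2 * (n%:R * d ^+ 2) - n%:R * d ^+ 4)); last by ring.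
  by rewrite nd E1 mul1r.
rewrite E1 E2.
have d1 : d ^+ 2 <= 1 by rewrite -nd ler_peMl ?sqr_ge0// ler1n.
have := m4_ge0; have := sqr_ge0 d; nra.
Qed.

Definition walk_mix d n h j x := iter n (T d) (fun y => y ^+ j * derive1n j h (x * y)) 0.

Lemma pg_iter_twopt d n F y : (forall y, pg (F^~ y)) -> pg (fun x => iter n (T d) (F x) y).
Proof.
move=> pF; elim: n y => [|n IH] y /=; first exact: pF.
by apply: pgD; apply: pgZ; exact: IH.
Qed.

Lemma is_derive_iter_twopt d n F (F' : R -> R -> R) y x :
  (forall y, is_derive x 1 (F^~ y) (F' x y)) ->
  is_derive x 1 (fun x => iter n (T d) (F x) y) (iter n (T d) (F' x) y).
Proof.
move=> dF; elim: n y => [|n IH] y /=; first exact: dF.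
by apply: is_derive1D; apply: is_derive1Z; exact: IH.
Qed.

Lemma pg_walk_mix k h d n j : Ck k h -> (j <= k)%N -> pg (walk_mix d n h j).
Proof.
move=> Ch jk; apply: (@pg_iter_twopt d n (fun x y => y ^+ j * derive1n j h (x * y))) => y.
exact: pg_scaled_derive Ch jk.
Qed.

Lemma is_derive_walk_mix k h d n j x : Ck k h -> (j < k)%N ->
  is_derive x 1 (walk_mix d n h j) (walk_mix d n h j.+1 x).
Proof.
move=> Ch jk.
apply: (@is_derive_iter_twopt d n (fun x y => y ^+ j * derive1n j h (x * y))
  (fun x y => y ^+ j.+1 * derive1n j.+1 h (x * y))) => y.
exact: is_derive_scaled Ch jk.
Qed.

Lemma walk_mix0 d n h x : walk_mix d n h 0 x = iter n (T d) (fun y => h (x * y)) 0.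
Proof. by rewrite /walk_mix; under eq_fun do rewrite expr0 mul1r. Qed.

Lemma walk_mix_bound k h d n j B C x : Ck k h -> (j <= k)%N ->
  (forall x, `|derive1n j h x| <= B) -> iter n (T d) (fun y => `|y| ^+ j) 0 <= C ->
  `|walk_mix d n h j x| <= C * B.
Proof.
move=> Ch jk hB jC; have B0 : 0 <= B by exact: le_trans (hB 0).
apply: (@le_trans _ _ (iter n (T d) (fun y => B * `|y| ^+ j + 0 * 0) 0)).
  apply: iter_twopt_norm => y; rewrite mul0r addr0 normrM normrX mulrC.
  by apply: ler_wpM2r; rewrite ?exprn_ge0.
by rewrite iter_twopt_lin mul0r addr0 mulrC; apply: ler_wpM2r.
Qed.

Lemma gE_iter_twopt d n F y : (forall y, pg (F^~ y)) ->
  gE (fun z => iter n (T d) (F z) y) = iter n (T d) (fun y => gE (F^~ y)) y.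
Proof.
move=> pF; elim: n y => [|n IH] y //=.
rewrite [RHS]/T /twopt -!IH -gE_lin//; exact: pg_iter_twopt.
Qed.

Lemma G1_0 u : G 1 u 0 = gE u.
Proof. by rewrite /G sqrtr1; congr gE; apply/funext => z; rewrite add0r mul1r. Qed.

Definition gauss_product h := gE (fun x => gE (fun z => h (x * z))).

Lemma G1_walk_mix h d n : pg h -> G 1 (walk_mix d n h 0) 0 = iter n (T d) (gauss_mix h 0) 0.
Proof.
move=> ph; rewrite G1_0 (_ : walk_mix d n h 0 = fun x => iter n (T d) (fun y => h (x * y)) 0); last first.
  by apply/funext => x; rewrite walk_mix0.
rewrite (@gE_iter_twopt d n (fun x y => h (x * y))); last by move=> y; exact: pg_scale.
congr (iter n (T d) _ 0); apply/funext => y; rewrite gauss_mix0; congr gE.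
by apply/funext => z; rewrite mulrC.
Qed.

Lemma G1_gauss_mix h : G 1 (gauss_mix h 0) 0 = gauss_product h.
Proof. by rewrite G1_0; congr gE; apply/funext => x; rewrite gauss_mix0. Qed.

(** The pivot has a Gaussian first factor and a walk as second one. Since finite averages commute
    with Gaussian expectations ([G1_walk_mix]), it is both the Gaussian end of the first comparison
    and the walk end of the second. *)
Lemma hybrid_bound h m n (dm dn : R) e1 e2 : pg h ->
  `|iter m (T dm) (walk_mix dn n h 0) 0 - G 1 (walk_mix dn n h 0) 0| <= e1 ->
  `|iter n (T dn) (gauss_mix h 0) 0 - G 1 (gauss_mix h 0) 0| <= e2 ->
  `|iter m (T dm) (fun x => iter n (T dn) (fun y => h (x * y)) 0) 0 - gauss_product h| <= e1 + e2.
Proof.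
move=> ph; rewrite G1_walk_mix// G1_gauss_mix => E1 E2.
rewrite (_ : (fun x => iter n (T dn) (fun y => h (x * y)) 0) = walk_mix dn n h 0); last first.
  by apply/funext => x; rewrite walk_mix0.
set a := iter m _ _ _ in E1 *; set c := iter n _ _ _ in E1 E2.
rewrite (_ : a - _ = (a - c) + (c - gauss_product h)); last by ring.
by apply: (le_trans (ler_normD _ _)); exact: lerD.
Qed.

Lemma gE_norm_sqr : gE (fun z : R => `|z| ^+ 2) = 1.
Proof. by rewrite -gE_pow2; congr gE; apply/funext => z; rewrite real_normK ?num_real. Qed.

Lemma iter_twopt_norm_sqr d n : n%:R * d ^+ 2 = 1 -> iter n (T d) (fun y => `|y| ^+ 2) 0 = 1.
Proof.
move=> nd; rewrite -[RHS]nd -[RHS]add0r -[X in X + _](expr0n _ 2) -iter_twopt_sqr.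
by congr (iter n (T d) _ 0); apply/funext => z; rewrite real_normK ?num_real.
Qed.

Lemma walk_mix_Ck k h d n : Ck k h -> Ck k (walk_mix d n h 0) /\
  forall j, (j <= k)%N -> derive1n j (walk_mix d n h 0) = walk_mix d n h j.
Proof.
move=> Ch; apply: Ck_seq; first by move=> j jk; exact: pg_walk_mix Ch jk.
by move=> j x jk; exact: is_derive_walk_mix Ch jk.
Qed.

Lemma gauss_mix_Ck k h : Ck k h -> Ck k (gauss_mix h 0) /\
  forall j, (j <= k)%N -> derive1n j (gauss_mix h 0) = gauss_mix h j.
Proof.
move=> Ch; apply: Ck_seq; first by move=> j jk; exact: pg_gauss_mix Ch jk.
by move=> j x jk; exact: is_derive_gauss_mix Ch jk.
Qed.

Lemma product_clt_symmetric h m n (dm dn : R) B : 0 < dm -> 0 < dn -> (0 < m)%N -> (0 < n)%N ->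
  m%:R * dm ^+ 2 = 1 -> n%:R * dn ^+ 2 = 1 -> m3 = 0 -> m4 = 1 ->
  Ck 2 h -> (forall x, `|derive1n 2 h x| <= B) ->
  `|iter m (T dm) (fun x => iter n (T dn) (fun y => h (x * y)) 0) 0 - gauss_product h| <=
  39 * (dm ^+ 2 + dn ^+ 2) * B.
Proof.
move=> dm0 dn0 m0 n0 md nd m30 m41 Ch hB.
have [CW EW] := walk_mix_Ck dn n Ch; have [CZ EZ] := gauss_mix_Ck Ch.
have bW x : `|derive1n 2 (walk_mix dn n h 0) x| <= B.
  rewrite (EW 2%N isT) -[B]mul1r; apply: (walk_mix_bound x Ch (leqnn 2) hB).
  by rewrite iter_twopt_norm_sqr.
have bZ x : `|derive1n 2 (gauss_mix h 0) x| <= B.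
  rewrite (EZ 2%N isT) -[B]mul1r; apply: (gauss_mix_bound x Ch (leqnn 2) hB).
  by rewrite gE_norm_sqr.
rewrite (_ : 39 * _ * B = 39 * B * dm ^+ 2 + 39 * B * dn ^+ 2); last by ring.
apply: (hybrid_bound (Ck_pg Ch)).
- exact: (clt_symmetric p0 q0 pq1 dm0 mean0 var1 0 m0 md m30 m41 CW bW).
- exact: (clt_symmetric p0 q0 pq1 dn0 mean0 var1 0 n0 nd m30 m41 CZ bZ).
Qed.

(** For a single letter, outside the range of [clt_general], one step of order 2 costs [d^2 * B2];
    this is the 1 in front of [(m4 + 3) / 6]. The size of [S] depends on which factor is being
    replaced. *)
Lemma clt_side u n d B2 B3 S : 0 < d -> (0 < n)%N -> n%:R * d ^+ 2 = 1 -> Ck 3 u ->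
  (forall x, `|derive1n 2 u x| <= B2) -> (forall x, `|derive1n 3 u x| <= B3) -> 0 <= S ->
  (forall k, n = k.+2 -> `|derive1n 3 (Gk d k.+1 u) 0| <= S) ->
  `|iter n (T d) u 0 - G 1 u 0| <=
  d ^+ 2 * ((1 + (m4 + 3) / 6) * B2 + (2 * b + 24 * b ^+ 2) * B3) + `|m3| * d / 6 * S.
Proof.
move=> d0 n0 nd Cu uB2 uB3 S0 uS.
have B20 : 0 <= B2 by exact: le_trans (uB2 0).
have B30 : 0 <= B3 by exact: le_trans (uB3 0).
have b0 : 0 <= b by exact: beta_ge0.
have dd := sqr_ge0 d; have m40 := m4_ge0.
have S1 : 0 <= `|m3| * d / 6 * S by rewrite mulr_ge0// divr_ge0// mulr_ge0// ltW.
have P1 : 0 <= d ^+ 2 * ((m4 + 3) / 6 * B2).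
  by rewrite mulr_ge0// mulr_ge0// divr_ge0// addr_ge0.
have P2 : 0 <= d ^+ 2 * ((2 * b + 24 * b ^+ 2) * B3).
  apply: mulr_ge0 => //; apply: mulr_ge0 => //; apply: addr_ge0; first exact: mulr_ge0.
  by apply: mulr_ge0 => //; exact: sqr_ge0.
have P3 : 0 <= d ^+ 2 * B2 by exact: mulr_ge0.
case: n n0 nd uS => // -[|k] _ nd uS.
  have -> : G 1 u = G (d ^+ 2) u by rewrite [d ^+ 2](_ : _ = 1)// -[RHS]nd mul1r.
  apply: (le_trans (stepdiff_order2 p0 q0 pq1 d0 mean0 var1 (CkW Cu) uB2 0)).
  by lra.
have := clt_general p0 q0 pq1 d0 mean0 var1 0 nd Cu uB2 uB3.
have := uS k erefl; rewrite -/(T d) -/m3 -/m4 -/b.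
set I := iter k.+2 _ _ _; set G1 := G 1 u 0; set D3 := derive1n 3 _ 0 => sk mn.
have E : `|m3 * d / 6 * D3| <= `|m3| * d / 6 * S.
  rewrite !normrM (ger0_norm (ltW d0)) (@ger0_norm _ 6^-1)//.
  by apply: ler_wpM2l => //; rewrite divr_ge0// mulr_ge0// ltW.
rewrite (_ : I - G1 = (I - G1 - m3 * d / 6 * D3) + m3 * d / 6 * D3); last by ring.
apply: (le_trans (ler_normD _ _)); apply: (le_trans (lerD mn E)); lra.
Qed.

Lemma product_clt_general h m n (dm dn : R) B2 B3 : 0 < dm -> 0 < dn -> (0 < m)%N -> (0 < n)%N ->
  m%:R * dm ^+ 2 = 1 -> n%:R * dn ^+ 2 = 1 ->
  Ck 3 h -> (forall x, `|derive1n 2 h x| <= B2) -> (forall x, `|derive1n 3 h x| <= B3) ->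
  `|iter m (T dm) (fun x => iter n (T dn) (fun y => h (x * y)) 0) 0 - gauss_product h| <=
  (dm ^+ 2 + dn ^+ 2) * ((1 + (m4 + 3) / 6 + 7 * `|m3| * (1 + 2 * b)) * B2 +
     (2 * b + 24 * b ^+ 2) * ((4 + m4) / 2) * B3).
Proof.
move=> dm0 dn0 m0 n0 md nd Ch hB2 hB3.
have B20 : 0 <= B2 by exact: le_trans (hB2 0).
have B30 : 0 <= B3 by exact: le_trans (hB3 0).
have b0 : 0 <= b by exact: beta_ge0.
have m40 := m4_ge0.
have [CW EW] := walk_mix_Ck dn n Ch; have [CZ EZ] := gauss_mix_Ck Ch.
pose e := dn * (1 + 2 * b) * B2.
have e0 : 0 <= e.
  by apply: mulr_ge0 => //; apply: mulr_ge0; [exact: ltW|apply: addr_ge0 => //; exact: mulr_ge0].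
pose K j x := walk_mix dn n h j x - gauss_mix h j x.
have [CK EK] : Ck 3 (K 0%N) /\ forall j, (j <= 3)%N -> derive1n j (K 0%N) = K j.
  apply: Ck_seq.
    by move=> j jk; apply: pgB; [exact: pg_walk_mix Ch jk|exact: pg_gauss_mix Ch jk].
  move=> j x jk; have := is_derive1D (is_derive_walk_mix dn n x Ch jk)
    (is_derive1Z (-1) (is_derive_gauss_mix x Ch jk)).
  by under eq_fun do rewrite mulN1r; rewrite mulN1r.
(* For fixed [x] the second derivative of [y => h (x * y)] carries the factor [x^2], so the rate
   [dn] comes with the weight [x^2]. *)
have Kb x : `|K 0%N x| <= e * x ^+ 2.
  have Cx : Ck 2 (fun y => h (x * y)) /\ forall j, (j <= 2)%N ->
      derive1n j (fun y => h (x * y)) = (fun y => x ^+ j * derive1n j h (y * x)).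
    have -> : (fun y => h (x * y)) = (fun y => x ^+ 0 * derive1n 0 h (y * x)).
      by apply/funext => y; rewrite expr0 mul1r mulrC.
    apply: (Ck_seq (g := fun j y => x ^+ j * derive1n j h (y * x))).
      by move=> j jk; apply: pg_scaled_derive (CkW Ch) jk.
    by move=> j y jk; apply: is_derive_scaled (CkW Ch) jk.
  have [Cx2 Ex] := Cx.
  have xB y : `|derive1n 2 (fun y => h (x * y)) y| <= x ^+ 2 * B2.
    by rewrite Ex// normrM ger0_norm ?sqr_ge0//; apply: ler_wpM2l; rewrite ?sqr_ge0.
  have := clt_one_level p0 q0 pq1 dn0 mean0 var1 0 n0 nd Cx2 xB.
  rewrite G1_0 -gauss_mix0 -[iter _ _ _ _]walk_mix0 => /le_trans; apply.
  by rewrite /e le_eqVlt; apply/orP; left; apply/eqP; rewrite -/b; ring.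
(* [gauss_mix h 0] is even, so that only the difference [K 0] contributes to the third
   derivative at 0, and [K 0] is small by [Kb]. *)
have skew k : m = k.+2 -> `|derive1n 3 (Gk dm k.+1 (walk_mix dn n h 0)) 0| <= 84 * e.
  move=> mk; rewrite /Gk; set s3 := k.+1%:R * dm ^+ 2; pose s := s3 / 3.
  have dm2 : 0 < dm ^+ 2 by rewrite exprn_gt0.
  (* At least half of the variance remains: [s3 = (k + 1) / (k + 2) >= 1 / 2]. The perfect square
     [1 / 9] lies below [s3 / 3] and turns 28 into [84 = 28 * 3]. *)
  have s6 : 1 / 9 <= s.
    rewrite /s /s3; move: md; rewrite mk -[k.+2%:R]natr1.
    have : 1 <= k.+1%:R :> R by rewrite ler1n.
    by move=> k1 md; nra.
  have s0 : 0 < s by lra.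
  have rs : 1 / 3 <= Num.sqrt s.
    rewrite -[leLHS]ger0_norm// -sqrtr_sqr ler_wsqrtr//; lra.
  have E3 : s3 = 3 * s by rewrite /s; field.
  have W3 : derive1n 3 (G s3 (walk_mix dn n h 0)) 0 =
      derive1n 3 (G s3 (K 0%N)) 0 + derive1n 3 (G s3 (gauss_mix h 0)) 0.
    rewrite !derive1n_G// EK// EW// EZ// /G -gED.
    - by congr gE; apply/funext => z; rewrite /K subrK.
    - by apply: pg_affine; rewrite -EK//; exact: Ck_nth_pg CK _.
    - by apply: pg_affine; exact: pg_gauss_mix Ch _.
  have ev x : gauss_mix h 0 (- x) = gauss_mix h 0 x by exact: (gauss_mix_even x (CkW Ch)).
  rewrite W3 (derive3_G_even s3 CZ ev).
  rewrite addr0 E3; apply: (le_trans (derive3_G_bound s0 (CkW CK) e0 Kb)).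
  have r0 : 0 < Num.sqrt s by rewrite sqrtr_gt0.
  rewrite (ler_pdivrMr _ _ r0) -mulrA.
  by have := ler_wpM2l e0 rs; clear; lra.
have bW2 x : `|derive1n 2 (walk_mix dn n h 0) x| <= B2.
  rewrite (EW 2%N isT) -[B2]mul1r; apply: (walk_mix_bound x Ch (isT : (2 <= 3)%N) hB2).
  by rewrite iter_twopt_norm_sqr.
have bW3 x : `|derive1n 3 (walk_mix dn n h 0) x| <= (4 + m4) / 2 * B3.
  rewrite (EW 3%N isT); apply: (walk_mix_bound x Ch (leqnn 3) hB3).
  exact: iter_twopt_norm3.
have bZ2 x : `|derive1n 2 (gauss_mix h 0) x| <= B2.
  rewrite (EZ 2%N isT) -[B2]mul1r; apply: (gauss_mix_bound x Ch (isT : (2 <= 3)%N) hB2).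
  by rewrite gE_norm_sqr.
have bZ3 x : `|derive1n 3 (gauss_mix h 0) x| <= (4 + m4) / 2 * B3.
  rewrite (EZ 3%N isT); apply: (gauss_mix_bound x Ch (leqnn 3) hB3).
  by apply: (le_trans gE_norm3); lra.
have s1 := clt_side dm0 m0 md CW bW2 bW3 (mulr_ge0 (ler0n R 84) e0) skew.
have skew0 k : n = k.+2 -> `|derive1n 3 (Gk dn k.+1 (gauss_mix h 0)) 0| <= 0.
  move=> _; rewrite /Gk (derive3_G_even _ CZ) ?normr0// => x.
  exact: (gauss_mix_even x (CkW Ch)).
have s2 := clt_side dn0 n0 nd CZ bZ2 bZ3 (lexx 0) skew0.
apply: (le_trans (hybrid_bound (Ck_pg Ch) s1 s2)).
have c0 : 0 <= `|m3| * (1 + 2 * b) * B2 by rewrite mulr_ge0// mulr_ge0// addr_ge0// mulr_ge0.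
(* The skew term is [|m3| * dm / 6 * 84 * e], that is [14 |m3| dm dn (1 + 2 b) B2];
   [2 dm dn <= dm^2 + dn^2] leaves the constant 7. *)
have X : (`|m3| * (1 + 2 * b) * B2) * (2 * (dm * dn)) <=
    (`|m3| * (1 + 2 * b) * B2) * (dm ^+ 2 + dn ^+ 2).
  by apply: ler_wpM2l => //; have := sqr_ge0 (dm - dn); lra.
by rewrite /e; lra.
Qed.

End product_clt.

(** * The variance-gamma law *)

Section variance_gamma.
Context {R : realType}.
Local Open Scope classical_set_scope.
Local Notation mu := (@lebesgue_measure R).
Implicit Types (f k : R -> R) (x t v : R).

(* The change of variables lemmas of the library require a derivative with a limit at [+oo],
   which [expR] does not have: substitute on [[-n, n]] and let [n] go to infinity. *)
Lemma ge0_integral_expR_subst k : continuous k -> (forall x, 0 <= k x) ->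
  (\int[mu]_(x in `]0%R, +oo[) (k x)%:E = \int[mu]_t (k (expR t) * expR t)%:E)%E.
Proof.
move=> ck k0.
have mk : measurable_fun setT (fun x => (k x)%:E).
  by apply/measurable_EFinP; exact: continuous_measurable_fun.
have cke : continuous (fun t => k (expR t) * expR t).
  move=> t; apply: cvgM; last exact: continuous_expR.
  by apply: continuous_comp; [exact: continuous_expR|exact: ck].
have mke : measurable_fun setT (fun t => (k (expR t) * expR t)%:E).
  by apply/measurable_EFinP; exact: continuous_measurable_fun.
pose A (n : nat) := `[expR (- n%:R), expR n%:R]%classic : set R.
pose B (n : nat) := `[- n%:R, n%:R]%classic : set R.
have AU : \bigcup_n A n = `]0%R, +oo[%classic.
  apply/seteqP; split => [x [n _]|x].
    rewrite /A /= !in_itv/= andbT => /andP[+ _]; apply: lt_le_trans; exact: expR_gt0.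
  rewrite /= in_itv/= andbT => x0; have xn := archi_boundP (normr_ge0 (ln x)).
  move: xn; set n := Num.bound _ => xn; exists n => //; clearbody n; rewrite /A /= in_itv/=; move: xn; rewrite ltr_norml => /andP[l1 l2].
  have lx : expR (ln x) = x by rewrite lnK// posrE.
  by rewrite -lx !ler_expR (ltW l1) (ltW l2).
have BU : \bigcup_n B n = setT.
  apply/seteqP; split => // x _; have xn := archi_boundP (normr_ge0 x).
  by exists (Num.bound `|x|) => //; rewrite /B /= in_itv/= -ler_norml ltW.
have ndA : nondecreasing_seq A.
  move=> i j ij; apply/subsetPset => x; rewrite /A /= !in_itv/= => /andP[l1 l2].
  by rewrite (le_trans _ l1) ?ler_expR ?lerN2 ?ler_nat// (le_trans l2)// ler_expR ler_nat.
have ndB : nondecreasing_seq B.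
  move=> i j ij; apply/subsetPset => x; rewrite /B /= !in_itv/= => /andP[l1 l2].
  by rewrite (le_trans _ l1) ?lerN2 ?ler_nat// (le_trans l2)// ler_nat.
have LA := @ge0_nondecreasing_set_cvg_integral _ (measurableTypeR R) R A _ mu ndA (fun i => measurable_itv _)
  (fun i => measurable_funTS mk) (fun i x _ => k0 x : (0 <= (k x)%:E)%E).
have LB := @ge0_nondecreasing_set_cvg_integral _ (measurableTypeR R) R B _ mu ndB (fun i => measurable_itv _)
  (fun i => measurable_funTS mke)
  (fun i x _ => mulr_ge0 (k0 (expR x)) (expR_ge0 x) : (0 <= (k (expR x) * expR x)%:E)%E).
rewrite AU in LA; rewrite BU in LB.
suff E : (fun i => \int[mu]_(x in A i) (k x)%:E)%E = (fun i => \int[mu]_(t in B i) (k (expR t) * expR t)%:E)%E.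
  by rewrite E in LA; exact: (cvg_unique _ LA LB).
apply/funext => i; rewrite /A /B.
have dE : (@expR R)^`() = expR.
  by apply: is_derive_derive1 => x; exact: is_derive_expR.
rewrite (@integration_by_substitution_increasing R expR k (- i%:R) i%:R).
- by rewrite dE.
- by rewrite ge0_cp.
- by move=> x y _ _ xy; rewrite ltr_expR.
- by rewrite dE => x _; exact: continuous_expR.
- by rewrite dE; apply/cvg_ex; exists (expR (- i%:R)); apply: cvg_at_right_filter; exact: continuous_expR.
- by rewrite dE; apply/cvg_ex; exists (expR i%:R); apply: cvg_at_left_filter; exact: continuous_expR.
- split; first by move=> x _; exact: (@ex_derive _ _ _ _ _ _ _ (is_derive_expR x)).
  + by apply: cvg_at_right_filter; exact: continuous_expR.
  + by apply: cvg_at_left_filter; exact: continuous_expR.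
- exact: continuous_subspaceT.
Qed.

Lemma ge0_integral_affine_subst k (a b : R) : 0 < b -> continuous k -> (forall x, 0 <= k x) ->
  (\int[mu]_x (k x)%:E = \int[mu]_t (k (a + b * t) * b)%:E)%E.
Proof.
move=> b0 ck k0; pose F t : R := a + b * t.
have FE : F = (fun r => a + r) \o (fun t => t * b) by apply/funext => t; rewrite /F/= mulrC.
have dE : F^`() = cst b by apply: is_derive_derive1 => x; exact: is_derive1_affine.
rewrite (@increasing_ge0_integration_by_substitutionT R F k).
- by apply: eq_integral => t _; rewrite dE.
- by move=> x y xy; rewrite /F ltrD2l ltr_pM2l.
- by rewrite dE => x; exact: cvg_cst.
- by rewrite dE; exact: is_cvg_cst.
- by rewrite dE; exact: is_cvg_cst.
- by move=> x; exact: (@ex_derive _ _ _ _ _ _ _ (is_derive1_affine a b x)).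
- rewrite FE; apply: (@cvg_comp _ _ _ (fun t => t * b) (fun r => a + r)).
    by apply: gt0_cvgMlNy => //; exact: cvg_id.
  exact: cvg_addrl_Ny.
- rewrite FE; apply: (@cvg_comp _ _ _ (fun t => t * b) (fun r => a + r)).
    by apply: gt0_cvgMly => //; exact: cvg_id.
  exact: cvg_addrl.
- by [].
- by [].
Qed.

(* The density at [v] of the product of two independent standard normal variables, after the
   change of variables [x = exp t] in the first one. *)
Definition product_density v : \bar R :=
  (\int[mu]_t (2 * (phi (v * expR (- t)) * phi (expR t)))%:E)%E.

Lemma phi_even x : phi (- x) = phi x.
Proof. by rewrite !phiE sqrrN. Qed.

Lemma continuous_phi_mix v : continuous (fun t : R => 2 * (phi (v * expR (- t)) * phi (expR t))).
Proof.
move=> t; apply: cvgM; first exact: cvg_cst.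
apply: cvgM; last by apply: (@continuous_comp _ _ _ expR phi); [exact: continuous_expR|exact: phi_cont].
apply: (@continuous_comp _ _ _ (fun t => v * expR (- t)) phi); last exact: phi_cont.
apply: cvgM; first exact: cvg_cst.
by apply: (@continuous_comp _ _ _ -%R expR); [exact: continuousN|exact: continuous_expR].
Qed.

Lemma measurable_phi_mix : measurable_fun setT
  (fun w : R * R => (2 * (phi (w.2 * expR (- w.1)) * phi (expR w.1)))%:E).
Proof.
have mphi : measurable_fun setT (phi : R -> R).
  by apply: continuous_measurable_fun; exact: phi_cont.
apply/measurable_EFinP; apply: measurable_funM => //; apply: measurable_funM.
  apply: (measurableT_comp mphi); apply: measurable_funM => //.
  by apply: measurableT_comp => //; exact: measurableT_comp.
by apply: (measurableT_comp mphi); exact: measurableT_comp.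
Qed.

Lemma phi_mix_ge0 v t : 0 <= 2 * (phi (v * expR (- t)) * phi (expR t)) :> R.
Proof. by rewrite mulr_ge0// mulr_ge0// phi_ge0. Qed.

Lemma measurable_product_density : measurable_fun setT product_density.
Proof.
apply: (measurable_fun_fubini_tonelli_G (m1 := mu)
  (fun w : R * R => (2 * (phi (w.2 * expR (- w.1)) * phi (expR w.1)))%:E)).
  exact: measurable_phi_mix.
by move=> w; rewrite lee_fin phi_mix_ge0.
Qed.

Lemma EFin_gE (u : R -> R) : pg u -> ((gE u)%:E = \int[mu]_x (u x * phi x)%:E)%E.
Proof.
move=> pu; rewrite /gE /Rintegral fineK//.
by apply: integrable_fin_num => //; exact: pg_integrable.
Qed.

Lemma gE_ge0 (u : R -> R) : (forall x, 0 <= u x) -> 0 <= gE u.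
Proof. by move=> u0; apply: Rintegral_ge0 => x _; rewrite mulr_ge0// phi_ge0. Qed.

(** Nonnegativity gives Tonelli: the outer integral is folded to [x > 0] by parity, which is the
    factor 2 of [product_density]; then [x = exp t], [v = x z] in the inner integral, and the order
    is exchanged. *)
Lemma gauss_product_mix f : Ck 2 f -> (forall x, 0 <= f x) ->
  ((gauss_product f)%:E = \int[mu]_v ((f v)%:E * product_density v))%E.
Proof.
move=> Cf f0; have pf := Ck_pg Cf; have cf := pf.1.
have mf : measurable_fun setT f by exact: continuous_measurable_fun.
have pk : pg (fun x => gE (fun z => f (x * z))) by apply: gE_pg; exact: pg2_mul.
pose k x := gE (fun z => f (x * z)) * phi x.
have k0 x : 0 <= k x by rewrite mulr_ge0 ?phi_ge0// gE_ge0.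
have ck : continuous k by move=> x; apply: cvgM; [exact: pk.1|exact: phi_cont].
have evk : k =1 k \o -%R.
  move=> x; rewrite /k /= phi_even; congr (_ * _).
  by rewrite -!gauss_mix0 gauss_mix_even.
rewrite /gauss_product EFin_gE// (ge0_symfun_integralT k0 ck evk) -set_itvcy.
rewrite -integral_itv_obnd_cbnd; last first.
  by apply/measurable_EFinP; apply: measurable_funTS; exact: continuous_measurable_fun.
rewrite ge0_integral_expR_subst//.
pose g (t v : R) := f v * (2 * (phi (v * expR (- t)) * phi (expR t))).
have g0 t v : 0 <= g t v by rewrite mulr_ge0// phi_mix_ge0.
have inner t : (2%:E * (k (expR t) * expR t)%:E = \int[mu]_v (g t v)%:E)%E.
  have pt : pg (fun z => f (expR t * z)).
    by have := pg_affine 0 (expR t) pf; under eq_fun do rewrite add0r.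
  have e0 := expR_gt0 (- t); have et : expR t != 0 by rewrite gt_eqF// expR_gt0.
  have G0 z : 0 <= f (expR t * z) * phi z by rewrite mulr_ge0// phi_ge0.
  have cG : continuous (fun z => f (expR t * z) * phi z).
    by move=> z; apply: cvgM; [exact: pt.1|exact: phi_cont].
  rewrite /k (_ : (_ * phi _ * _)%:E = (phi (expR t) * expR t)%:E * (gE (fun z => f (expR t * z)))%:E)%E; last first.
    by rewrite -EFinM; congr EFin; ring.
  rewrite EFin_gE// (ge0_integral_affine_subst 0 e0 cG G0) muleA -EFinM.
  rewrite -ge0_integralZl_EFin//; first last.
  - by rewrite mulr_ge0// mulr_ge0 ?phi_ge0// expR_ge0.
  - apply/measurable_EFinP; apply: measurable_funM => //.
    apply: (measurableT_comp (continuous_measurable_fun cG)).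
    by apply: measurable_funD => //; exact: measurable_funM.
  - by move=> v _; rewrite lee_fin mulr_ge0// ltW.
  apply: eq_integral => v _; rewrite -EFinM; congr EFin; rewrite /g add0r mulrA expRN.
  rewrite divff// mul1r (mulrC v); field.
  by rewrite et.
rewrite -ge0_integralZl_EFin//; first last.
- by apply/measurable_EFinP; apply: continuous_measurable_fun => t; apply: cvgM;
    [apply: continuous_comp; [exact: continuous_expR|exact: ck]|exact: continuous_expR].
- by move=> t _; rewrite lee_fin mulr_ge0// expR_ge0.
under eq_integral do rewrite inner.
have mg : measurable_fun setT (fun w : R * R => (g w.1 w.2)%:E).
  apply/measurable_EFinP; apply: measurable_funM.
    exact: (measurableT_comp mf).
  by have /measurable_EFinP := measurable_phi_mix.
rewrite (fubini_tonelli (m1 := mu) (m2 := mu) (fun w : R * R => (g w.1 w.2)%:E) mg); last first.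
  by move=> w; rewrite lee_fin.
apply: eq_integral => v _ /=; rewrite -ge0_integralZl_EFin//.
- by move=> t _; rewrite lee_fin phi_mix_ge0.
- by apply/measurable_EFinP; apply: continuous_measurable_fun; exact: continuous_phi_mix.
Qed.

Lemma normal_peak1_sqr : normal_peak 1 ^+ 2 = (2 * pi)^-1 :> R.
Proof.
rewrite /normal_peak exprVn sqr_sqrtr; last by rewrite expr1n mul1r mulrn_wge0// pi_ge0.
by rewrite expr1n mul1r -mulr_natl.
Qed.

Lemma coshN t : cosh (- t) = cosh t :> R.
Proof. by rewrite /cosh opprK addrC. Qed.

Lemma continuous_cosh : continuous (@cosh R).
Proof.
move=> t; apply: cvgM; last exact: cvg_cst.
apply: cvgD; first exact: continuous_expR.
by apply: continuous_comp; [exact: continuousN|exact: continuous_expR].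
Qed.

(** The shift by [ln |v| / 2] balances the two exponents: with [t = (ln |v| + s) / 2], [v^2 exp (-2
    t) + exp (2 t) = 2 |v| cosh s]. The constant [1 / (2 pi)] is doubled by folding the even
    integrand. *)
Lemma product_density_VG v : v != 0 -> product_density v = VG1010_density v.
Proof.
move=> v0; have nv0 : 0 < `|v| by rewrite normr_gt0.
have h0 : 0 < 2^-1 :> R by [].
rewrite /product_density (ge0_integral_affine_subst (ln `|v| / 2) h0 (@continuous_phi_mix v) (phi_mix_ge0 v)).
pose g s := (2 * pi)^-1 * expR (- (`|v| * cosh s)) : R.
have gE_ s : 2 * (phi (v * expR (- (ln `|v| / 2 + 2^-1 * s))) * phi (expR (ln `|v| / 2 + 2^-1 * s))) * 2^-1 = g s.
  rewrite !phiE /g -normal_peak1_sqr.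
  rewrite (_ : 2 * _ * 2^-1 = normal_peak 1 ^+ 2 *
    (expR (- (v * expR (- (ln `|v| / 2 + 2^-1 * s))) ^+ 2 / 2) *
     expR (- expR (ln `|v| / 2 + 2^-1 * s) ^+ 2 / 2))); last by field.
  rewrite -expRD; congr (_ * expR _).
  rewrite exprMn -!expRM_natl (_ : 2%:R * - _ = - ln `|v| - s); last by field.
  rewrite (_ : 2%:R * (_ + _) = ln `|v| + s); last by field.
  rewrite !expRD expRN lnK ?posrE// -(real_normK (num_real v)) /cosh; field.
  by rewrite gt_eqF.
under eq_integral do rewrite gE_.
have g0 s : 0 <= g s by rewrite mulr_ge0 ?expR_ge0// invr_ge0 mulr_ge0// pi_ge0.
have ce : continuous (fun s => expR (- (`|v| * cosh s))).
  move=> s; apply: (@continuous_comp _ _ _ (fun s => - (`|v| * cosh s)) expR); last exact: continuous_expR.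
  by apply: cvgN; apply: cvgM; [exact: cvg_cst|exact: continuous_cosh].
have cg : continuous g by move=> s; apply: cvgM; [exact: cvg_cst|exact: ce].
have evg : g =1 g \o -%R by move=> s; rewrite /g /= coshN.
rewrite (ge0_symfun_integralT g0 cg evg) -set_itvcy /VG1010_density /besselK.
under eq_integral do rewrite /g EFinM.
rewrite ge0_integralZl_EFin//; first last.
- by rewrite invr_ge0 mulr_ge0// pi_ge0.
- by apply/measurable_EFinP; apply: measurable_funTS; exact: continuous_measurable_fun.
rewrite muleA -EFinM; congr (_%:E * _)%E.
  by rewrite invfM mulrA divff ?mul1r ?pnatr_eq0.
apply: eq_integral => s _; congr EFin.
by rewrite mul0r /cosh oppr0 expR0 (_ : (1 + 1) / 2 = 1) ?mulr1//; field.
Qed.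

Lemma measurable_VG : measurable_fun setT (@VG1010_density R).
Proof.
rewrite (_ : @VG1010_density R = fun v => if v == 0 then VG1010_density 0 else product_density v).
  apply: measurable_fun_ifT; [|exact: measurable_cst|exact: measurable_product_density].
  exact: measurable_fun_eqr.
by apply/funext => v; case: eqVneq => [->//|/product_density_VG ->].
Qed.

(** The hypothesis on the law speaks of sets. It makes the law absolutely continuous and identifies
    its Radon-Nikodym derivative with [VG1010_density] almost everywhere, which gives the formula
    for functions. *)
Lemma ge0_integral_VG d (Omega : measurableType d) (Q : probability Omega R) (V : {RV Q >-> R}) f :
  has_VG1010_law V -> measurable_fun setT f -> (forall x, 0 <= f x) ->
  (\int[Q]_w (f (V w))%:E = \int[mu]_v ((f v)%:E * VG1010_density v))%E.
Proof.
move=> VL mf f0.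
have mfE : measurable_fun setT (EFin \o f) by exact/measurable_EFinP.
have f0E x : (0 <= (EFin \o f) x)%E by rewrite /= lee_fin.
have mV0 : measurable_fun setT (V : Omega -> R) by exact: measurable_funP.
have mV : measurable_fun setT (V : Omega -> measurableTypeR R) by exact: mV0.
pose mixV := isMeasurableFun.Build _ _ _ _ _ mV.
pose W : {mfun Omega >-> measurableTypeR R} := HB.pack (V : Omega -> measurableTypeR R) mixV.
pose nu := distribution Q W.
have nuE S : measurable S -> nu S = (\int[mu]_(x in S) VG1010_density x)%E by exact: VL.
have := @ge0_integral_distribution _ _ Omega (measurableTypeR R) R Q W _ mfE f0E => /= <-.
have dom : nu `<< mu.
  apply/null_content_dominatesP => S mS S0; rewrite nuE//.
  by apply: null_set_integral => //; apply: measurable_funTS; exact: measurable_VG.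
rewrite -(Radon_Nikodym_SigmaFinite.change_of_variables dom)//.
have RNi := Radon_Nikodym_SigmaFinite.f_integrable dom.
apply: ae_eq_integral => //.
- by apply: emeasurable_funM => //; exact: measurable_int RNi.
- by apply: emeasurable_funM => //; exact: measurable_VG.
apply: ae_eqe_mul2l; apply: integral_ae_eq => //; first exact: measurable_VG.
by move=> E _ mE; rewrite -Radon_Nikodym_SigmaFinite.f_integral//; exact: nuE.
Qed.

Lemma ge0_expectation_VG d (Omega : measurableType d) (Q : probability Omega R) (V : {RV Q >-> R}) f :
  has_VG1010_law V -> Ck 2 f -> (forall x, 0 <= f x) ->
  (\int[Q]_w (f (V w))%:E = (gauss_product f)%:E)%E.
Proof.
move=> VL Cf f0; have cf := (Ck_pg Cf).1.
have mf : measurable_fun setT f by exact: continuous_measurable_fun.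
rewrite gauss_product_mix// (ge0_integral_VG VL)//; apply: ae_eq_integral => //.
- by apply: emeasurable_funM; [exact/measurable_EFinP|exact: measurable_VG].
- by apply: emeasurable_funM; [exact/measurable_EFinP|exact: measurable_product_density].
(* The two densities can differ only at 0. *)
apply: ae_eqe_mul2l; exists [set 0]; split => //; first exact: lebesgue_measure_set1.
by move=> v /= /not_implyP[_ nv]; apply: contrapT => /eqP v0; apply: nv; rewrite product_density_VG.
Qed.

Lemma CkD (k : nat) (u w : R -> R) : Ck k u -> Ck k w -> Ck k (fun x => u x + w x).
Proof.
elim: k u w => [|k IH] u w Cu Cw; first by split => //; apply: pgD; [exact: Ck_pg Cu|exact: Ck_pg Cw].
apply: (@CkP _ k _ (fun x => derive1 u x + derive1 w x)).
- by apply: pgD; [exact: Ck_pg Cu|exact: Ck_pg Cw].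
- by move=> x; apply: is_derive1D; [exact: (Ck_is_derive Cu)|exact: (Ck_is_derive Cw)].
- by apply: IH; exact: CkS.
Qed.

Lemma Ck2_sqr (a : R) : Ck 2 (fun x => a + a * x ^+ 2).
Proof.
have pc c : pg (fun _ : R => c) := pg_cst c.
apply: (@CkP _ 1 _ (fun x => 2 * a * x)).
- by apply: pgD => //; apply: pgZ; exact: pg_pow.
- move=> x; apply: (is_derive_eq (is_derive1D (is_derive_cst a x 1) (is_derive1Z a (is_derive_pow 1 x)))).
  by rewrite expr1; ring.
apply: (@CkP _ 0 _ (fun=> 2 * a)).
- by apply: pgZ; exact: pg_id.
- move=> x; apply: (is_derive_eq (is_derive1Z (2 * a) (is_derive_id x 1))).
  by rewrite mulr1.
- by [].
Qed.

(** A signed [h] is the difference of [h + (a + a x^2)] and [a + a x^2], both nonnegative and in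
    [Ck 2]; positive and negative parts need not be smooth. *)
Lemma expectation_VG d (Omega : measurableType d) (Q : probability Omega R) (V : {RV Q >-> R}) h (a : R) :
  has_VG1010_law V -> Ck 2 h -> (forall x, `|h x| <= a + a * x ^+ 2) ->
  ('E_Q[h \o V] = (gauss_product h)%:E)%E.
Proof.
move=> VL Ch ha; have Ca := Ck2_sqr a; have Cha := CkD Ch Ca.
have a0 x : 0 <= a + a * x ^+ 2 by exact: le_trans (ha x).
have ha0 x : 0 <= h x + (a + a * x ^+ 2).
  by have := ha x; rewrite ler_norml => /andP[+ _]; rewrite -lerBlDr sub0r.
have E1 := ge0_expectation_VG VL Cha ha0; have E2 := ge0_expectation_VG VL Ca a0.
have mV : measurable_fun setT V by exact: measurable_funP.
have intg f : Ck 2 f -> (forall x, 0 <= f x) -> Q.-integrable setT (EFin \o (f \o V)).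
  move=> Cf f0; apply/integrableP; split.
    apply/measurable_EFinP; apply: measurableT_comp => //.
    by apply: continuous_measurable_fun; exact: (Ck_pg Cf).1.
  under eq_integral do rewrite /= ger0_norm//.
  by rewrite (ge0_expectation_VG VL)// ltry.
rewrite unlock (_ : (fun w => _) = (fun w => ((h (V w) + (a + a * V w ^+ 2)) - (a + a * V w ^+ 2))%:E)); last first.
  by apply/funext => w /=; rewrite addrK.
rewrite (integralB_EFin measurableT (intg _ Cha ha0) (intg _ Ca a0)) /= E1 E2 -EFinB; congr EFin.
have ph := Ck_pg Ch; have pa := Ck_pg Ca.
rewrite /gauss_product -gEB; last 2 first.
- by apply: gE_pg; exact: (pg2_mul (pgD ph pa)).
- exact: (gE_pg (pg2_mul pa)).
congr gE; apply/funext => x; rewrite -gEB.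
- by congr gE; apply/funext => z; rewrite addrK.
- exact: (pg2_section x (pg2_mul (pgD ph pa))).
- exact: (pg2_section x (pg2_mul pa)).
Qed.

End variance_gamma.

(** * Letters and test functions *)

Section letters.
Context {R : realType}.
Local Open Scope classical_set_scope.
Implicit Types (p q d x y : R) (m n : nat) (u c : R -> R).

Definition letter_weight p q (l : bool) : R := if l then q else p.

Lemma sum_ffun_recl m (F : {ffun 'I_m.+1 -> bool} -> R) :
  \sum_(w : {ffun 'I_m.+1 -> bool}) F w =
  \sum_(l : bool) \sum_(w : {ffun 'I_m -> bool})
    F [ffun i => if unlift ord0 i is Some j then w j else l].
Proof.
pose f (lw : bool * {ffun 'I_m -> bool}) : {ffun 'I_m.+1 -> bool} :=
  [ffun i => if unlift ord0 i is Some j then lw.2 j else lw.1].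
pose g (w : {ffun 'I_m.+1 -> bool}) : bool * {ffun 'I_m -> bool} :=
  (w ord0, [ffun j => w (lift ord0 j)]).
have fK : cancel f g.
  move=> [l w]; rewrite /f /g ffunE unlift_none/=; congr pair.
  by apply/ffunP => j; rewrite !ffunE liftK.
have gK : cancel g f.
  move=> w; apply/ffunP => i; rewrite ffunE /=.
  by case: unliftP => [j ->|->]; rewrite ?ffunE.
rewrite (reindex f); last by exists g => ? _; [exact: fK|exact: gK].
by rewrite pair_bigA.
Qed.

(** Summing over the first letter of a word is one application of [twopt]; the free starting point
    [x] absorbs that letter in the induction. *)
Lemma sum_ffun_iter p q (al be d : R) m u x :
  \sum_(w : {ffun 'I_m -> bool}) u (x + \sum_i d * (if w i then be else al)) *
     \prod_i letter_weight p q (w i) =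
  iter m (twopt p q al be d) u x.
Proof.
elim: m x => [|m IH] x.
  rewrite (eq_bigr (fun=> u x)); last by move=> w _; rewrite !big_ord0 addr0 mulr1.
  by rewrite sumr_const card_ffun card_ord expn0.
pose cons (l : bool) (w : {ffun 'I_m -> bool}) : {ffun 'I_m.+1 -> bool} :=
  [ffun i => if unlift ord0 i is Some j then w j else l].
have step l w : u (x + \sum_i d * (if cons l w i then be else al)) *
      \prod_i letter_weight p q (cons l w i) =
    letter_weight p q l * (u (x + d * (if l then be else al) +
      \sum_i d * (if w i then be else al)) * \prod_i letter_weight p q (w i)).
  rewrite !big_ord_recl !ffunE unlift_none mulrCA addrA; congr (_ * (u (_ + _) * _)).
    by apply: eq_bigr => i _; rewrite ffunE liftK.
  by apply: eq_bigr => i _; rewrite ffunE liftK.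
rewrite sum_ffun_recl big_bool /= addrC [RHS]/twopt -!IH !mulr_sumr.
by congr (_ + _); apply: eq_bigr => w _; exact: step.
Qed.

Lemma sum_ffun_sum m n (F : {ffun 'I_m + 'I_n -> bool} -> R) :
  \sum_(w : {ffun 'I_m + 'I_n -> bool}) F w =
  \sum_(w1 : {ffun 'I_m -> bool}) \sum_(w2 : {ffun 'I_n -> bool})
    F [ffun k => match k with inl i => w1 i | inr j => w2 j end].
Proof.
pose f (w : {ffun 'I_m -> bool} * {ffun 'I_n -> bool}) : {ffun 'I_m + 'I_n -> bool} :=
  [ffun k => match k with inl i => w.1 i | inr j => w.2 j end].
pose g (w : {ffun 'I_m + 'I_n -> bool}) : {ffun 'I_m -> bool} * {ffun 'I_n -> bool} :=
  ([ffun i => w (inl i)], [ffun j => w (inr j)]).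
have fK : cancel f g.
  by move=> [w1 w2]; congr pair; apply/ffunP => i; rewrite !ffunE.
have gK : cancel g f by move=> w; apply/ffunP => -[i|j]; rewrite !ffunE.
rewrite (reindex f); last by exists g => ? _; [exact: fK|exact: gK].
by rewrite pair_bigA.
Qed.

Context (disp : measure_display) (Omega : measurableType disp) (P : probability Omega R).

(** [F] of the random word is a finite combination of the indicators of the events that the whole
    word equals [w], whose probabilities factor by independence. *)
Lemma iid_expectation (I : finType) (L : I -> {RV P >-> bool}) p q (F : {ffun I -> bool} -> R) :
  iid_letters p q L ->
  ('E_P[fun t => F [ffun i => L i t]] =
  (\sum_(w : {ffun I -> bool}) F w * \prod_i letter_weight p q (w i))%:E)%E.
Proof.
move=> [ind law].
pose E (w : {ffun I -> bool}) := \bigcap_(i in [set` [set: I]%SET]) (L i @^-1` [set w i]).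
have mL i l : measurable (L i @^-1` [set l]).
  by rewrite -[X in measurable X]setTI; apply: (measurable_funP (L i)).
have mE w : measurable (E w).
  by apply: fin_bigcap_measurable => // i _; exact: mL.
have PE w : P (E w) = (\prod_i letter_weight p q (w i))%:E.
  rewrite /E ind// -prodEFin; apply: eq_big => [i|i _]; first by rewrite inE.
  by have [l1 l2] := law i; case: (w i).
have FE t : (F [ffun i => L i t])%:E = (\sum_(w : {ffun I -> bool}) (F w)%:E * (\1_(E w) t)%:E)%E.
  rewrite (bigD1 [ffun i => L i t])//= big1 ?adde0 => [|w wt].
    by rewrite indicE mem_set ?mule1// => i _; rewrite /= ffunE.
  rewrite indicE memNset ?mule0// => Ewt; move/eqP: wt; apply; apply/ffunP => i.
  by rewrite ffunE; apply/esym/(Ewt i); rewrite /= inE.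
rewrite unlock; under eq_integral do rewrite FE.
have iE w : P.-integrable setT (fun t => (F w)%:E * (\1_(E w) t)%:E)%E.
  by apply: integrableZl => //; exact: (integrable_indic P (mE w)).
rewrite integral_sum//= -sumEFin; apply: eq_bigr => w _.
rewrite integralZl//; last exact: (integrable_indic P (mE w)).
by rewrite integral_indic// setIT EFinM; congr (_ * _)%E; exact: PE.
Qed.

Lemma letters_expectation m n (A : 'I_m -> {RV P >-> bool}) (B : 'I_n -> {RV P >-> bool})
    p q (al be dm dn : R) (F : R -> R -> R) :
  independent_letter_sequences p q A B ->
  ('E_P[fun t => (F (\sum_i dm * (if A i t then be else al)) (\sum_j dn * (if B j t then be else al)))%R] =
  (iter m (twopt p q al be dm) (fun x => iter n (twopt p q al be dn) (F x) 0) 0)%:E)%E.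
Proof.
move=> AB.
pose H (w : {ffun 'I_m + 'I_n -> bool}) :=
  F (\sum_i dm * (if w (inl i) then be else al)) (\sum_j dn * (if w (inr j) then be else al)).
have := iid_expectation H AB.
rewrite (_ : (fun t => _) = (fun t => F (\sum_i dm * (if A i t then be else al))
    (\sum_j dn * (if B j t then be else al)))); last first.
  by apply/funext => t; congr F; apply: eq_bigr => i _; rewrite ffunE.
move=> ->; congr EFin; rewrite sum_ffun_sum -sum_ffun_iter; apply: eq_bigr => w1 _.
rewrite add0r -sum_ffun_iter mulr_suml; apply: eq_bigr => w2 _.
rewrite add0r big_sumType /= mulrA mulrAC; congr (_ * _ * _).
- by congr F; apply: eq_bigr => i _; rewrite ffunE.
- by apply: eq_bigr => i _; rewrite ffunE.
- by apply: eq_bigr => i _; rewrite ffunE.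
Qed.

End letters.

(** * Test functions with essentially bounded derivatives *)

Section test_functions.
Context {R : realType}.
Local Open Scope classical_set_scope.
Implicit Types (u h : R -> R) (x : R).

Lemma supnorm_ge0 u : (0 <= supnorm u)%E.
Proof.
apply: ess_sup_gee; last by apply: aeW => t; rewrite lee_fin.
apply: (@lt_le_trans _ _ (lebesgue_measure (`[0%R, 1%R]%classic : set R))).
  by rewrite lebesgue_measure_itv/= lte01 -EFinB lte_fin subr0.
by apply: le_measure => //; rewrite inE.
Qed.

(** If a continuous [|u|] exceeded its essential supremum at a point, it would do so on an interval,
    a set of positive measure. *)
Lemma supnorm_bound u x : continuous u -> (supnorm u < +oo)%E ->
  `|u x| <= fine (supnorm u).
Proof.
move=> cu uy; have u0 := supnorm_ge0 u.
have uE : supnorm u = (fine (supnorm u))%:E by rewrite fineK// ge0_fin_numE.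
rewrite leNgt; apply/negP => ux; set B := fine (supnorm u) in uE ux.
have /(_ x)/cvg_norm := cu => /cvgr_gt/(_ _ ux)[e /= e0 eu].
have xe : x - e < x + e by lra.
have [N [mN N0 uN]] := ess_sup_ge (@lebesgue_measure R) (fun x => `|u x|%:E).
have IN : `]x - e, x + e[ `<=` N.
  move=> y /=; rewrite in_itv/= => /andP[y1 y2]; apply: uN => /=; apply/negP.
  rewrite -/(supnorm u) uE lee_fin -ltNge; apply: eu => /=.
  by rewrite ltr_norml; apply/andP; split; lra.
have : (lebesgue_measure `](x - e)%R, (x + e)%R[ <= lebesgue_measure N)%E.
  by apply: le_measure => //; rewrite inE.
by rewrite N0 lebesgue_measure_itv/= lte_fin xe -EFinB lee_fin leNgt subr_gt0 xe.
Qed.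

Lemma locally_AC_continuous u : locally_absolutely_continuous u -> continuous u.
Proof.
move=> acu x; apply/cvgrPdist_lt => e e0.
have [|d d0 du] := acu (x - 1) (x + 1) _ e e0; first lra.
near=> y.
have yx : `|y - x| < Num.min d 1.
  by rewrite distrC; near: y; apply: cvgr_dist_lt => //; rewrite lt_min d0 ltr01.
have [yd y1] : `|y - x| < d /\ `|y - x| < 1 by move: yx; rewrite lt_min => /andP.
(* Absolute continuity is used with a single interval, whose end points [min] and [max] put in
   order. *)
have := du 1%N (fun=> Num.min x y) (fun=> Num.max x y).
rewrite !big_ord1; move: y1 yd; case: (leP x y) => xy; rewrite ltr_norml => /andP[y1 y2].
- rewrite ger0_norm ?subr_ge0// => yd /(_ _ _ yd) H.
  rewrite distrC; apply: H; first by move=> _; split; [|split]; lra.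
  by move=> i j; rewrite !ord1 eqxx.
- rewrite ltr0_norm ?subr_lt0// opprB => yd /(_ _ _ yd) H.
  apply: H; first by move=> _; split; [|split]; lra.
  by move=> i j; rewrite !ord1 eqxx.
Unshelve. all: by end_near. Qed.

Lemma Cb_continuous k h j : Cb k.+1 h -> (j <= k)%N -> continuous (derive1n j h).
Proof.
move=> [dh ach _]; rewrite leq_eqVlt => /predU1P[->|jk].
  exact: locally_AC_continuous.
by move=> x; apply/differentiable_continuous/derivable1_diffP; exact: dh.
Qed.

Lemma Cb_bound k h j x : Cb k.+1 h -> (0 < j <= k)%N ->
  `|derive1n j h x| <= fine (supnorm (derive1n j h)).
Proof.
move=> Ch /andP[j0 jk]; apply: supnorm_bound; first exact: Cb_continuous Ch jk.
by have [_ _ +] := Ch; apply; rewrite j0 (leq_trans jk).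
Qed.

Lemma Cb_is_derive k h j x : Cb k.+1 h -> (j < k)%N ->
  is_derive x 1 (derive1n j h) (derive1n j.+1 h x).
Proof.
by move=> [dh _ _] jk; apply: DeriveDef; [exact: dh|rewrite derive1nS derive1E].
Qed.

Lemma Cb_growth k h x : Cb k.+2 h ->
  `|h x| <= `|h 0| + fine (supnorm (derive1n 1 h)) * `|x|.
Proof.
move=> Ch; pose g y := h y + - h 0.
have dg (y : R) : is_derive y 1 g (derive1n 1 h y).
  by have := is_derive1D (@Cb_is_derive k.+1 h 0 y Ch isT) (is_derive_cst (- h 0) y 1); rewrite addr0.
have gB y : `|derive1n 1 h y| <= fine (supnorm (derive1n 1 h)) * `|y| ^+ 0.
  by rewrite expr0 mulr1; exact: (@Cb_bound k.+1 h 1 y Ch isT).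
have := power_bound dg (subrr _) gB x; rewrite expr1 divr1 => gx.
by have := ler_normD (g x) (h 0); rewrite /g subrK; rewrite /g in gx; lra.
Qed.

(** One order is lost because the last derivative exists only almost everywhere: [Cb 4] gives [Ck 3]
    and [Cb 3] gives [Ck 2]. The growth of [h] itself is linear, by [Cb_growth]. *)
Lemma Cb_Ck k h : Cb k.+2 h -> Ck k.+1 h.
Proof.
move=> Ch; apply: (proj1 (@Ck_seq _ (fun j => derive1n j h) _ _ _)).
  move=> [|j] jk.
    split; first exact: (Cb_continuous (j := 0) Ch).
    exists (`|h 0| + fine (supnorm (derive1n 1 h))), 1%N => x; rewrite expr1 /=.
    apply: (le_trans (Cb_growth x Ch)).
    have : 0 <= fine (supnorm (derive1n 1 h)) by rewrite fine_ge0// supnorm_ge0.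
    have := normr_ge0 (h 0); have := normr_ge0 x; nra.
  apply: (pg_bounded (Cb_continuous Ch jk)) => x.
  exact: Cb_bound Ch _.
by move=> j x jk; exact: Cb_is_derive Ch jk.
Qed.

Lemma Cb_sqr_growth k h x : Cb k.+2 h ->
  let a := `|h 0| + fine (supnorm (derive1n 1 h)) in `|h x| <= a + a * x ^+ 2.
Proof.
move=> Ch /=; apply: (le_trans (Cb_growth x Ch)).
have : 0 <= fine (supnorm (derive1n 1 h)) by rewrite fine_ge0// supnorm_ge0.
rewrite -(real_normK (num_real x)); set M := fine _; have := normr_ge0 (h 0).
have := normr_ge0 x; move: `|x| `|h 0| => y H y0 H0 M0.
have P1 := mulr_ge0 H0 (sqr_ge0 y); have P2 := mulr_ge0 M0 (sqr_ge0 (y - 1)).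
have P3 := mulr_ge0 M0 y0; lra.
Qed.

Lemma Cb_supnormE k h j : Cb k.+1 h -> (0 < j <= k.+1)%N ->
  exists b : R, [/\ supnorm (derive1n j h) = b%:E, 0 <= b &
    (j <= k)%N -> forall x, `|derive1n j h x| <= b].
Proof.
move=> Ch /andP[j0 jk]; exists (fine (supnorm (derive1n j h))); split.
- have [_ _ /(_ j) bh] := Ch.
  by rewrite fineK// ge0_fin_numE ?supnorm_ge0// bh// j0.
- by rewrite fine_ge0// supnorm_ge0.
- by move=> j'k x; apply: Cb_bound Ch _; rewrite j0.
Qed.

End test_functions.

(** * Moments of the standardized letter *)

Section letter_law.
Context {R : realType} (p q : R).
Hypotheses (p_gt0 : 0 < p) (q_gt0 : 0 < q) (pq1 : p + q = 1).
Local Open Scope classical_set_scope.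

(** The indicator of the letter 0, centred at [p] and divided by [sqrt (p q)], is [q / sqrt (p q)]
    on the letter 0 and [- p / sqrt (p q)] on the letter 1. *)
Let al := Num.sqrt (q / p).
Let be := - Num.sqrt (p / q).

Lemma sqrt_div (x y : R) : 0 < x -> 0 < y -> Num.sqrt (x / y) = Num.sqrt x / Num.sqrt y.
Proof. by move=> x0 y0; rewrite sqrtrM ?ltW// sqrtrV// ltW. Qed.

Lemma letter_mean : p * al + q * be = 0.
Proof.
rewrite /al /be !sqrt_div//.
have rp : 0 < Num.sqrt p by rewrite sqrtr_gt0.
have rq : 0 < Num.sqrt q by rewrite sqrtr_gt0.
rewrite -{1}(sqr_sqrtr (ltW p_gt0)) -{2}(sqr_sqrtr (ltW q_gt0)); field.
by rewrite !gt_eqF.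
Qed.

Lemma letter_var : p * al ^+ 2 + q * be ^+ 2 = 1.
Proof.
rewrite /al /be sqrrN !sqr_sqrtr ?divr_ge0 ?ltW// -pq1; field.
by rewrite !gt_eqF.
Qed.

Lemma letter_mom4 : mom p q al be 4 = (p * q)^-1 - 3.
Proof.
rewrite /mom -[4%N]/(2 * 2)%N !exprM /al /be sqrrN !sqr_sqrtr ?divr_ge0 ?ltW//.
have -> : q = 1 - p by rewrite -pq1 addrC addKr.
field; rewrite !gt_eqF//; move: q_gt0; rewrite -pq1; lra.
Qed.

Lemma absmom3_le : absmom p q al be 3 <= (1 + mom p q al be 4) / 2.
Proof.
have H (t : R) : `|t| ^+ 3 <= (t ^+ 2 + t ^+ 4) / 2.
  rewrite (_ : t ^+ 4 = `|t| ^+ 4); last by rewrite -normrX ger0_norm// exprn_even_ge0.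
  by rewrite -(real_normK (num_real t)); have := sqr_ge0 (`|t| * (`|t| - 1)); lra.
rewrite /absmom /mom; have := letter_var.
have := ler_wpM2l (ltW p_gt0) (H al); have := ler_wpM2l (ltW q_gt0) (H be); lra.
Qed.

Lemma norm_mom3_le : `|mom p q al be 3| <= absmom p q al be 3.
Proof.
apply: (le_trans (ler_normD _ _)).
by apply: lerD; rewrite normrM normrX ger0_norm// ltW.
Qed.

Lemma four_pq : 4 <= (p * q)^-1.
Proof.
have pq0 : 0 < p * q by exact: mulr_gt0.
rewrite -[4]invrK lef_pV2 ?posrE//; have -> : q = 1 - p by rewrite -pq1 addrC addKr.
by have := sqr_ge0 (p - 2^-1); lra.
Qed.

(* With [y = 1 / (p q) - 4 >= 0], the prefactor [q^4/p^3 + p^4/q^3] is the polynomial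
   [1 + 6 y + 5 y^2 + y^3], and the constants of [product_clt_general] are bounded by
   polynomials in [y] of degree at most 3. *)
Lemma prefactorE : q ^+ 4 / p ^+ 3 + p ^+ 4 / q ^+ 3 =
  let y := (p * q)^-1 - 4 in 1 + 6 * y + 5 * y ^+ 2 + y ^+ 3.
Proof.
have -> : q = 1 - p by rewrite -pq1 addrC addKr.
rewrite /=; field; rewrite !gt_eqF//; move: q_gt0; rewrite -pq1; lra.
Qed.

(** [1253 = 7 * 179] and [1074 = 6 * 179], where 7 and 6 are the weights of the second and third
    derivatives in the theorem. With [m4 = y + 1], [beta <= (y + 6) / 12] and [|m3| <= (y + 2) / 2],
    the comparison holds coefficient by coefficient. *)
Lemma constants_le : let F := q ^+ 4 / p ^+ 3 + p ^+ 4 / q ^+ 3 in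
  let b := beta p q al be in let m4 := mom p q al be 4 in
  [/\ 0 <= F,
      1 + (m4 + 3) / 6 + 7 * `|mom p q al be 3| * (1 + 2 * b) <= 1253 * F &
      (2 * b + 24 * b ^+ 2) * ((4 + m4) / 2) <= 1074 * F].
Proof.
rewrite /= prefactorE letter_mom4 /=; set y := (p * q)^-1 - 4.
have y0 : 0 <= y by rewrite subr_ge0 four_pq.
have a3 := absmom3_le; rewrite letter_mom4 in a3.
have m3 := norm_mom3_le; have m30 := normr_ge0 (mom p q al be 3).
have b0 : 0 <= beta p q al be by apply: beta_ge0; exact: ltW.
have b1 : beta p q al be <= (y + 6) / 12 by rewrite /beta /y; lra.
move: b0 b1; set b := beta p q al be => b0 b1.
rewrite (_ : (p * q)^-1 - 3 = y + 1); last by rewrite /y; ring.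
have m31 : `|mom p q al be 3| <= (y + 2) / 2 by apply: (le_trans m3); rewrite /y; lra.
have y2 := sqr_ge0 y; have y3 : 0 <= y ^+ 3 by exact: exprn_ge0.
split; first lra.
- have : `|mom p q al be 3| * (1 + 2 * b) <= (y + 2) / 2 * (1 + 2 * ((y + 6) / 12)).
    by apply: ler_pM => //; lra.
  lra.
- have : b ^+ 2 <= ((y + 6) / 12) ^+ 2.
    by apply: lerXn2r; rewrite ?nnegrE//; lra.
  move=> b2; have : (2 * b + 24 * b ^+ 2) * ((4 + (y + 1)) / 2) <=
    (2 * ((y + 6) / 12) + 24 * ((y + 6) / 12) ^+ 2) * ((4 + (y + 1)) / 2).
    by apply: ler_wpM2r; lra.
  lra.
Qed.

End letter_law.

(** * Counts of letters as walks *)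

Section standardized_counts.
Context {R : realType} (disp : measure_display) (Omega : measurableType disp)
  (P : probability Omega R).
Local Open Scope classical_set_scope.
Implicit Types (p q : R) (m n : nat).

Definition count_walk p q m (A : 'I_m -> Omega -> bool) (t : Omega) : R :=
  \sum_i (Num.sqrt m%:R)^-1 * (if A i t then - Num.sqrt (p / q) else Num.sqrt (q / p)).

Lemma zeros_sum m (A : 'I_m -> Omega -> bool) t : zeros R A t = \sum_i (A i t == false)%:R.
Proof. by rewrite /zeros -sum1_card natr_sum big_mkcond; apply: eq_bigr => i _; rewrite inE; case: (A i t). Qed.

Lemma standardized_count p q m (A : 'I_m -> Omega -> bool) t :
  (0 < m)%N -> 0 < p -> 0 < q -> p + q = 1 ->
  (zeros R A t - m%:R * p) / Num.sqrt (m%:R * p * q) = count_walk p q A t.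
Proof.
move=> m0 p0 q0 pq1; rewrite zeros_sum.
rewrite [X in _ - X](_ : _ = \sum_(i < m) p); last by rewrite sumr_const card_ord mulr_natl.
rewrite -sumrB mulr_suml; apply: eq_bigr => i _.
have mR : 0 < m%:R :> R by rewrite ltr0n.
have rm : 0 < Num.sqrt m%:R :> R by rewrite sqrtr_gt0.
have rp : 0 < Num.sqrt p by rewrite sqrtr_gt0.
have rq : 0 < Num.sqrt q by rewrite sqrtr_gt0.
rewrite (sqrt_div q0 p0) (sqrt_div p0 q0) sqrtrM ?mulr_ge0 ?(ltW p0) ?(ltW mR)// sqrtrM ?(ltW mR)//.
have pE : p = Num.sqrt p ^+ 2 by rewrite sqr_sqrtr// ltW.
have qE : 1 - p = Num.sqrt q ^+ 2 by rewrite sqr_sqrtr ?ltW// -pq1 addrC addKr.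
case: (A i t) => /=; last by rewrite qE; field; rewrite !gt_eqF.
by rewrite sub0r {1}pE; field; rewrite !gt_eqF.
Qed.

End standardized_counts.

Section counts_of_letters.
Context {R : realType} (disp : measure_display) (Omega : measurableType disp)
  (P : probability Omega R) (m n : nat) (p q : R)
  (A : 'I_m -> {RV P >-> bool}) (B : 'I_n -> {RV P >-> bool}).
Hypotheses (m_gt0 : (0 < m)%N) (n_gt0 : (0 < n)%N).
Hypotheses (p_gt0 : 0 < p) (q_gt0 : 0 < q) (pq1 : p + q = 1).
Hypothesis AB : independent_letter_sequences p q A B.
Local Open Scope classical_set_scope.

Let al := Num.sqrt (q / p).
Let be := - Num.sqrt (p / q).
Let dm : R := (Num.sqrt m%:R)^-1.
Let dn : R := (Num.sqrt n%:R)^-1.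
Let S := count_walk p q A.
Let T := count_walk p q B.

Lemma inv_sqrt_step k : (0 < k)%N ->
  0 < (Num.sqrt k%:R)^-1 :> R /\ k%:R * (Num.sqrt k%:R)^-1 ^+ 2 = 1 :> R.
Proof.
move=> k0; have kR : 0 < k%:R :> R by rewrite ltr0n.
by rewrite invr_gt0 sqrtr_gt0 kR exprVn sqr_sqrtr ?(ltW kR)// divff// gt_eqF.
Qed.

Lemma inv_sqrt_steps : dm ^+ 2 + dn ^+ 2 = m%:R^-1 + n%:R^-1.
Proof. by rewrite /dm /dn !exprVn !sqr_sqrtr// ler0n. Qed.

Lemma D2star_walks : D2star p q m n (zeros R A) (zeros R B) = (fun t => S t * T t).
Proof. by apply/funext => t; rewrite /D2star !standardized_count. Qed.

Lemma walks_expectation (F : R -> R -> R) : ('E_P[fun t => (F (S t) (T t))%R] =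
  (iter m (twopt p q al be dm) (fun x => iter n (twopt p q al be dn) (F x) 0) 0)%:E)%E.
Proof. exact: (letters_expectation al be dm dn F AB). Qed.

Lemma walks_affine_expectation s c : ('E_P[fun t => (s * (S t * T t) + c)%R] = c%:E)%E.
Proof.
rewrite (walks_expectation (fun x y => s * (x * y) + c)); congr EFin.
rewrite -[RHS](iter_twopt_cst al be pq1 dm m c 0); congr (iter m _ _ 0).
apply/funext => x; transitivity (iter n (twopt p q al be dn)
    (fun y => s * x * id y + c * (fun=> 1) y) 0).
  by congr (iter n _ _ 0); apply/funext => y; rewrite mulrA mulr1.
rewrite iter_twopt_lin (iter_twopt_id pq1 (letter_mean p_gt0 q_gt0)).
by rewrite (iter_twopt_cst _ _ pq1) mulr0 add0r mulr1.
Qed.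

Lemma walks_sqr_expectation s : ('E_P[fun t => ((s * (S t * T t)) ^+ 2)%R] = (s ^+ 2)%:E)%E.
Proof.
have [_ md] := inv_sqrt_step m_gt0; have [_ nd] := inv_sqrt_step n_gt0.
have sqr0 d k (c : R) : k%:R * d ^+ 2 = 1 ->
    iter k (twopt p q al be d) (fun y => c * y ^+ 2) 0 = c.
  move=> kd; transitivity (iter k (twopt p q al be d)
      (fun y => c * (fun z => z ^+ 2) y + 0 * (fun=> 1) y) 0).
    by congr (iter k _ _ 0); apply/funext => y; rewrite mul0r addr0.
  rewrite iter_twopt_lin mul0r addr0.
  rewrite (iter_twopt_sqr pq1 (letter_mean p_gt0 q_gt0) (letter_var p_gt0 q_gt0 pq1)).
  by rewrite expr0n add0r kd mulr1.
rewrite (walks_expectation (fun x y => (s * (x * y)) ^+ 2)); congr EFin.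
rewrite -[RHS](sqr0 dm m _ md); congr (iter m _ _ 0); apply/funext => x.
rewrite -[RHS](sqr0 dn n _ nd); congr (iter n _ _ 0); apply/funext => y.
by rewrite !exprMn mulrA.
Qed.

(** [S * T] has mean 0 and variance 1, so standardizing undoes an affine map of positive slope. *)
Lemma standardized_affine_walks s c : 0 < s ->
  standardized P (fun t => s * (S t * T t) + c) = (fun t => S t * T t).
Proof.
move=> s0; apply/funext => t.
rewrite /standardized /variance covariance.unlock walks_affine_expectation /=.
rewrite (_ : (_ * _)%R = (fun t => (s * (S t * T t)) ^+ 2)); last first.
  by apply/funext => w /=; rewrite /GRing.mul /= addrK expr2.
rewrite walks_sqr_expectation /= sqrtr_sqr gtr0_norm// addrK.
by rewrite mulrAC divff ?mul1r// gt_eqF.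
Qed.

End counts_of_letters.

Section fair_letters.
Context {R : realType} (disp : measure_display) (Omega : measurableType disp).
Implicit Types (m n : nat) (p q : R).

(** The identity is [X Y + (m - X) (n - Y) = m n / 2 + 2 (X - m / 2) (Y - n / 2)]; for fair letters
    the two differences are the centred counts, [sqrt m / 2] and [sqrt n / 2] times their walks. *)
Lemma D2_walks_half p q m n (A : 'I_m -> Omega -> bool) (B : 'I_n -> Omega -> bool) :
  p = 2^-1 -> q = 2^-1 -> (0 < m)%N -> (0 < n)%N ->
  D2 m n (zeros R A) (zeros R B) =
  (fun t => Num.sqrt m%:R * Num.sqrt n%:R / 2 * (count_walk p q A t * count_walk p q B t) +
    m%:R * n%:R / 2).
Proof.
move=> -> -> m0 n0; apply/funext => t; rewrite /D2.
have H k (L : 'I_k -> Omega -> bool) : (0 < k)%N ->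
    zeros R L t = k%:R / 2 + Num.sqrt k%:R / 2 * count_walk 2^-1 2^-1 L t.
  move=> k0; have kR : 0 < k%:R :> R by rewrite ltr0n.
  have h0 : 0 < 2^-1 :> R by rewrite invr_gt0.
  rewrite -standardized_count//; last by lra.
  rewrite (_ : k%:R / 2 / 2 = k%:R * 2^-1 ^+ 2); last by rewrite expr2 mulrA.
  rewrite sqrtrM ?(ltW kR)// sqrtr_sqr gtr0_norm//; field.
  by rewrite gt_eqF// sqrtr_gt0.
by rewrite (H _ A m0) (H _ B n0); field.
Qed.

Lemma mom3_half : mom (2^-1 : R) 2^-1 (Num.sqrt (2^-1 / 2^-1)) (- Num.sqrt (2^-1 / 2^-1)) 3 = 0.
Proof. by rewrite divff ?invr_eq0// sqrtr1 /mom; ring. Qed.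

Lemma mom4_half : mom (2^-1 : R) 2^-1 (Num.sqrt (2^-1 / 2^-1)) (- Num.sqrt (2^-1 / 2^-1)) 4 = 1.
Proof. by rewrite divff ?invr_eq0// sqrtr1 /mom; field. Qed.

End fair_letters.

Theorem theorem3p12 (R : realType)
    (d : measure_display) (Omega : measurableType d) (P : probability Omega R)
    (d' : measure_display) (Omega' : measurableType d')
    (Q : probability Omega' R)
    (m n : nat) (p q : R)
    (A : 'I_m -> {RV P >-> bool}) (B : 'I_n -> {RV P >-> bool})
    (V : {RV Q >-> R})
    (m_ge1 : (1 <= m)%N) (n_ge1 : (1 <= n)%N)
    (p_gt0 : 0 < p) (p_lt1 : p < 1) (pq1 : p + q = 1)
    (AB : independent_letter_sequences p q A B)
    (V_law : has_VG1010_law V) :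
  let X : Omega -> R := zeros R A in
  let Y : Omega -> R := zeros R B in
  let Dstar : Omega -> R := D2star p q m n X Y in
  let Dz : Omega -> R := standardized P (D2 m n X Y) in
  (forall h : R -> R, Cb 4 h ->
    (`| 'E_P[h \o Dstar] - 'E_Q[h \o V] | <=
     ((179 + 4411 * `| Num.sqrt (q / p) - Num.sqrt (p / q) |) *
      (q ^+ 4 / p ^+ 3 + p ^+ 4 / q ^+ 3) *
      (m%:R^-1 + n%:R^-1))%:E *
     (supnorm (derive1n 4 h) + 6%:E * supnorm (derive1n 3 h) + 7%:E * supnorm (derive1n 2 h)
      + supnorm (derive1n 1 h)))%E) /\
  (p = 2^-1 -> q = 2^-1 ->
    Dz = Dstar /\
    forall h : R -> R, Cb 3 h ->
      (`| 'E_P[h \o Dstar] - 'E_Q[h \o V] | <=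
       (193 * (m%:R^-1 + n%:R^-1))%:E *
       (supnorm (derive1n 3 h) + 3%:E * supnorm (derive1n 2 h) + supnorm (derive1n 1 h)))%E /\
      (`| 'E_P[h \o Dz] - 'E_Q[h \o V] | <=
       (193 * (m%:R^-1 + n%:R^-1))%:E *
       (supnorm (derive1n 3 h) + 3%:E * supnorm (derive1n 2 h) + supnorm (derive1n 1 h)))%E).
Proof.
have q_gt0 : 0 < q by move: p_lt1; rewrite -pq1; lra.
move=> X Y Dstar Dz.
have DstarE := D2star_walks A B m_ge1 n_ge1 p_gt0 q_gt0 pq1.
have [[dm0 md] [dn0 nd]] := (inv_sqrt_step (R := R) m_ge1, inv_sqrt_step (R := R) n_ge1).
have mean0 := letter_mean p_gt0 q_gt0.
have var1 := letter_var p_gt0 q_gt0 pq1.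
have K0 : 0 <= m%:R^-1 + n%:R^-1 :> R by rewrite addr_ge0 ?invr_ge0.
have EP h : ('E_P[h \o Dstar])%E = _ := etrans (congr1 (fun D => 'E_P[h \o D]%E) DstarE)
  (walks_expectation AB (fun x y => h (x * y))).
split=> [h Ch|p2 q2].
  have [b1 [E1 b10 h1]] := Cb_supnormE Ch (isT : (0 < 1 <= 4)%N).
  have [b2 [E2 b20 h2]] := Cb_supnormE Ch (isT : (0 < 2 <= 4)%N).
  have [b3 [E3 b30 h3]] := Cb_supnormE Ch (isT : (0 < 3 <= 4)%N).
  have [b4 [E4 b40 h4]] := Cb_supnormE Ch (isT : (0 < 4 <= 4)%N).
  have hg x := Cb_sqr_growth x Ch.
  have := product_clt_general (ltW p_gt0) (ltW q_gt0) pq1 mean0 var1 dm0 dn0 m_ge1 n_ge1 md nd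
    (Cb_Ck Ch) (h2 isT) (h3 isT).
  rewrite (inv_sqrt_steps (R := R) m n).
  have [F0 C2 C3] := constants_le p_gt0 q_gt0 pq1.
  have EQ := expectation_VG V_law (Ck_le (isT : (2 <= 3)%N) (Cb_Ck Ch)) hg.
  have -> : (supnorm (derive1n 4 h) + 6%:E * supnorm (derive1n 3 h) + 7%:E * supnorm (derive1n 2 h) +
      supnorm (derive1n 1 h) = (b4 + 6 * b3 + 7 * b2 + b1)%:E)%E.
    by rewrite !EFinD !EFinM -E1 -E2 -E3 -E4.
  rewrite (EP h) EQ -EFinB abse_EFin -EFinM lee_fin => H; apply: (le_trans H).
  rewrite [leRHS]mulrAC [leRHS]mulrC; apply: ler_wpM2l => //; rewrite -[leRHS]mulrA.
  move: F0 C2 C3; move: (q ^+ 4 / p ^+ 3 + p ^+ 4 / q ^+ 3) => F F0 C2 C3.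
  apply: (le_trans (lerD (ler_wpM2r b20 C2) (ler_wpM2r b30 C3))).
  (* [1253 b2 + 1074 b3] is [179 (7 b2 + 6 b3)]; the terms in [b1], in [b4] and then in 4411 are
     nonnegative and are simply added. *)
  apply: (@le_trans _ _ (179 * (F * (b4 + 6 * b3 + 7 * b2 + b1)))).
    have := mulr_ge0 F0 b10; have := mulr_ge0 F0 b40; lra.
  apply: ler_wpM2r; first by rewrite mulr_ge0// !addr_ge0 ?mulr_ge0.
  have := normr_ge0 (Num.sqrt (q / p) - Num.sqrt (p / q)).
  by move: `| _ | => r r0; clear -r0; lra.
have DzE : Dz = Dstar.
  rewrite /Dz [RHS]DstarE (D2_walks_half A B p2 q2 m_ge1 n_ge1).
  by apply: standardized_affine_walks => //; rewrite divr_gt0 ?mulr_gt0 ?sqrtr_gt0 ?ltr0n.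
split=> // h Ch; rewrite DzE.
suff H : (`| 'E_P[h \o Dstar] - 'E_Q[h \o V] | <= (193 * (m%:R^-1 + n%:R^-1))%:E *
       (supnorm (derive1n 3 h) + 3%:E * supnorm (derive1n 2 h) + supnorm (derive1n 1 h)))%E.
  by [].
have [b1 [E1 b10 h1]] := Cb_supnormE Ch (isT : (0 < 1 <= 3)%N).
have [b2 [E2 b20 h2]] := Cb_supnormE Ch (isT : (0 < 2 <= 3)%N).
have [b3 [E3 b30 h3]] := Cb_supnormE Ch (isT : (0 < 3 <= 3)%N).
have hg x := Cb_sqr_growth x Ch.
have M3 : mom p q (Num.sqrt (q / p)) (- Num.sqrt (p / q)) 3 = 0 by rewrite p2 q2 mom3_half.
have M4 : mom p q (Num.sqrt (q / p)) (- Num.sqrt (p / q)) 4 = 1 by rewrite p2 q2 mom4_half.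
have := product_clt_symmetric (ltW p_gt0) (ltW q_gt0) pq1 mean0 var1 dm0 dn0 m_ge1 n_ge1 md nd
  M3 M4 (Cb_Ck Ch) (h2 isT).
rewrite (inv_sqrt_steps (R := R) m n) (EP h) (expectation_VG V_law (Cb_Ck Ch) hg).
have -> : (supnorm (derive1n 3 h) + 3%:E * supnorm (derive1n 2 h) + supnorm (derive1n 1 h) =
    (b3 + 3 * b2 + b1)%:E)%E.
  by rewrite !EFinD !EFinM -E1 -E2 -E3.
rewrite -EFinB abse_EFin -EFinM lee_fin => H; apply: (le_trans H).
(* What was proved is a bound by [39 * b2], and [39 <= 193 * 3]. *)
rewrite mulrAC [leRHS]mulrAC; apply: ler_wpM2r => //; lra.
Qed.
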